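(* Let $M\subset\mathbb{C}^m$ be a complete Lagrangian translating soliton with $0\in M$, translating in direction of a unit vector $V\in\mathbb{C}^m$, and with bounded second fundamental form. Define functions on $M$ by $y(p):=\langle V,p\rangle$ and $\alpha(p):=x(p):=\langle -JV,p\rangle$ for $p\in M$, and suppose that $\cos\alpha\ge\epsilon>0$ on $M$ for some constant $\epsilon$. Then the coordinate function $y$ is unbounded from above and unbounded from below on $M$.
   Context: $\mathbb{C}^m$ carries its standard complex structure $J$, Euclidean inner product $\langle\cdot,\cdot\rangle$ and Kähler form $\omega$. A submanifold $M\subset\mathbb{C}^m$ is Lagrangian if $\dim M=m$ and $\omega|_M=0$. Complete means complete with respect to the induced metric. $H$ denotes the mean curvature vector (the trace of the second fundamental tensor). A translating soliton (for the mean curvature flow) translating in direction of the constant unit vector $V$ is a submanifold satisfying $H=V^\perp$, where $V^\perp$ is the normal part of $V$ along the submanifold. Bounded second fundamental form means that the norm $|A|$ of the second fundamental tensor is bounded on $M$. *)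

(* Defs.v *)
From HB Require Import structures.
From mathcomp Require Import all_boot all_order all_algebra.
From mathcomp Require Import all_classical all_reals all_analysis.
Set Implicit Arguments.
Unset Strict Implicit.
Unset Printing Implicit Defensive.
Import Order.TTheory GRing.Theory Num.Theory.
Import numFieldNormedType.Exports.
Local Open Scope classical_set_scope.
Local Open Scope ring_scope.

(* C^m as a real vector space: the pair (a, b) stands for a + i b.  The
   topology is the product topology; the library norm on this type is a sup
   norm, so the Euclidean norm [enorm] is defined separately. *)
Notation Cspace R m := ('rV[R]_m * 'rV[R]_m)%type.

Section HermitianSpace.
Context {R : realType} {m : nat}.
Implicit Types z w : Cspace R m.

Definition Jmul z : Cspace R m := (- z.2, z.1).

Definition dot z w : R :=
  \sum_(i < m) (z.1 0 i * w.1 0 i + z.2 0 i * w.2 0 i).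

Definition enorm z : R := Num.sqrt (dot z z).

Definition kaehler z w : R := dot (Jmul z) w.

End HermitianSpace.

Section Smooth.
Context {R : realType} {U V : normedModType R}.

Fixpoint Cr_on (r : nat) (W : set U) (f : U -> V) : Prop :=
  match r with
  | 0 => forall x, W x -> {for x, continuous f}
  | r'.+1 => (forall x, W x -> differentiable f x) /\
             (forall v : U, Cr_on r' W (fun x => 'D_v f x))
  end.

Definition smooth_on (W : set U) (f : U -> V) : Prop := forall r, Cr_on r W f.

End Smooth.

Section LocalGeometry.
Context {R : realType} {k m : nat}.
Implicit Types (phi : 'rV[R]_k -> Cspace R m) (x : 'rV[R]_k).

Definition partial (i : 'I_k) phi x : Cspace R m := 'D_(delta_mx 0 i) phi x.

Definition metric phi x : 'M[R]_k :=
  \matrix_(i, j) dot (partial i phi x) (partial j phi x).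

Definition imetric phi x : 'M[R]_k := invmx (metric phi x).

Definition tangent_part phi x (X : Cspace R m) : Cspace R m :=
  \sum_(i < k) \sum_(j < k)
    (imetric phi x i j * dot X (partial j phi x)) *: partial i phi x.

Definition normal_part phi x (X : Cspace R m) : Cspace R m :=
  X - tangent_part phi x X.

Definition second_form phi x (i j : 'I_k) : Cspace R m :=
  normal_part phi x (partial i (partial j phi) x).

Definition mean_curvature phi x : Cspace R m :=
  \sum_(i < k) \sum_(j < k) imetric phi x i j *: second_form phi x i j.

Definition second_form_norm phi x : R :=
  Num.sqrt (\sum_(i < k) \sum_(j < k) \sum_(p < k) \sum_(q < k)
    imetric phi x i p * imetric phi x j q *
    dot (second_form phi x i j) (second_form phi x p q)).

End LocalGeometry.

Section Submanifold.
Context {R : realType} {m : nat} {M : topologicalType}.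
Variable F : M -> Cspace R m.

(* [psi], restricted to the open set [W] of R^k, is a homeomorphism onto an
   open subset of [M] in which [F] reads as a smooth immersion.  Since [F]
   becomes a local embedding, two such parametrizations automatically differ
   by a diffeomorphism: [F] determines the smooth structure of [M]. *)
Definition parametrization (k : nat) (W : set 'rV[R]_k) (psi : 'rV[R]_k -> M)
    : Prop :=
  [/\ open W,
      {in W &, injective psi},
      (forall x, W x -> {for x, continuous psi}),
      (forall O, open O -> O `<=` W -> open (psi @` O)) &
      smooth_on W (F \o psi) /\
      (forall x, W x -> injective ('d (F \o psi) x))].

(* An immersed submanifold of dimension [k]; an embedded one is the case where
   [M] is a subspace of C^m and [F] the inclusion. *)
Definition submanifold (k : nat) : Prop :=
  [/\ hausdorff_space M, @second_countable M &
      forall p : M, exists (W : set 'rV[R]_k) (psi : 'rV[R]_k -> M),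
        parametrization W psi /\ (psi @` W) p].

(* The conditions below are invariant under change of parametrization, and are
   required in all of them. *)

Definition lagrangian : Prop :=
  submanifold m /\
  forall (W : set 'rV[R]_m) (psi : 'rV[R]_m -> M), parametrization W psi ->
  forall x, W x -> forall v w : 'rV[R]_m,
    kaehler ('D_v (F \o psi) x) ('D_w (F \o psi) x) = 0.

Definition translating_soliton (k : nat) (V : Cspace R m) : Prop :=
  forall (W : set 'rV[R]_k) (psi : 'rV[R]_k -> M), parametrization W psi ->
  forall x, W x ->
    mean_curvature (F \o psi) x = normal_part (F \o psi) x V.

Definition bounded_second_form (k : nat) : Prop :=
  exists K : R,
  forall (W : set 'rV[R]_k) (psi : 'rV[R]_k -> M), parametrization W psi ->
  forall x, W x -> second_form_norm (F \o psi) x <= K.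

(* As [F] is locally an embedding, a continuous [c] is C^1 in [M] as soon as
   [F \o c] is.  Asking for c to be defined and C^1 on all of R, while only
   its restriction to [0, 1] is used, costs nothing: M has no boundary. *)
Definition C1_arc (c : R -> M) : Prop :=
  [/\ continuous c,
      (forall t, derivable (F \o c) t 1) &
      continuous (derive1 (F \o c))].

Definition arc_length (c : R -> M) : \bar R :=
  (\int[lebesgue_measure]_(t in `[0%R, 1%R]) (enorm (derive1 (F \o c) t))%:E)%E.

(* Piecewise C^1 curves from [p] to [q], as chains of C^1 arcs on [0, 1]. *)
Fixpoint piecewise_C1 (p : M) (s : seq (R -> M)) (q : M) : Prop :=
  match s with
  | [::] => p = q
  | c :: s' => [/\ C1_arc c, c 0 = p & piecewise_C1 (c 1) s' q]
  end.

(* Distance of the induced metric; +oo between different components. *)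
Definition idist (p q : M) : \bar R :=
  ereal_inf [set (\sum_(c <- s) arc_length c)%E
            | s in [set s | piecewise_C1 p s q]].

Definition complete_submanifold : Prop :=
  forall u : nat -> M,
    (forall e : R, 0 < e -> exists N : nat, forall i j : nat,
       (N <= i)%N -> (N <= j)%N -> (idist (u i) (u j) < e%:E)%E) ->
    exists p : M, forall e : R, 0 < e -> exists N : nat, forall n : nat,
       (N <= n)%N -> (idist (u n) p < e%:E)%E.

End Submanifold.

(* Main.v *)
Require Import Defs.
From HB Require Import structures.
From mathcomp Require Import all_boot all_order all_algebra.
From mathcomp Require Import all_classical all_reals all_analysis measurable_realfun.
From mathcomp Require Import ring lra.
Set Implicit Arguments.
Unset Strict Implicit.
Unset Printing Implicit Defensive.
Import Order.TTheory GRing.Theory Num.Theory.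
Import numFieldNormedType.Exports.
Local Open Scope classical_set_scope.
Local Open Scope ring_scope.

(** Let x = <-JV, F>, y = <V, F> and let L = Delta + <V, grad> be the drift
    Laplacian of the soliton.  Since Delta F = H = V^perp, one has L y = 1 and
    L x = 0; since the tangent planes are Lagrangian, J exchanges tangent and
    normal vectors, so |grad x|^2 = |V^perp|^2 = 1 - |grad y|^2.

    Suppose that functions bounded above have almost maxima, where the gradient
    is small and L is at most a small positive number.  Then y is not bounded
    above, because L y = 1.  If y were bounded below, the function
    g = -a y - log cos (a x) would be bounded above, where a > 1 is so close to 1
    that a x stays in a compact part of (-pi/2, pi/2).  With T = tan (a x),
      grad g = a (- grad y + T grad x),
      L g = - a + a^2 (1 + T^2) |grad x|^2.
    Where grad g is small, 1 = |grad x|^2 + |grad y|^2 is close to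
    (1 + T^2) |grad x|^2, so that L g is close to a^2 - a > 0: this contradicts
    the choice of an almost maximum ([tangent_secant_contradiction]).

    Almost maxima ([almost_maximum]) are true maxima of g - c |F - F p|^2 near
    a point p where g almost attains its supremum.  All the functions involved
    are restrictions of functions h of the ambient space, so the intrinsic
    Laplacian is never formed: at a critical point, L h is the trace of the
    second derivative of h over the tangent plane, plus <grad h, V>
    ([maximum_trace]).

    For such a maximum to exist, p needs a compact neighbourhood whose boundary
    is at a distance r from p, with r independent of p.  This is where
    completeness and the bound for the second fundamental form enter
    ([uniform_graph]): near p the submanifold is the graph of a map over the
    ball of radius r of its tangent plane at p.  A differential inequality
    along rays bounds the slope of any such graph ([slope_bound]).  The graph
    over a small ball comes from the inverse function theorem
    ([inverse_function], [local_section]).  It is continued along rays: the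
    slope bound makes the lift of a ray a curve of finite length, completeness
    gives it an end point, the slope bound passes to the tangent plane there,
    and the inverse function theorem applies again ([reach_limit]).  That
    sequences converging for the intrinsic distance converge in the manifold
    is [idist_lt_nbhs]. *)

(** * Euclidean geometry of complex space *)

Section EuclideanAlgebra.
Context {R : realType} {m : nat}.
Implicit Types z w u : Cspace R m.

Lemma dotC z w : dot z w = dot w z.
Proof. by apply: eq_bigr => i _; rewrite mulrC [X in _ + X]mulrC. Qed.

Lemma dotDl z w u : dot (z + w) u = dot z u + dot w u.
Proof. by rewrite -big_split; apply: eq_bigr => i _; rewrite /= !mxE; ring. Qed.

Lemma dotZl (a : R) z u : dot (a *: z) u = a * dot z u.
Proof. by rewrite mulr_sumr; apply: eq_bigr => i _; rewrite /= !mxE; ring. Qed.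

Lemma dotDr z w u : dot u (z + w) = dot u z + dot u w.
Proof. by rewrite dotC dotDl !(dotC u). Qed.

Lemma dotZr (a : R) z u : dot u (a *: z) = a * dot u z.
Proof. by rewrite dotC dotZl (dotC u). Qed.

Lemma dotNl z u : dot (- z) u = - dot z u.
Proof. by rewrite -scaleN1r dotZl mulN1r. Qed.

Lemma dotNr z u : dot u (- z) = - dot u z.
Proof. by rewrite dotC dotNl dotC. Qed.

Lemma dotBl z w u : dot (z - w) u = dot z u - dot w u.
Proof. by rewrite dotDl dotNl. Qed.

Lemma dotBr z w u : dot u (z - w) = dot u z - dot u w.
Proof. by rewrite dotDr dotNr. Qed.

Lemma dot0l u : dot 0 u = 0.
Proof. by rewrite -(scale0r u) dotZl mul0r. Qed.

Lemma dot0r u : dot u 0 = 0.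
Proof. by rewrite dotC dot0l. Qed.

Lemma dot_suml (I : Type) (r : seq I) (P : pred I) (f : I -> Cspace R m) u :
  dot (\sum_(i <- r | P i) f i) u = \sum_(i <- r | P i) dot (f i) u.
Proof. by apply: (big_morph (fun z => dot z u)) => [a b|]; rewrite ?dotDl ?dot0l. Qed.

Lemma dot_sumr (I : Type) (r : seq I) (P : pred I) (f : I -> Cspace R m) u :
  dot u (\sum_(i <- r | P i) f i) = \sum_(i <- r | P i) dot u (f i).
Proof. by rewrite dotC dot_suml; apply: eq_bigr => i _; rewrite dotC. Qed.

Lemma dot_ge0 z : 0 <= dot z z.
Proof. by apply: sumr_ge0 => i _; rewrite -!expr2 addr_ge0 ?sqr_ge0. Qed.

Lemma dot_eq0 z : dot z z = 0 -> z = 0.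
Proof.
move=> /psumr_eq0P; rewrite (surjective_pairing z) => h.
have {}h i : z.1 0 i = 0 /\ z.2 0 i = 0.
  have /(_ i isT) /= : forall j, true -> z.1 0 j * z.1 0 j + z.2 0 j * z.2 0 j = 0.
    by apply: h => j _; rewrite -!expr2 addr_ge0 ?sqr_ge0.
  by move=> e; split; nra.
by congr pair; apply/rowP => i; rewrite mxE; case: (h i).
Qed.

Lemma cauchy_schwarz z w : dot z w ^+ 2 <= dot z z * dot w w.
Proof.
have [->|w0] := eqVneq w 0; first by rewrite !dot0r mulr0 expr0n.
have ww : 0 < dot w w.
  by rewrite lt_neqAle dot_ge0 andbT eq_sym; apply: contra_neq w0 => /dot_eq0.
have := dot_ge0 (dot w w *: z - dot z w *: w).
rewrite !(dotBl, dotBr, dotZl, dotZr) (dotC w z) => h.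
rewrite -subr_ge0 -(pmulr_rge0 _ ww); apply: le_trans h _.
by rewrite le_eqVlt; apply/orP; left; apply/eqP; ring.
Qed.

Lemma enorm_ge0 z : 0 <= enorm z. Proof. exact: sqrtr_ge0. Qed.

Lemma enorm_sqr z : enorm z ^+ 2 = dot z z.
Proof. by rewrite sqr_sqrtr // dot_ge0. Qed.

Lemma dot_le_enorm z w : `|dot z w| <= enorm z * enorm w.
Proof.
rewrite -(ler_pXn2r (_ : 0 < 2)%N) ?nnegrE ?mulr_ge0 ?enorm_ge0 //.
by rewrite exprMn !enorm_sqr real_normK ?num_real // cauchy_schwarz.
Qed.

Lemma enormZ (a : R) z : enorm (a *: z) = `|a| * enorm z.
Proof. by rewrite /enorm dotZl dotZr mulrA sqrtrM ?sqr_ge0 // -expr2 sqrtr_sqr. Qed.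

Lemma enormN z : enorm (- z) = enorm z.
Proof. by rewrite -scaleN1r enormZ normrN1 mul1r. Qed.

Lemma enorm0 : enorm (0 : Cspace R m) = 0.
Proof. by rewrite /enorm dot0l sqrtr0. Qed.

Lemma ler_enormD z w : enorm (z + w) <= enorm z + enorm w.
Proof.
rewrite -(ler_pXn2r (_ : 0 < 2)%N) ?nnegrE ?addr_ge0 ?enorm_ge0 //.
rewrite enorm_sqr sqrrD !enorm_sqr dotDl !dotDr (dotC w z).
have := le_trans (ler_norm _) (dot_le_enorm z w); lra.
Qed.

Lemma ler_enorm_sum (I : Type) (r : seq I) (P : pred I) (f : I -> Cspace R m) :
  enorm (\sum_(i <- r | P i) f i) <= \sum_(i <- r | P i) enorm (f i).
Proof.
elim/big_ind2: _ => [|a b c d h1 h2|//]; first by rewrite enorm0.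
by apply: le_trans (ler_enormD _ _) _; rewrite lerD.
Qed.

Lemma coord_le_norm (n : nat) (v : 'rV[R]_n) i : `|v 0 i| <= `|v|.
Proof. by rewrite [leRHS]/Num.Def.normr/= mx_normrE; apply: (le_bigmax _ _ (0, i)). Qed.

Lemma norm_le_coord (n : nat) (v : 'rV[R]_n) (c : R) : 0 <= c ->
  (forall i, `|v 0 i| <= c) -> `|v| <= c.
Proof.
move=> c0 h; rewrite [leLHS]/Num.Def.normr/= mx_normrE.
by apply: bigmax_le => // -[i j] _ /=; rewrite ord1.
Qed.

Lemma enorm_le_norm z : enorm z <= (2 * m)%:R * `|z|.
Proof.
have zi i : `|z.1 0 i| <= `|z| /\ `|z.2 0 i| <= `|z|.
  by split; [apply: le_trans (coord_le_norm z.1 i) _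
            |apply: le_trans (coord_le_norm z.2 i) _];
     rewrite [leRHS]/Num.Def.normr /= le_max lexx ?orbT.
rewrite -(ler_pXn2r (_ : 0 < 2)%N) ?nnegrE ?mulr_ge0 ?enorm_ge0 //.
rewrite enorm_sqr exprMn; apply: (@le_trans _ _ ((2 * m)%:R * `|z| ^+ 2)).
  have -> : (2 * m)%:R * `|z| ^+ 2 = \sum_(i < m) 2 * `|z| ^+ 2.
    by rewrite sumr_const card_ord -mulr_natl natrM; ring.
  apply: ler_sum => i _; have [h1 h2] := zi i.
  rewrite mulr_natl mulr2n -!expr2 -(real_normK (num_real (z.1 0 i))).
  by rewrite -(real_normK (num_real (z.2 0 i))) lerD // ler_pXn2r ?nnegrE.
rewrite ler_wpM2r ?sqr_ge0 // -natrX ler_nat.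
by case: m => [|n]; rewrite ?muln0 // mulnS -[X in (X <= _)%N]expn1 leq_pexp2l.
Qed.

Lemma Jmul_dot z w : dot (Jmul z) (Jmul w) = dot z w.
Proof. by apply: eq_bigr => i _; rewrite /= !mxE; ring. Qed.

Lemma dot_Jmul_self z : dot (Jmul z) z = 0.
Proof. by apply: big1 => i _; rewrite /= !mxE; ring. Qed.

Lemma dot_JmulC z w : dot (Jmul z) w = - dot z (Jmul w).
Proof. by rewrite -sumrN; apply: eq_bigr => i _; rewrite /= !mxE; ring. Qed.

(** An orthonormal basis of a Lagrangian plane and its image under [Jmul] form
    an orthonormal basis of the whole space. *)
Lemma lagrangian_parseval (E : 'I_m -> Cspace R m) :
  (forall a b, dot (E a) (E b) = (a == b)%:R) ->
  (forall a b, dot (Jmul (E a)) (E b) = 0) ->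
  forall X, \sum_a dot X (E a) ^+ 2 + \sum_a dot (Jmul X) (E a) ^+ 2 = dot X X.
Proof.
move=> onE lagE X.
pose row (z : Cspace R m) := row_mx z.1 z.2.
have dotE z w : dot z w = (row z *m (row w)^T) 0 0.
  rewrite mxE big_split_ord /= /dot big_split /=.
  by congr (_ + _); apply: eq_bigr => i _; rewrite [X in _ = _ * X]mxE ?row_mxEl ?row_mxEr.
pose EQ : 'M[R]_(m, m + m) := \matrix_a row (E a).
pose JQ : 'M[R]_(m, m + m) := \matrix_a row (Jmul (E a)).
pose Q := col_mx EQ JQ.
have mxd (f g : 'I_m -> Cspace R m) :
    (\matrix_a row (f a)) *m (\matrix_a row (g a))^T =
    \matrix_(a, b) dot (f a) (g b).
  apply/matrixP => a b; rewrite mxE [RHS]mxE dotE mxE; apply: eq_bigr => k _.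
  by rewrite [X in X * _ = _]mxE [X in _ * X = _]mxE [X in _ * X = _]mxE [X in _ = _ * X]mxE.
have Q1 : Q *m Q^T = 1%:M.
  rewrite tr_col_mx mul_col_row !mxd (scalar_mx_block m m 1).
  by congr block_mx; apply/matrixP => a b; rewrite !mxE ?Jmul_dot ?onE ?lagE //
    dotC lagE.
have Q2 : Q^T *m Q = 1%:M by apply: mulmx1C.
have cE (f : 'I_m -> Cspace R m) a :
    (row X *m (\matrix_a row (f a))^T) 0 a = dot X (f a).
  rewrite dotE !mxE; apply: eq_bigr => k _.
  by rewrite [X in _ * X = _]mxE [X in _ * X = _]mxE [X in _ = _ * X]mxE.
have -> : dot X X = ((row X *m Q^T) *m (row X *m Q^T)^T) 0 0.
  by rewrite trmx_mul trmxK -mulmxA (mulmxA Q^T) Q2 mul1mx dotE.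
rewrite tr_col_mx mul_mx_row tr_row_mx mul_row_col !mxE.
congr (_ + _); apply: eq_bigr => a _; rewrite [X in _ * X]mxE /EQ /JQ cE -expr2 //.
by rewrite dot_JmulC sqrrN.
Qed.

End EuclideanAlgebra.

(** * Orthonormal frames and the second fundamental form *)

Section Orthonormalisation.
Context {R : realType}.

(** Cholesky factorisation, by elimination of the first variable. *)
Lemma posdef_orthonormalise (k : nat) (G : 'M[R]_k) : G^T = G ->
  (forall v : 'rV[R]_k, v != 0 -> 0 < (v *m G *m v^T) 0 0) ->
  exists P : 'M[R]_k, P *m G *m P^T = 1%:M.
Proof.
elim: k G => [|k IH] G; first by move=> _ _; exists 1%:M; apply/matrixP => -[].
rewrite -[k.+1]/(1 + k)%N in G *.
pose a := G 0 0; pose b : 'rV[R]_k := ursubmx G; pose D : 'M[R]_k := drsubmx G.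
move=> symG posG.
have addE (A B : 'M[R]_1) : (A + B) 0 0 = A 0 0 + B 0 0 by rewrite mxE.
have z0E : (0 : 'M[R]_1) 0 0 = 0 by rewrite mxE.
have scaleE c (A : 'M[R]_1) : (c *: A) 0 0 = c * A 0 0 by rewrite mxE.
have GE : G = block_mx a%:M b b^T D.
  rewrite -[LHS]submxK; congr block_mx; last by rewrite trmx_ursub symG.
  by apply/matrixP => i j; rewrite !ord1 !mxE /a mulr1n; congr (G _ _); apply/val_inj.
have quadE (s : R) (v : 'rV[R]_k) :
    (row_mx s%:M v *m G *m (row_mx s%:M v)^T) 0 0 =
    a * s ^+ 2 + 2 * s * (v *m b^T) 0 0 + (v *m D *m v^T) 0 0.
  rewrite GE mul_row_block tr_row_mx mul_row_col !mulmxDl.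
  have bv : (b *m v^T) 0 0 = (v *m b^T) 0 0.
    by rewrite -[b in LHS]trmxK -trmx_mul mxE.
  rewrite tr_scalar_mx !mul_scalar_mx !mul_mx_scalar -!scalemxAl !addE !scaleE bv.
  rewrite [a%:M 0 0]mxE mulr1n.
  ring.
have a0 : 0 < a.
  have := posG (row_mx 1%:M 0); rewrite quadE !mul0mx !z0E expr1n mulr1 mulr0 !addr0.
  apply; apply/eqP => /(congr1 lsubmx); rewrite row_mxKl => /matrixP/(_ 0 0).
  by rewrite !mxE /= => /eqP; rewrite oner_eq0.
have an0 : a != 0 by rewrite gt_eqF.
pose S := D - a^-1 *: (b^T *m b).
have [||Q QS] := IH S.
- by rewrite /S linearB linearZ /= trmx_mul trmxK /D trmx_drsub symG.
- move=> v v0; pose s := - a^-1 * (v *m b^T) 0 0.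
  have := posG (row_mx s%:M v); rewrite quadE => /(_ _)/lt_le_trans; apply.
    by apply/eqP => /(congr1 rsubmx); rewrite row_mxKr linear0; apply/eqP.
  have bv : (v *m (b^T *m b) *m v^T) 0 0 = (v *m b^T) 0 0 ^+ 2.
    rewrite !mulmxA -mulmxA mxE big_ord1 expr2; congr (_ * _).
    by rewrite -[b in LHS]trmxK -trmx_mul mxE.
  rewrite /S mulmxBr mulmxBl -scalemxAr -scalemxAl [leRHS]mxE [X in _ <= _ + X]mxE.
  rewrite [X in _ <= _ - X]mxE bv /s le_eqVlt; apply/orP; left; apply/eqP.
  by field.
pose t := (Num.sqrt a)^-1.
have tt : t * (t * a) = 1.
  by rewrite mulrA -expr2 /t exprVn sqr_sqrtr ?ltW // mulVf.
exists (block_mx t%:M 0 (- a^-1 *: (Q *m b^T)) Q).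
rewrite GE mulmx_block tr_block_mx mulmx_block (scalar_mx_block 1 k).
rewrite !tr_scalar_mx !trmx0 !mul0mx !mulmx0 !addr0 ?mul_mx_scalar.
have -> : a *: (- a^-1 *: (Q *m b^T)) + Q *m b^T = 0.
  by rewrite scalerA mulrN divff // scaleN1r addNr.
rewrite !mul0mx ?add0r !linearZ /= trmx_mul trmxK.
have -> : - a^-1 *: (Q *m b^T) *m b + Q *m D = Q *m S.
  by rewrite /S mulmxBr -scalemxAr mulmxA addrC -scalemxAl scaleNr.
rewrite QS; congr block_mx.
- by apply/matrixP => i j; rewrite !ord1 !mxE /= mulr1n -tt; ring.
- rewrite -scalemxAl scalerA mulNr mulVf // scaleN1r -mulmxA.
  by rewrite addNr.
- by rewrite scaler0.
Qed.

(** The Gram matrix G of the family satisfies P G P^T = 1, which says both that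
    the rows of P are the coordinates of an orthonormal family and that
    G^-1 = P^T P.  Contractions with the inverse metric thereby become sums over
    an orthonormal frame. *)
Lemma orthonormal_frame (m k : nat) (b : 'I_k -> Cspace R m) :
  (forall v : 'rV[R]_k, \sum_i v 0 i *: b i = 0 -> v = 0) ->
  exists P : 'M[R]_k,
    [/\ P \in unitmx,
        invmx (\matrix_(i, j) dot (b i) (b j)) = P^T *m P &
        forall a a', dot (\sum_i P a i *: b i) (\sum_i P a' i *: b i) = (a == a')%:R].
Proof.
move=> free_b; pose G := \matrix_(i, j) dot (b i) (b j).
have GE (v w : 'rV[R]_k) :
    (v *m G *m w^T) 0 0 = dot (\sum_i v 0 i *: b i) (\sum_i w 0 i *: b i).
  rewrite dot_sumr mxE; apply: eq_bigr => j _; rewrite dotZr dot_suml !mxE mulrC.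
  by congr (_ * _); apply: eq_bigr => i _; rewrite dotZl !mxE.
have [||P PGP] := @posdef_orthonormalise k G.
- by apply/matrixP => i j; rewrite !mxE dotC.
- move=> v v0; rewrite GE lt_neqAle dot_ge0 andbT eq_sym.
  by apply: contra_neq v0 => /dot_eq0 /free_b.
have [uPG uP] : (P *m G \in unitmx) /\ (P^T \in unitmx) by apply: mulmx1_unit.
have uP' : P \in unitmx by rewrite unitmx_tr in uP.
exists P; split => //.
  have GPP : G *m (P^T *m P) = 1%:M.
    apply: (can_inj (mulKmx uP')).
    by rewrite !mulmxA PGP mul1mx mulmx1.
  have [uG _] := mulmx1_unit GPP.
  by apply: (can_inj (mulKmx uG)); rewrite GPP mulmxV.
move=> a a'; have /matrixP/(_ a a') := PGP; rewrite [1%:M _ _]mxE => <-.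
have -> : (P *m G *m P^T) a a' = (row a P *m G *m (row a' P)^T) 0 0.
  rewrite -row_mul !mxE; apply: eq_bigr => i _; rewrite !mxE //.
by rewrite GE; congr dot; apply: eq_bigr => i _; rewrite mxE.
Qed.

Section Frame.
Context {m k : nat}.
Variables (phi : 'rV[R]_k -> Cspace R m) (x : 'rV[R]_k) (P : 'M[R]_k).
Hypothesis PP : imetric phi x = P^T *m P.

Definition frame (a : 'I_k) := \sum_i P a i *: partial i phi x.

Lemma imetricE i j : imetric phi x i j = \sum_a P a i * P a j.
Proof. by rewrite PP mxE; apply: eq_bigr => a _; rewrite mxE. Qed.

Lemma tangent_part_frame X : tangent_part phi x X = \sum_a dot X (frame a) *: frame a.
Proof.
transitivity (\sum_i \sum_j \sum_a
    (P a i * P a j * dot X (partial j phi x)) *: partial i phi x).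
  apply: eq_bigr => i _; apply: eq_bigr => j _.
  by rewrite imetricE mulr_suml scaler_suml.
rewrite [RHS](eq_bigr (fun a => \sum_i \sum_j
    (P a i * P a j * dot X (partial j phi x)) *: partial i phi x)); last first.
  move=> a _; rewrite {2}/frame scaler_sumr; apply: eq_bigr => i _.
  rewrite /frame dot_sumr scaler_suml; apply: eq_bigr => j _.
  by rewrite dotZr scalerA; congr (_ *: _); ring.
rewrite [RHS]exchange_big; apply: eq_bigr => i _.
by rewrite [RHS]exchange_big.
Qed.

Definition frame_second_form (a b : 'I_k) :=
  \sum_i \sum_j (P a i * P b j) *: second_form phi x i j.

Lemma mean_curvature_frame :
  mean_curvature phi x = \sum_a frame_second_form a a.
Proof.
rewrite exchange_big; apply: eq_bigr => i _.
rewrite exchange_big; apply: eq_bigr => j _.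
by rewrite imetricE scaler_suml.
Qed.

Lemma second_form_norm_frame :
  second_form_norm phi x ^+ 2 =
  \sum_a \sum_b dot (frame_second_form a b) (frame_second_form a b).
Proof.
have E : \sum_(i < k) \sum_(j < k) \sum_(p < k) \sum_(q < k)
    imetric phi x i p * imetric phi x j q *
    dot (second_form phi x i j) (second_form phi x p q) =
  \sum_a \sum_b dot (frame_second_form a b) (frame_second_form a b).
  transitivity (\sum_(i < k) \sum_(j < k) \sum_(p < k) \sum_(q < k) \sum_a \sum_b
      dot ((P a i * P b j) *: second_form phi x i j)
          ((P a p * P b q) *: second_form phi x p q)).
    do 4!(apply: eq_bigr => ? _); rewrite !imetricE mulr_suml mulr_suml.
    apply: eq_bigr => a _; rewrite mulr_sumr mulr_suml; apply: eq_bigr => b _.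
    by rewrite dotZl dotZr; ring.
  pose T a b i j p q := dot ((P a i * P b j) *: second_form phi x i j)
          ((P a p * P b q) *: second_form phi x p q).
  transitivity (\sum_(u : 'I_k * 'I_k) \sum_(i < k) \sum_(j < k) \sum_(p < k) \sum_(q < k)
      T u.1 u.2 i j p q).
    do 4!(rewrite [RHS]exchange_big; apply: eq_bigr => ? _).
    by rewrite (pair_bigA _ (fun a b => T a b _ _ _ _)).
  rewrite [RHS](pair_bigA _ (fun a b => dot (frame_second_form a b) (frame_second_form a b))).
  apply: eq_bigr => -[a b] _ /=; rewrite dot_suml; apply: eq_bigr => i _.
  rewrite dot_suml; apply: eq_bigr => j _; rewrite dot_sumr; apply: eq_bigr => p _.
  by rewrite dot_sumr; apply: eq_bigr.
rewrite /second_form_norm E sqr_sqrtr //.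
by apply: sumr_ge0 => a _; apply: sumr_ge0 => b _; apply: dot_ge0.
Qed.

End Frame.

Lemma sum_cauchy_schwarz (I : finType) (s t : I -> R) :
  (\sum_i s i * t i) ^+ 2 <= (\sum_i s i ^+ 2) * (\sum_i t i ^+ 2).
Proof.
set S := \sum_i s i ^+ 2; set T := \sum_i t i ^+ 2; set B := \sum_i s i * t i.
have T0 : 0 <= T by apply: sumr_ge0 => i _; rewrite sqr_ge0.
have [Tz|Tn] := eqVneq T 0.
  have t0 i : t i = 0.
    have /psumr_eq0P -/(_ (fun i _ => sqr_ge0 _) i isT) := Tz.
    by move/eqP; rewrite sqrf_eq0 => /eqP.
  by rewrite /B big1 ?expr0n ?Tz ?mulr0 // => i _; rewrite t0 mulr0.
have : 0 <= \sum_i (T * s i - B * t i) ^+ 2 by apply: sumr_ge0 => i _; rewrite sqr_ge0.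
have -> : \sum_i (T * s i - B * t i) ^+ 2 = T * (S * T - B ^+ 2).
  transitivity (\sum_i (T ^+ 2 * s i ^+ 2 + - 2 * T * B * (s i * t i) + B ^+ 2 * t i ^+ 2)).
    by apply: eq_bigr => i _; ring.
  by rewrite !big_split /= -!mulr_sumr -/S -/T -/B; ring.
by rewrite pmulr_rge0 ?subr_ge0 // lt_neqAle eq_sym Tn.
Qed.

Lemma bilinear_component_bound (m k : nat) (A : Cspace R m)
  (S : 'I_k -> 'I_k -> Cspace R m) (c d : 'I_k -> R) :
  A = \sum_a \sum_b (c a * d b) *: S a b ->
  dot A A <= (\sum_a \sum_b dot (S a b) (S a b)) *
    ((\sum_a c a ^+ 2) * (\sum_a d a ^+ 2)).
Proof.
move=> AE.
set N := \sum_a \sum_b dot _ _; set Q := (\sum_a c a ^+ 2) * _.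
have N0 : 0 <= N by apply: sumr_ge0 => a _; apply: sumr_ge0 => b _; apply: dot_ge0.
have AA : dot A A = \sum_(u : 'I_k * 'I_k)
    (c u.1 * d u.2) * dot (S u.1 u.2) A.
  rewrite {1}AE dot_suml -(pair_bigA _ (fun a b =>
    (c a * d b) * dot (S a b) A)).
  apply: eq_bigr => a _; rewrite dot_suml; apply: eq_bigr => b _.
  by rewrite dotZl.
have QE : Q = \sum_(u : 'I_k * 'I_k) (c u.1 * d u.2) ^+ 2.
  rewrite -(pair_bigA _ (fun a b => (c a * d b) ^+ 2)) /Q mulr_suml.
  by apply: eq_bigr => a _; rewrite mulr_sumr; apply: eq_bigr => b _; rewrite exprMn.
have : dot A A ^+ 2 <= Q * (N * dot A A).
  rewrite {1}AA; apply: le_trans (sum_cauchy_schwarz _ _) _; rewrite -QE.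
  apply: ler_wpM2l; first by rewrite QE; apply: sumr_ge0 => u _; rewrite sqr_ge0.
  rewrite /N (pair_bigA _ (fun a b => dot (S a b) _)) mulr_suml.
  by apply: ler_sum => -[a b] _ /=; apply: cauchy_schwarz.
have [->|A0] := eqVneq (dot A A) 0.
  by move=> _; rewrite mulr_ge0 // QE; apply: sumr_ge0 => u _; rewrite sqr_ge0.
rewrite mulrA expr2 ler_pM2r; first by rewrite mulrC.
by rewrite lt_neqAle eq_sym A0 dot_ge0.
Qed.

(** In an orthonormal frame the norm of the second fundamental form is the
    Euclidean norm of its matrix of components. *)
Lemma second_form_le (m k : nat) (phi : 'rV[R]_k -> Cspace R m) (x : 'rV[R]_k) i j :
  (forall v : 'rV[R]_k, \sum_i v 0 i *: partial i phi x = 0 -> v = 0) ->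
  enorm (second_form phi x i j) <=
    second_form_norm phi x * (enorm (partial i phi x) * enorm (partial j phi x)).
Proof.
move=> /orthonormal_frame[P [uP PP onP]].
pose c i a := invmx P i a; pose E := frame phi x P.
have invP i' (f : 'I_k -> Cspace R m) : f i' = \sum_a c i' a *: (\sum_l P a l *: f l).
  transitivity (\sum_l (invmx P *m P) i' l *: f l).
    rewrite mulVmx // (bigD1 i') //= mxE eqxx scale1r big1 ?addr0 // => l li.
    by rewrite mxE eq_sym (negbTE li) scale0r.
  under eq_bigr => l _ do rewrite mxE scaler_suml.
  rewrite exchange_big; apply: eq_bigr => a _; rewrite scaler_sumr.
  by apply: eq_bigr => l _; rewrite scalerA.
have norm_partial i' : dot (partial i' phi x) (partial i' phi x) = \sum_a c i' a ^+ 2.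
  rewrite [partial i' phi x](invP i' (fun l => partial l phi x)) dot_suml.
  apply: eq_bigr => a _; rewrite dotZl dot_sumr (bigD1 a) //= dotZr onP eqxx mulr1.
  rewrite big1 ?addr0 ?expr2 // => b ba.
  by rewrite dotZr onP eq_sym (negbTE ba) mulr0.
set A := second_form phi x i j.
have AE : A = \sum_a \sum_b (c i a * c j b) *: frame_second_form phi x P a b.
  rewrite /A (invP i (fun l => second_form phi x l j)); apply: eq_bigr => a _.
  rewrite scaler_sumr.
  under eq_bigr => l _.
    rewrite (invP j (fun q => second_form phi x l q)) !scaler_sumr; over.
  rewrite exchange_big; apply: eq_bigr => b _.
  rewrite scaler_sumr; apply: eq_bigr => l _; rewrite !scaler_sumr.
  by apply: eq_bigr => q _; rewrite !scalerA; congr (_ *: _); ring.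
have aux (n s b d X Y : R) : 0 <= n -> 0 <= s -> 0 <= b -> 0 <= d -> n ^+ 2 = X ->
    s ^+ 2 * (b ^+ 2 * d ^+ 2) = Y -> X <= Y -> n <= s * (b * d).
  move=> n0 s0 b0 d0 <- <-.
  by rewrite -!exprMn ler_pXn2r ?nnegrE ?mulr_ge0.
have ni := etrans (enorm_sqr (partial i phi x)) (norm_partial i).
have nj := etrans (enorm_sqr (partial j phi x)) (norm_partial j).
exact: (aux _ _ _ _ _ _ (enorm_ge0 A) (sqrtr_ge0 _) (enorm_ge0 _) (enorm_ge0 _)
  (enorm_sqr A) (congr2 *%R (second_form_norm_frame PP) (congr2 *%R ni nj))
  (bilinear_component_bound AE)).
Qed.

End Orthonormalisation.

(** * Calculus of differentiable maps of finite order *)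

Lemma near_on_open (T : topologicalType) (V : Type) (W : set T) x (f g : T -> V) :
  open W -> W x -> (forall y, W y -> f y = g y) -> \forall y \near x, f y = g y.
Proof. by move=> oW Wx fg; apply: filterS (open_nbhs_nbhs (conj oW Wx)). Qed.

Lemma near_eq_continuous (T T' : topologicalType) (f g : T -> T') x :
  (\forall y \near x, f y = g y) -> {for x, continuous f} -> {for x, continuous g}.
Proof.
move=> fg h; have {}h : f @ x --> f x := h.
suff : g @ x --> g x by [].
by rewrite -(nbhs_singleton fg); apply: cvg_trans h; apply: near_eq_cvg.
Qed.

Section CrCalculus.
Context {R : realType}.

Section Basic.
Context {U V : normedModType R}.
Implicit Types (W : set U) (f g : U -> V).

Lemma near_eq_differentiable f g x :
  (\forall y \near x, f y = g y) -> differentiable f x -> differentiable g x.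
Proof.
move=> fg df.
have fgx : f x = g x by apply: nbhs_singleton fg.
have /diff_locallyP[dc /eqaddoP h] := df.
have g_o : g \o shift x = cst (g x) + 'd f x +o_ 0 id.
  apply/eqaddoP => e e0; have := h e e0.
  apply: filter_app; have : \forall h \near 0, f (h + x) = g (h + x).
    by move: fg; rewrite (near_shift 0 x) /= subr0.
  by apply: filterS => z /= fgz; rewrite !fctE /= /cst fgz fgx.
apply/diff_locallyP; split; last by rewrite (diff_unique dc g_o).
by rewrite (diff_unique dc g_o).
Qed.

Lemma Cr_on_ext r W f g : open W -> (forall x, W x -> f x = g x) ->
  Cr_on r W f -> Cr_on r W g.
Proof.
move=> oW; elim: r f g => [|r IH] f g fg /=.
  by move=> cf x Wx; apply: near_eq_continuous (cf x Wx); apply: near_on_open oW Wx fg.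
move=> [df Df]; split=> [x Wx|v].
  by apply: near_eq_differentiable (df x Wx); apply: near_on_open oW Wx fg.
apply: IH (Df v) => x Wx.
by apply: near_eq_derive; apply: near_on_open oW Wx fg.
Qed.

Lemma Cr_onW r W f : Cr_on r.+1 W f -> Cr_on r W f.
Proof.
elim: r f => [|r IH] f /= [df Df]; first by move=> x Wx; apply/differentiable_continuous/df.
by split=> // v; apply: IH; apply: Df.
Qed.

Lemma Cr_on_subset r W W' f : W' `<=` W -> Cr_on r W f -> Cr_on r W' f.
Proof.
move=> WW; elim: r f => [|r IH] f /=; first by move=> h x /WW/h.
by move=> [df Df]; split=> [x /WW/df//|v]; apply: IH.
Qed.

Lemma Cr_on_cst r W (c : V) : Cr_on r W (fun _ : U => c).
Proof.
elim: r c => [|r IH] c /=; first by move=> x _; apply: cst_continuous.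
split=> [x _|v]; first exact: differentiable_cst.
rewrite (_ : (fun x => 'D_v (fun=> c) x) = fun=> 0); first exact: IH.
by apply/funext => x; rewrite derive_cst.
Qed.

Lemma Cr_onD r W f g : open W -> Cr_on r W f -> Cr_on r W g ->
  Cr_on r W (fun x => f x + g x).
Proof.
move=> oW; elim: r f g => [|r IH] f g /=.
  by move=> cf cg x Wx; apply: (@continuousD _ V); [apply: cf|apply: cg].
move=> [df Df] [dg Dg]; split=> [x Wx|v]; first by apply: differentiableD; auto.
apply: Cr_on_ext (IH _ _ (Df v) (Dg v)) => // x Wx.
by rewrite -deriveD //; apply: diff_derivable; auto.
Qed.

Lemma Cr_on_sum r W (I : Type) (s : seq I) (P : pred I) (f : I -> U -> V) : open W ->
  (forall i, Cr_on r W (f i)) -> Cr_on r W (fun x => \sum_(i <- s | P i) f i x).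
Proof.
move=> oW fC; elim: s => [|i s IH].
  rewrite (_ : (fun x => _) = fun=> 0); first exact: Cr_on_cst.
  by apply/funext => x; rewrite big_nil.
have [Pi|Pi] := boolP (P i).
  by rewrite (_ : (fun x => _) = fun x => f i x + \sum_(j <- s | P j) f j x);
    [exact: Cr_onD|apply/funext => x; rewrite big_cons Pi].
by rewrite (_ : (fun x => _) = fun x => \sum_(j <- s | P j) f j x) //;
  apply/funext => x; rewrite big_cons (negbTE Pi).
Qed.

End Basic.

Lemma derive_linear_comp (U V V' : normedModType R) (L : {linear V -> V'}) (f : U -> V) x v :
  continuous L -> differentiable f x -> 'D_v (L \o f) x = L ('D_v f x).
Proof.
move=> cL df; have dL : differentiable L (f x) by apply: linear_differentiable.
rewrite deriveE; last exact: differentiable_comp.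
by rewrite diff_comp // deriveE //= diff_lin.
Qed.

Lemma Cr_on_linear_comp (U V V' : normedModType R) r (W : set U) (L : {linear V -> V'})
  (f : U -> V) : open W -> continuous L -> Cr_on r W f -> Cr_on r W (L \o f).
Proof.
move=> oW cL; elim: r f => [|r IH] f /=.
  by move=> cf x Wx; apply: continuous_comp; [apply: cf|apply: cL].
move=> [df Df]; split=> [x Wx|v].
  by apply: differentiable_comp; [apply: df|apply: linear_differentiable].
apply: Cr_on_ext (IH _ (Df v)) => // x Wx.
by rewrite derive_linear_comp //; apply: df.
Qed.

Lemma Cr_on_scale (U V : normedModType R) r (W : set U) (k : U -> R) (e : V) :
  open W -> Cr_on r W k -> Cr_on r W (fun x => k x *: e).
Proof.
move=> oW; elim: r k => [|r IH] k /=.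
  by move=> ck x Wx; apply: continuousZl; apply: ck.
move=> [dk Dk]; split=> [x Wx|v]; first by apply: differentiableZl; apply: dk.
apply: Cr_on_ext (IH _ (Dk v)) => // x Wx.
have dkx := dk x Wx.
rewrite [RHS]deriveE; last exact: differentiableZl.
by rewrite diffZl // deriveE.
Qed.

Section Scalar.
Context {U : normedModType R}.
Implicit Types (W : set U) (f g : U -> R).

Lemma Cr_onM r W f g : open W -> Cr_on r W f -> Cr_on r W g ->
  Cr_on r W (fun x => f x * g x).
Proof.
move=> oW; elim: r f g => [|r IH] f g.
  by move=> cf cg x Wx; apply: (@continuousM R U); [apply: cf|apply: cg].
move=> [df Df] [dg Dg]; have Cf : Cr_on r W f by apply: Cr_onW.
have Cg : Cr_on r W g by apply: Cr_onW.
split=> [x Wx|v]; first by apply: differentiableM; auto.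
apply: Cr_on_ext (Cr_onD oW (IH _ _ Cf (Dg v)) (IH _ _ Cg (Df v))) => // x Wx.
by rewrite [RHS]deriveM //; apply: diff_derivable; auto.
Qed.

Lemma Cr_on_prod r W (I : Type) (s : seq I) (P : pred I) (f : I -> U -> R) : open W ->
  (forall i, Cr_on r W (f i)) -> Cr_on r W (fun x => \prod_(i <- s | P i) f i x).
Proof.
move=> oW fC; elim: s => [|i s IH].
  rewrite (_ : (fun x => _) = fun=> 1); first exact: Cr_on_cst.
  by apply/funext => x; rewrite big_nil.
have [Pi|Pi] := boolP (P i).
  by rewrite (_ : (fun x => _) = fun x => f i x * \prod_(j <- s | P j) f j x);
    [exact: Cr_onM|apply/funext => x; rewrite big_cons Pi].
by rewrite (_ : (fun x => _) = fun x => \prod_(j <- s | P j) f j x) //;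
  apply/funext => x; rewrite big_cons (negbTE Pi).
Qed.

Lemma Cr_onV r W f : open W -> (forall x, W x -> f x != 0) -> Cr_on r W f ->
  Cr_on r W (fun x => (f x)^-1).
Proof.
move=> oW f0; elim: r f f0 => [|r IH] f f0.
  by move=> cf x Wx; apply: (@continuousV R U); [apply: f0|apply: cf].
move=> [df Df]; have /(IH _ f0) Cf : Cr_on r W f by apply: Cr_onW.
split=> [x Wx|v]; first by apply: differentiableV; auto.
have N1 : Cr_on r W (fun _ : U => -1 : R) by apply: Cr_on_cst.
apply: Cr_on_ext (Cr_onM oW N1 (Cr_onM oW (Cr_onM oW Cf Cf) (Df v))) => // x Wx.
rewrite [RHS]deriveV ?f0 //; last by apply: diff_derivable; auto.
rewrite /GRing.scale /= -exprVn; ring.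
Qed.

Lemma Cr_on_det r W n (A : U -> 'M[R]_n) : open W ->
  (forall i j, Cr_on r W (fun x => A x i j)) -> Cr_on r W (fun x => \det (A x)).
Proof.
move=> oW CA; apply: Cr_on_sum => // s; apply: Cr_onM => //; first exact: Cr_on_cst.
by apply: Cr_on_prod.
Qed.

Lemma Cr_on_invmx r W n (A : U -> 'M[R]_n) : open W ->
  (forall x, W x -> A x \in unitmx) ->
  (forall i j, Cr_on r W (fun x => A x i j)) ->
  forall i j, Cr_on r W (fun x => invmx (A x) i j).
Proof.
move=> oW uA CA i j.
pose f x := (\det (A x))^-1 * ((-1) ^+ (j + i) * \det (row' j (col' i (A x)))).
apply: (@Cr_on_ext _ _ r W f) => // [x Wx|].
  by rewrite /f /invmx uA // mxE [in RHS]mxE.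
apply: Cr_onM => //.
  apply: Cr_onV => //; last exact: Cr_on_det.
  by move=> x Wx; have := uA x Wx; rewrite unitmxE unitfE.
apply: Cr_onM => //; first exact: Cr_on_cst.
apply: Cr_on_det => // a b.
rewrite (_ : (fun x => _) = fun x => A x (lift j a) (lift i b)) //.
by apply/funext => x; rewrite !mxE.
Qed.

End Scalar.

End CrCalculus.

Section Coordinates.
Context {R : realType}.

Lemma linear_bound_continuous (U V : normedModType R) (L : {linear U -> V}) (C : R) :
  (forall z, `|L z| <= C * `|z|) -> continuous L.
Proof.
move=> LC; apply/linear_bounded_continuous/linear_boundedP.
exists C; split; first exact: num_real.
by move=> r Cr x; apply: le_trans (LC x) _; apply: ler_wpM2r (ltW Cr).
Qed.

Section Row.
Variables (n : nat) (i : 'I_n).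
Definition coordL (v : 'rV[R]_n) : R^o := v 0 i.
Fact coordL_linear : linear coordL.
Proof. by move=> a u v; rewrite /coordL !mxE. Qed.
HB.instance Definition _ := GRing.isLinear.Build R 'rV[R]_n R^o *:%R coordL coordL_linear.
Lemma coordL_continuous : continuous coordL.
Proof.
apply: (@linear_bound_continuous _ _ coordL 1) => z.
by rewrite mul1r; apply: coord_le_norm.
Qed.
End Row.

Section Dot.
Variables (m : nat) (w : Cspace R m).
Definition dotL (z : Cspace R m) : R^o := dot z w.
Fact dotL_linear : linear dotL.
Proof. by move=> a u v; rewrite /dotL dotDl dotZl. Qed.
HB.instance Definition _ := GRing.isLinear.Build R (Cspace R m) R^o *:%R dotL dotL_linear.
Lemma dotL_continuous : continuous dotL.
Proof.
apply: (@linear_bound_continuous _ _ dotL ((2 * m)%:R * enorm w)) => z.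
apply: le_trans (dot_le_enorm _ _) _.
by rewrite mulrAC ler_wpM2r ?enorm_ge0 // enorm_le_norm.
Qed.
End Dot.

Section MulMx.
Variables (n p : nat) (A : 'M[R]_(n, p)).
Lemma mulmxr_continuous : continuous (mulmxr A : 'rV[R]_n -> 'rV[R]_p).
Proof.
apply: (@linear_bound_continuous _ _ (mulmxr A) (\sum_i \sum_j `|A i j|)) => z /=.
have S0 : 0 <= \sum_i \sum_j `|A i j|.
  by apply: sumr_ge0 => i _; apply: sumr_ge0.
apply: norm_le_coord => [|j]; first by rewrite mulr_ge0.
rewrite mxE; apply: le_trans (ler_norm_sum _ _ _) _.
rewrite mulr_suml; apply: ler_sum => i _.
rewrite normrM mulrC; apply: ler_pM => //; last exact: coord_le_norm.
by rewrite (bigD1 j) //= lerDl sumr_ge0.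
Qed.
End MulMx.

Section CrRow.
Context {U : normedModType R} {n : nat}.
Implicit Types (W : set U) (f : U -> 'rV[R]_n).

Lemma Cr_on_coord r W f i : open W -> Cr_on r W f -> Cr_on r W (fun x => f x 0 i : R).
Proof. by move=> oW; apply: (Cr_on_linear_comp oW (@coordL_continuous n i)). Qed.

Lemma Cr_on_row r W f : open W -> (forall i, Cr_on r W (fun x => f x 0 i : R)) -> Cr_on r W f.
Proof.
move=> oW Cf; apply: (@Cr_on_ext _ _ _ r W (fun x => \sum_i f x 0 i *: delta_mx 0 i)) => //.
  by move=> x _; rewrite -row_sum_delta.
by apply: Cr_on_sum => // i; apply: Cr_on_scale.
Qed.

Lemma derive_coord f x v i : differentiable f x -> 'D_v (fun x => f x 0 i : R) x = 'D_v f x 0 i.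
Proof. by move=> df; apply: (derive_linear_comp v (@coordL_continuous n i)). Qed.

Lemma differentiable_coord_comp f x i : differentiable f x ->
  differentiable (fun x => f x 0 i : R) x.
Proof.
move=> df; apply: (@differentiable_comp _ _ _ _ f (coordL i)) => //.
by apply: linear_differentiable; apply: coordL_continuous.
Qed.

Lemma differentiable_row f x :
  (forall i, differentiable (fun x => f x 0 i : R) x) -> differentiable f x.
Proof.
move=> df; rewrite (_ : f = fun x => \sum_i f x 0 i *: delta_mx 0 i).
  rewrite (_ : (fun x => _) = \sum_i (fun x => f x 0 i *: delta_mx 0 i)).
    by apply: differentiable_sum => i; apply: differentiableZl.
  by apply/funext => y; rewrite fct_sumE.
by apply/funext => y; rewrite -row_sum_delta.
Qed.

(** Chain rule in coordinates, with a scalar outer function: its right-hand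
    side is again made of sums and products of functions of lower order. *)
Lemma derive_comp_row (f : 'rV[R]_n -> R) (g : U -> 'rV[R]_n) x v :
  differentiable g x -> differentiable f (g x) ->
  'D_v (f \o g) x = \sum_i 'D_v g x 0 i * 'D_(delta_mx 0 i) f (g x).
Proof.
move=> dg df; rewrite deriveE; last exact: differentiable_comp.
rewrite diff_comp //= -(deriveE v dg) ['D_v g x in LHS]row_sum_delta linear_sum.
by apply: eq_bigr => i _; rewrite linearZ /= (deriveE _ df).
Qed.

Lemma Cr_on_comp r W (W' : set 'rV[R]_n) (f : 'rV[R]_n -> R) (g : U -> 'rV[R]_n) :
  open W -> (forall x, W x -> W' (g x)) ->
  Cr_on r W g -> Cr_on r W' f -> Cr_on r W (f \o g).
Proof.
move=> oW gW; elim: r f => [|r IH] f Cg Cf.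
  by move=> x Wx; apply: continuous_comp; [apply: Cg|apply: Cf; apply: gW].
have Cg' := Cr_onW Cg.
case: Cg Cf => [dg Dg] [df Df]; split=> [x Wx|v].
  by apply: differentiable_comp; [apply: dg|apply: df; apply: gW].
apply: (@Cr_on_ext _ _ _ r W
  (fun x => \sum_i 'D_v g x 0 i * ('D_(delta_mx 0 i) f \o g) x)) => //.
  by move=> x Wx; rewrite derive_comp_row //; [apply: dg|apply: df; apply: gW].
apply: Cr_on_sum => // i; apply: Cr_onM => //; first exact: (Cr_on_coord _ oW (Dg v)).
exact: (IH (fun y => 'D_(delta_mx 0 i) f y) Cg' (Df _)).
Qed.

End CrRow.

Section CrC.
Context {U : normedModType R} {m : nat}.
Implicit Types (W : set U) (f : U -> Cspace R m).

Lemma Cspace_sum_delta (z : Cspace R m) :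
  z = \sum_i (dot z (delta_mx 0 i, 0) *: (delta_mx 0 i, 0) +
              dot z (0, delta_mx 0 i) *: (0, delta_mx 0 i)) :> Cspace R m.
Proof.
have e1 i : dot z (delta_mx 0 i, 0) = z.1 0 i.
  rewrite /dot (bigD1 i) //= !mxE !eqxx mulr1 mulr0 addr0 big1 ?addr0 // => j ji.
  by rewrite !mxE eqxx (negbTE ji) !mulr0 addr0.
have e2 i : dot z (0, delta_mx 0 i) = z.2 0 i.
  rewrite /dot (bigD1 i) //= !mxE !eqxx mulr1 mulr0 add0r big1 ?addr0 // => j ji.
  by rewrite !mxE eqxx (negbTE ji) !mulr0 addr0.
rewrite [LHS]surjective_pairing [RHS]surjective_pairing.
congr pair; rewrite ?(raddf_sum fst) ?(raddf_sum snd) [LHS]row_sum_delta;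
  apply: eq_bigr => i _ /=; rewrite ?e1 ?e2 ?scaler0 ?addr0 ?add0r //.
Qed.

Lemma Cr_on_dot r W f w : open W -> Cr_on r W f -> Cr_on r W (fun x => dot (f x) w : R).
Proof. by move=> oW; apply: (Cr_on_linear_comp oW (@dotL_continuous m w)). Qed.

Lemma Cr_on_Cspace r W f : open W ->
  (forall w, Cr_on r W (fun x => dot (f x) w : R)) -> Cr_on r W f.
Proof.
move=> oW Cf; apply: (@Cr_on_ext _ _ _ r W
  (fun x => \sum_i (dot (f x) (delta_mx 0 i, 0) *: (delta_mx 0 i, 0) +
              dot (f x) (0, delta_mx 0 i) *: (0, delta_mx 0 i)))) => //.
  by move=> x _; rewrite -Cspace_sum_delta.
by apply: Cr_on_sum => // i; apply: Cr_onD => //; apply: Cr_on_scale.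
Qed.

Lemma derive_dot f x v w : differentiable f x ->
  'D_v (fun x => dot (f x) w : R) x = dot ('D_v f x) w.
Proof. by move=> df; apply: (derive_linear_comp v (@dotL_continuous m w)). Qed.

Lemma differentiable_dot f x w : differentiable f x ->
  differentiable (fun x => dot (f x) w : R) x.
Proof.
move=> df; apply: (@differentiable_comp _ _ _ _ f (dotL w)) => //.
by apply: linear_differentiable; apply: dotL_continuous.
Qed.

End CrC.
End Coordinates.

(** * The inverse function theorem *)

Section MeanValue.
Context {R : realType}.

Lemma is_derive_line (U V : normedModType R) (f : U -> V) (x v : U) (t : R) :
  differentiable f (x + t *: v) ->
  is_derive t 1 (fun s : R => f (x + s *: v)) ('D_v f (x + t *: v)).
Proof.
move=> df; pose a (s : R) := x + s *: v.
have da : is_diff t a (fun s : R => s *: v).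
  have -> : a = cst x + (fun s : R => s *: v) by [].
  by apply: is_diff_eq; rewrite add0r.
have dfa : differentiable (f \o a) t by apply: differentiable_comp.
apply: DeriveDef; first exact: diff_derivable.
rewrite (deriveE _ dfa) diff_comp //= diff_val scale1r.
by rewrite deriveE.
Qed.

Lemma mean_value_line (U : normedModType R) (f : U -> R) (x y : U) :
  (forall t : R, 0 <= t <= 1 -> differentiable f (x + t *: (y - x))) ->
  exists2 t : R, 0 <= t <= 1 & f y - f x = 'D_(y - x) f (x + t *: (y - x)).
Proof.
move=> df; pose k (t : R) := f (x + t *: (y - x)).
have dk (t : R) : 0 <= t <= 1 -> is_derive t 1 k ('D_(y - x) f (x + t *: (y - x))).
  by move=> /df; apply: is_derive_line.
have [||t t01] := @MVT_segment R k (fun t => 'D_(y - x) f (x + t *: (y - x))) 0 1 ler01.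
- by move=> t; rewrite in_itv /= => /andP[t0 t1]; apply: dk; rewrite !ltW.
- apply: derivable_within_continuous => t; rewrite in_itv /= => /dk h.
  exact: (@ex_derive _ _ _ _ _ _ _ h).
rewrite /k scale1r scale0r addr0 subr0 mulr1 [x + (_ - _)]addrC subrK => e.
by exists t; rewrite // -in_itv.
Qed.

Lemma ball_line (U : normedModType R) (c x y : U) (r t : R) : 0 <= t <= 1 ->
  ball c r x -> ball c r y -> ball c r (x + t *: (y - x)).
Proof.
move=> /andP[t0 t1]; rewrite -!ball_normE /ball_ /= => cx cy.
have -> : c - (x + t *: (y - x)) = (1 - t) *: (c - x) + t *: (c - y).
  rewrite scalerBl scale1r -[RHS]addrA [- _ + _]addrC -scalerBr opprB.
  rewrite [c - y + _]addrC addrA subrK opprD addrA.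
  by rewrite -[x - y in RHS]opprB scalerN.
rewrite (le_lt_trans (ler_normD _ _)) // !normrZ !ger0_norm ?subr_ge0 //.
have [->|tn0] := eqVneq t 0; first by rewrite subr0 mul1r mul0r addr0.
have tp : 0 < t by rewrite lt_neqAle eq_sym tn0.
rewrite [ltRHS](_ : r = (1 - t) * r + t * r); last by ring.
by apply: ler_ltD; rewrite ?ltr_pM2l //; apply: ler_wpM2l; [rewrite subr_ge0|exact: ltW].
Qed.

Lemma diff_of_estimate (U V : normedModType R) (f : U -> V) (x : U) (L : {linear U -> V}) :
  continuous L ->
  (forall e : R, 0 < e -> \forall h \near (0 : U), `|f (h + x) - f x - L h| <= e * `|h|) ->
  differentiable f x /\ 'd f x = L :> (U -> V).
Proof.
move=> cL est.
have h : f \o shift x = cst (f x) + L +o_ 0 id.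
  apply/eqaddoP => e e0; apply: filterS (est e e0) => z /=.
  by rewrite !fctE /= opprD addrA.
have dE := diff_unique cL h.
by split=> //; apply/diff_locallyP; rewrite dE.
Qed.

Lemma estimate_of_diff (U V : normedModType R) (f : U -> V) (x : U) :
  differentiable f x ->
  forall e : R, 0 < e -> \forall h \near (0 : U), `|f (h + x) - f x - 'd f x h| <= e * `|h|.
Proof.
move=> /diff_locallyP[_ /eqaddoP h] e e0; apply: filterS (h e e0) => z /=.
by rewrite !fctE /= opprD addrA.
Qed.

End MeanValue.

(** Joins the complete and the normed structures of matrices, as the fixed point
    theorem below requires. *)
HB.instance Definition _ (R : realType) (m n : nat) := Complete.on 'M[R]_(m, n).

Section InverseFunction.
Context {R : realType} {m : nat}.
Implicit Types (W Z B : set 'rV[R]_m) (x y z v : 'rV[R]_m) (f g : 'rV[R]_m -> 'rV[R]_m).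

Lemma norm_mulmx_le (v : 'rV[R]_m) (A : 'M[R]_m) (c : R) : 0 <= c ->
  (forall i j, `|A i j| <= c) -> `|v *m A| <= m%:R * c * `|v|.
Proof.
move=> c0 Ac; apply: norm_le_coord => [|j]; first by rewrite !mulr_ge0.
rewrite mxE; apply: le_trans (ler_norm_sum _ _ _) _.
have -> : m%:R * c * `|v| = \sum_(i < m) (`|v| * c).
  by rewrite sumr_const card_ord -[RHS]mulr_natl; ring.
apply: ler_sum => i _; rewrite normrM; apply: ler_pM => //.
exact: coord_le_norm.
Qed.

Lemma derive_jacobian_entry f z i j : differentiable f z ->
  'J f z i j = 'D_(delta_mx 0 i) f z 0 j.
Proof. by move=> df; rewrite deriveEjacobian // -rowE [RHS]mxE. Qed.

(** The mean value theorem is applied to each coordinate of f - id.  For the sup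
    norm, a bound on the entries of a matrix costs a factor m. *)
Lemma near_identity_lipschitz (c : 'rV[R]_m) (r : R) f :
  (forall z : 'rV[R]_m, ball c r z -> differentiable f z) ->
  (forall (z : 'rV[R]_m) i j, ball c r z -> `|('J f z - 1%:M) i j| <= (2 * m.+1%:R)^-1) ->
  forall x y : 'rV[R]_m, ball c r x -> ball c r y ->
    `|(f y - y) - (f x - x)| <= 2^-1 * `|y - x|.
Proof.
move=> df Jf x y cx cy.
apply: norm_le_coord => [|j]; first by rewrite mulr_ge0 // invr_ge0.
pose e z : R := (f z - z) 0 j.
have de (z : 'rV[R]_m) : ball c r z -> differentiable (fun z => f z - z) z.
  by move=> cz; apply: differentiableB => //; apply: df.
have [|t t01 et] := @mean_value_line R _ e x y.
  by move=> t t01; exact: differentiable_coord_comp (de _ (ball_line t01 cx cy)).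
have cz := ball_line t01 cx cy; set z := x + _ in cz et.
have -> : (f y - y - (f x - x)) 0 j = e y - e x by rewrite /e !mxE.
rewrite et derive_coord; last exact: de.
have -> : 'D_(y - x) (fun z => f z - z) z = (y - x) *m ('J f z - 1%:M).
  rewrite [LHS]deriveB; [|exact/diff_derivable/df|exact: derivable_id].
  by rewrite derive_id deriveEjacobian ?mulmxBr ?mulmx1 //; apply: df.
apply: le_trans (coord_le_norm _ _) _.
apply: le_trans (norm_mulmx_le _ _ (fun i j => Jf z i j cz)) _.
  by rewrite invr_ge0 mulr_ge0.
apply: ler_wpM2r => //; rewrite invfM mulrCA -[leRHS]mulr1; apply: ler_wpM2l => //.
by rewrite ler_pdivrMr // mul1r ler_nat.
Qed.

(** The equation f z = y is the fixed point equation of the contraction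
    z |-> y - (f z - z). *)
Lemma near_identity_surjective (c : 'rV[R]_m) (r : R) f : 0 < r ->
  (forall x y : 'rV[R]_m, ball c r x -> ball c r y ->
    `|(f y - y) - (f x - x)| <= 2^-1 * `|y - x|) ->
  forall y, `|y - f c| < r / 4 -> exists2 z, ball c r z & f z = y.
Proof.
move=> r0 lip y yc.
pose U : set 'rV[R]_m := closed_ball_ Num.norm c (r / 2).
have Ub z : U z -> ball c r z.
  by rewrite -ball_normE /ball_ /= => h; apply: le_lt_trans h _; lra.
have Uc : U c by rewrite /U /closed_ball_ /= subrr normr0; lra.
pose T z := y - (f z - z).
have TU : {homo T : z / U z >-> U z}.
  move=> z Uz; rewrite /U /closed_ball_ /= /T distrC.
  have -> : y - (f z - z) - c = (y - f c) - ((f z - z) - (f c - c)).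
    by rewrite [in RHS]opprB addrA subrKA addrAC.
  apply: le_trans (ler_normB _ _) _.
  have := lip _ _ (Ub _ Uc) (Ub _ Uz); move: Uz; rewrite /U /closed_ball_ /= -(distrC z); lra.
have ctr : contraction (2^-1)%:nng (mkfun TU).
  split; first by rewrite /=; lra.
  move=> [z z'] [/= Uz Uz'].
  have -> : T z - T z' = - ((f z - z) - (f z' - z')).
    by rewrite /T; move: (f z - z) (f z' - z') => a b; rewrite opprB addrC subrKA opprB.
  by rewrite normrN; apply: lip; apply: Ub.
have [|||z Uz zE] := @banach_fixed_point R 'rV[R]_m U (mkfun TU).
- by exists (2^-1)%:nng.
- exact: closed_closed_ball_.
- by exists c.
exists z; first exact: Ub.
have : z + 0 = z + (y - f z) by rewrite addr0 addrCA -opprB; exact: zE.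
by move/addrI/esym/eqP; rewrite subr_eq0 => /eqP.
Qed.

Lemma unitmx_near_identity (A : 'M[R]_m) :
  (forall i j, `|(A - 1%:M) i j| <= (2 * m.+1%:R)^-1) -> A \in unitmx.
Proof.
move=> A1; rewrite -row_free_unit; apply: inj_row_free => v vA.
have : `|v *m (A - 1%:M)| <= 2^-1 * `|v|.
  apply: le_trans (norm_mulmx_le _ _ A1) _; first by rewrite invr_ge0 mulr_ge0.
  apply: ler_wpM2r => //; rewrite invfM mulrCA -[leRHS]mulr1; apply: ler_wpM2l => //.
  by rewrite ler_pdivrMr // mul1r ler_nat.
rewrite mulmxBr mulmx1 vA sub0r normrN => h.
by apply/eqP; rewrite -normr_eq0 eq_le normr_ge0 andbT; lra.
Qed.

Lemma unitmx_jacobian f z : injective ('d f z) -> 'J f z \in unitmx.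
Proof.
move=> inj; rewrite -row_free_unit; apply: inj_row_free => v.
by rewrite mul_rV_lin1 => vz; apply: inj; rewrite vz linear0.
Qed.

(** The first order expansion of f at g y is read backwards: its remainder is
    small with respect to |g (h + y) - g y|, hence with respect to |h|, because
    g is Lipschitz. *)
Lemma differentiable_inverse W B f g (c : R) : open W -> open B ->
  (forall z, W z -> differentiable f z) ->
  (forall z, W z -> 'J f z \in unitmx) ->
  (forall y, B y -> W (g y) /\ f (g y) = y) ->
  (forall y y', B y -> B y' -> `|g y - g y'| <= c * `|y - y'|) ->
  forall y, B y -> differentiable g y /\
    forall v, 'D_v g y = v *m invmx ('J f (g y)).
Proof.
move=> oW oB df uJ gB glip y By; have [Wgy fgy] := gB y By.
pose A := invmx ('J f (g y)); pose L : {linear 'rV[R]_m -> 'rV[R]_m} := mulmxr A.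
have [C C0 LC] := linear_lipschitz (@mulmxr_continuous R m m A).
have c1 : 0 < `|c| + 1 by rewrite ltr_wpDl.
have [|dg Dg] := @diff_of_estimate _ _ _ g y L (@mulmxr_continuous R m m A).
  move=> e e0; pose e1 := e / (C * (`|c| + 1)).
  have e10 : 0 < e1 by rewrite divr_gt0 // mulr_gt0.
  have := estimate_of_diff (df _ Wgy) e10 => /nbhs_ballP[d /= d0 dP].
  have near_B : \forall h \near (0 : 'rV[R]_m), B (h + y).
    have := open_nbhs_nbhs (conj oB By).
    by rewrite -[nbhs y B]/(\forall z \near y, B z) (near_shift 0 y) /= subr0.
  near=> h.
  have Bh : B (h + y) by near: h.
  pose k := g (h + y) - g y.
  have kh : `|k| <= (`|c| + 1) * `|h|.
    apply: le_trans (glip _ _ Bh By) _; rewrite addrK ler_wpM2r //.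
    by apply: le_trans (ler_norm c) _; rewrite lerDl.
  have /dP : ball (0 : 'rV[R]_m) d k.
    rewrite -ball_normE /ball_ /= sub0r normrN; apply: le_lt_trans kh _.
    by rewrite mulrC -ltr_pdivlMr //; near: h; apply: (@nbhs0_lt R 'rV[R]_m); rewrite divr_gt0.
  rewrite /= subrK (gB _ Bh).2 fgy addrK => est.
  have -> : g (h + y) - g y - L h = - L (h - 'd f (g y) k).
    rewrite linearB /= opprB; congr (_ - _).
    by rewrite -(deriveE _ (df _ Wgy)) (deriveEjacobian _ (df _ Wgy)) mulmxK ?uJ.
  rewrite normrN; apply: le_trans (LC _) _; rewrite mulrC.
  rewrite -ler_pdivlMr //; apply: le_trans est _.
  rewrite /e1 -ler_pdivlMl ?divr_gt0 ?mulr_gt0 //.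
  apply: le_trans kh _; rewrite le_eqVlt; apply/orP; left; apply/eqP.
  by field; rewrite !gt_eqF.
by split=> // v; rewrite deriveE // Dg.
Unshelve. all: by end_near. Qed.

(** The Jacobian matrix of g is rational in that of f composed with g: each
    derivative gained for g gives one more for its Jacobian matrix. *)
Lemma smooth_inverse W B f g (c : R) : open W -> open B ->
  smooth_on W f -> (forall z, W z -> 'J f z \in unitmx) ->
  (forall y, B y -> W (g y) /\ f (g y) = y) ->
  (forall y y', B y -> B y' -> `|g y - g y'| <= c * `|y - y'|) ->
  smooth_on B g.
Proof.
move=> oW oB Sf uJ gB glip.
have df z : W z -> differentiable f z by move=> Wz; have [h _] := Sf 1%N; apply: h.
have dg := differentiable_inverse oW oB df uJ gB glip.
elim=> [|r IH] /=; first by move=> y /dg[h _]; apply: differentiable_continuous.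
split=> [y /dg[]//|v].
apply: (@Cr_on_ext _ _ _ r B (fun y => v *m invmx ('J f (g y)))) => //.
  by move=> y /dg[_ ->].
apply: Cr_on_row => // j.
apply: (@Cr_on_ext _ _ _ r B (fun y => \sum_i v 0 i * invmx ('J f (g y)) i j)) => //.
  by move=> y _; rewrite mxE.
apply: Cr_on_sum => // i; apply: Cr_onM => //; first exact: Cr_on_cst.
apply: Cr_on_invmx => // [y /gB[/uJ//]|a b].
apply: (@Cr_on_ext _ _ _ r B ((fun z => 'D_(delta_mx 0 a) f z 0 b) \o g)) => //.
  by move=> y /gB[Wgy _] /=; rewrite derive_jacobian_entry //; apply: df.
apply: (@Cr_on_comp _ _ _ r B W) => // [y /gB[]//|].
by apply: Cr_on_coord => //; have [_] := Sf r.+1; apply.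
Qed.

End InverseFunction.

Section InverseFunctionTheorem.
Context {R : realType} {m : nat}.
Implicit Types (W Z B : set 'rV[R]_m) (f g : 'rV[R]_m -> 'rV[R]_m) (x y z v : 'rV[R]_m).

Lemma jacobian_near W f z1 (A : 'M[R]_m) (e : R) : open W -> W z1 -> smooth_on W f ->
  'J f z1 *m A = 1%:M -> 0 < e ->
  \forall z \near z1, W z /\ forall i j, `|('J f z *m A - 1%:M) i j| <= e.
Proof.
move=> oW Wz1 Sf JA e0; have [df Df] := Sf 1%N.
pose c (i j : 'I_m) z : R := \sum_k 'D_(delta_mx 0 i) f z 0 k * A k j + - (1%:M : 'M[R]_m) i j.
have cE i j z : W z -> ('J f z *m A - 1%:M) i j = c i j z.
  move=> Wz; rewrite mxE [X in X + _]mxE [X in _ + X]mxE; congr (_ + _).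
  by apply: eq_bigr => k _; rewrite derive_jacobian_entry //; apply: df.
have cc i j : Cr_on 0 W (c i j).
  apply: Cr_onD => //; last exact: Cr_on_cst.
  apply: Cr_on_sum => // k; apply: Cr_onM => //; last exact: Cr_on_cst.
  apply: (@Cr_on_coord R _ _ 0 W (fun z => 'D_(delta_mx 0 i) f z) k oW); exact: Df.
have near_ij (i j : 'I_m) : \forall z \near z1, `|c i j z| <= e.
  have cij : c i j z @[z --> z1] --> c i j z1 := cc i j z1 Wz1.
  have c0 : c i j z1 = 0 by rewrite -cE // JA subrr mxE.
  rewrite c0 in cij; apply: filterS (cvgr0_norm_lt _ cij _ e0) => z; exact: ltW.
have near_W : \forall z \near z1, W z by apply: open_nbhs_nbhs.
have near_all : \forall z \near z1, forall ij : 'I_m * 'I_m, `|c ij.1 ij.2 z| <= e.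
  exact: (@filter_forall _ _ (fun (ij : 'I_m * 'I_m) z => `|c ij.1 ij.2 z| <= e)
    (nbhs z1) _ (fun ij => near_ij ij.1 ij.2)).
apply: filterS2 near_W near_all => z Wz all_z; split=> // i j.
by rewrite cE //; apply: (all_z (i, j)).
Qed.

Lemma jacobian_mulmxr f z (A : 'M[R]_m) : differentiable f z ->
  'J (fun z => f z *m A) z = 'J f z *m A.
Proof.
move=> df; have dF : differentiable (fun z => f z *m A) z.
  apply: (@differentiable_comp _ _ _ _ f (mulmxr A)) => //.
  by apply: linear_differentiable; apply: mulmxr_continuous.
have jE (v : 'rV[R]_m) : v *m 'J (fun z => f z *m A) z = v *m ('J f z *m A).
  apply: (etrans (esym (deriveEjacobian v dF))).
  apply: (etrans (derive_linear_comp v (@mulmxr_continuous R m m A) df)).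
  exact: (etrans (congr1 (mulmxr A) (deriveEjacobian v df)) (esym (mulmxA v ('J f z) A))).
move: ('J (fun z => f z *m A) z) ('J f z *m A) jE => B C jE.
by apply/row_matrixP => i; rewrite !rowE.
Qed.

(** Composing f with the inverse of its differential at the point makes it a
    small perturbation of the identity. *)
Theorem inverse_function W f z1 : open W -> W z1 -> smooth_on W f ->
  injective ('d f z1) ->
  exists (Z : set 'rV[R]_m) (g : 'rV[R]_m -> 'rV[R]_m) (d : R),
    [/\ 0 < d, open Z, Z `<=` W, Z z1 &
    [/\ forall y, ball (f z1) d y -> Z (g y) /\ f (g y) = y,
       forall z, Z z -> ball (f z1) d (f z) -> g (f z) = z &
       smooth_on (ball (f z1) d) g]].
Proof.
move=> oW Wz1 Sf inj; pose A := invmx ('J f z1).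
have uJ1 := unitmx_jacobian inj.
have uA : A \in unitmx by rewrite unitmx_inv.
have h0 : 0 < (2 * m.+1%:R)^-1 :> R by rewrite invr_gt0 mulr_gt0.
have /nbhs_ballP[r /= r0 rP] := jacobian_near oW Wz1 Sf (mulmxV uJ1) h0.
have df z : W z -> differentiable f z by move=> Wz; have [h _] := Sf 1%N; apply: h.
pose F z := f z *m A.
have dF z : W z -> differentiable F z.
  move=> Wz; apply: (@differentiable_comp _ _ _ _ f (mulmxr A)); first exact: df.
  by apply: linear_differentiable; apply: mulmxr_continuous.
have JF z : W z -> 'J F z = 'J f z *m A.
  by move=> /df dfz; apply: jacobian_mulmxr.
have rW z : ball z1 r z -> W z by move=> /rP[].
have lip := @near_identity_lipschitz R m z1 r F.
have {}lip x y : ball z1 r x -> ball z1 r y -> `|F y - y - (F x - x)| <= 2^-1 * `|y - x|.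
  apply: lip => [z /rW/dF//|z i j bz].
  by rewrite JF; [have [_] := rP z bz; apply|exact: rW].
have expand x y : ball z1 r x -> ball z1 r y -> `|y - x| <= 2 * `|F y - F x|.
  move=> bx by_; have := lip x y bx by_.
  have : `|y - x| <= `|F y - F x| + `|F y - y - (F x - x)|.
    have -> : y - x = (F y - F x) - (F y - y - (F x - x)).
      move: (F x) (F y) => a b; rewrite (opprB (b - y) (a - x)) addrA subrKA opprB.
      by rewrite [RHS]addrC subrKA.
    exact: ler_normB.
  lra.
have [C C0 LC] := linear_lipschitz (@mulmxr_continuous R m m A).
have FC y y' : `|y *m A - y' *m A| <= C * `|y - y'|.
  by rewrite -mulmxBl; apply: LC.
pose Z : set 'rV[R]_m := ball z1 r `&` F @^-1` ball (F z1) (r / 4).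
have r40 : 0 < r / 4 by lra.
have oZ : open Z.
  have : {in (ball z1 r : set 'rV[R]_m), continuous F}.
    move=> z; rewrite inE => /rW/dF; exact: differentiable_continuous.
  move/(continuous_inP _ (ball_open z1 r)); apply; exact: ball_open.
have Zz1 : Z z1 by split; apply: ballxx.
have ZF z : Z z -> ball z1 r z by case.
pose g y := xget z1 [set z | Z z /\ f z = y].
pose d := r / (4 * C).
have d0 : 0 < d by rewrite divr_gt0 ?mulr_gt0.
have gP y : ball (f z1) d y -> Z (g y) /\ f (g y) = y.
  move=> By; apply: (@xgetPex _ z1 [set z | Z z /\ f z = y]).
  have yF : `|y *m A - F z1| < r / 4.
    apply: le_lt_trans (FC _ _) _; rewrite mulrC -ltr_pdivlMr //.
    move: By; rewrite -ball_normE /ball_ /= distrC => h; apply: lt_le_trans h _.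
    by rewrite /d invfM mulrA.
  have [z bz Fz] := near_identity_surjective r0 lip yF.
  exists z; split; last by apply: (can_inj (mulmxK uA)).
  by split=> //; rewrite /= -ball_normE /ball_ /= Fz distrC.
have injF z z' : Z z -> Z z' -> f z = f z' -> z = z'.
  move=> /ZF bz /ZF bz' fz; apply/eqP; rewrite -subr_eq0 -normr_eq0 eq_le normr_ge0 andbT.
  by apply: le_trans (expand _ _ bz' bz) _; rewrite /F fz subrr normr0 mulr0.
have ZW : Z `<=` W by move=> z /ZF/rW.
exists Z, g, d; split=> //; split=> //.
  by move=> z Zz /gP[Zg fg]; apply: injF.
apply: (@smooth_inverse R m Z (ball (f z1) d) f g (2 * C) oZ (ball_open _ _)).
- by move=> n; apply: Cr_on_subset ZW (Sf n).
- move=> z /ZF bz; have := unitmx_near_identity (rP z bz).2.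
  by rewrite unitmx_mul uA andbT.
- exact: gP.
- move=> y y' /gP[Zy fy] /gP[Zy' fy'].
  apply: le_trans (expand _ _ (ZF _ Zy') (ZF _ Zy)) _.
  by rewrite /F fy fy' -mulrA ler_wpM2l.
Qed.

End InverseFunctionTheorem.

(** * Curves and the intrinsic distance *)

Section Arcs.
Context {R : realType} {m : nat}.
Implicit Types z w : Cspace R m.

Lemma enorm_dist z w : `|enorm z - enorm w| <= enorm (z - w).
Proof.
have h (a b : Cspace R m) : enorm a - enorm b <= enorm (a - b).
  by rewrite lerBlDr -[X in enorm X <= _](subrK b); apply: ler_enormD.
by rewrite ler_norml h andbT -enormN opprB lerNl opprB h.
Qed.

Lemma near_enorm (T : topologicalType) (f : T -> Cspace R m) (x : T) (e : R) :
  {for x, continuous f} -> 0 < e -> \forall y \near x, enorm (f y - f x) < e.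
Proof.
move=> cf e0; have C0 : 0 < (2 * m)%:R + 1 :> R by rewrite ltr_wpDl.
have h : f @ x --> f x := cf.
have hd : \forall y \near x, `|f x - f y| < e / ((2 * m)%:R + 1).
  by apply: (cvgr_dist_lt _ _ h); exact: divr_gt0.
apply: filterS hd => y.
rewrite ltr_pdivlMr // distrC => hy.
apply: le_lt_trans (enorm_le_norm _) _; apply: le_lt_trans hy.
by rewrite mulrC ler_wpM2l // lerDl.
Qed.

Lemma enorm_continuous : continuous (@enorm R m).
Proof.
move=> z; apply/cvgrPdist_lt => e e0.
apply: filterS (@near_enorm _ id z e (@cvg_id _ _) e0) => w /= h.
by apply: le_lt_trans (enorm_dist _ _) _; rewrite -enormN opprB.
Qed.

Lemma derivable_dot (f : R -> Cspace R m) t w : derivable f t 1 ->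
  is_derive t (1 : R) (fun s => dot (f s) w : R) (dot (derive1 f t) w).
Proof.
move=> /derivable1_diffP df; apply: DeriveDef.
  by apply/diff_derivable; apply: differentiable_dot.
exact: (etrans (derive_dot (1 : R) w df) (congr1 (fun z => dot z w) (esym (derive1E f t)))).
Qed.

Variables (M : topologicalType) (F : M -> Cspace R m).

Lemma speed_continuous c : C1_arc F c -> continuous (fun t => enorm (derive1 (F \o c) t)).
Proof.
by move=> [_ _ cf] t; apply: continuous_comp; [apply: cf|apply: enorm_continuous].
Qed.

Lemma speed_measurable c (D : set R) : measurable D -> C1_arc F c ->
  measurable_fun D (fun t => (enorm (derive1 (F \o c) t))%:E).
Proof.
move=> mD Fc; apply/measurable_EFinP; apply: measurable_funTS.
exact: continuous_measurable_fun (speed_continuous Fc).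
Qed.

(** The velocity is integrated against the chord, so that only scalar integrals
    occur. *)
Lemma chord_le_arc_length c (s t : R) : C1_arc F c -> 0 <= s -> s <= t -> t <= 1 ->
  ((enorm (F (c t) - F (c s)))%:E <= arc_length F c)%E.
Proof.
move=> Fc s0; rewrite le_eqVlt => /predU1P[->|st] t1.
  rewrite subrr enorm0; apply: integral_ge0 => x _.
  by rewrite lee_fin enorm_ge0.
have [cc dc Cf'] := Fc.
pose N x := enorm (derive1 (F \o c) x); have cN : continuous N := speed_continuous Fc.
pose w := F (c t) - F (c s).
have len : ((\int[lebesgue_measure]_(x in `[s, t]) (N x)%:E) <= arc_length F c)%E.
  apply: ge0_subset_integral => //.
  - exact: speed_measurable.
  - by move=> x _; rewrite lee_fin enorm_ge0.
  - by apply: subset_itv; rewrite bnd_simp.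
apply: le_trans len.
have [w0|w0] := eqVneq (enorm w) 0.
  by rewrite w0; apply: integral_ge0 => x _; rewrite lee_fin enorm_ge0.
have wp : 0 < enorm w by rewrite lt_neqAle eq_sym w0 enorm_ge0.
rewrite -(@lee_pmul2l _ (enorm w)%:E) ?fin_numE ?lte_fin // -EFinM -expr2 enorm_sqr.
rewrite -ge0_integralZl_EFin ?enorm_ge0 //; last 2 first.
  by move=> x _; rewrite lee_fin enorm_ge0.
  exact: speed_measurable.
pose g x : R := dot (derive1 (F \o c) x) w.
have cg : continuous g.
  move=> x; apply: (@continuous_comp _ _ _ (derive1 (F \o c)) (dotL w)); first exact: Cf'.
  exact: dotL_continuous.
have gE : (\int[lebesgue_measure]_(x in `[s, t]) (g x)%:E)%E = (dot w w)%:E.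
  rewrite (@continuous_FTC2 R g (fun x => dot (F (c x)) w) s t) //.
  - by rewrite -EFinB -dotBl.
  - exact: continuous_subspaceT.
  - have h x : is_derive x (1 : R) (fun x => dot (F (c x)) w : R) (g x) by apply: derivable_dot.
    have ch x : {for x, continuous (fun x => dot (F (c x)) w : R)}.
      by apply: differentiable_continuous; apply/derivable1_diffP; case: (h x).
    split; first by move=> x _; case: (h x).
      exact: cvg_at_right_filter (ch s).
    exact: cvg_at_left_filter (ch t).
  - by move=> x _; rewrite derive1E; case: (derivable_dot w (dc x)).
rewrite -gE; apply: le_integral => //.
- by apply: continuous_compact_integrable; [exact: segment_compact|exact: continuous_subspaceT].
- apply: (@continuous_compact_integrable R (fun x => enorm w * N x)); first exact: segment_compact.
  by apply: continuous_subspaceT => x; apply: cvgM; [exact: cvg_cst|exact: cN].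
- move=> x _; rewrite -EFinM lee_fin mulrC.
  by apply: le_trans (ler_norm _) (dot_le_enorm _ _).
Qed.

Lemma arc_length_le c (L : R) : C1_arc F c ->
  (forall t, 0 <= t <= 1 -> enorm (derive1 (F \o c) t) <= L) ->
  (arc_length F c <= L%:E)%E.
Proof.
move=> Fc NL.
have <- : (\int[lebesgue_measure]_(x in `[0%R, 1%R]) (cst L%:E x))%E = L%:E.
  rewrite integral_cst // -[RHS]mule1; congr (_ * _)%E.
  by apply: (etrans (lebesgue_measure_itv `[0 : R, 1])); rewrite /= lte_fin ltr01 oppr0 adde0.
apply: ge0_le_integral => //.
- by move=> x _; rewrite lee_fin enorm_ge0.
- exact: speed_measurable.
Qed.

End Arcs.

Section ImmersionBounds.
Context {R : realType} {m : nat}.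

Lemma immersion_bound (k : nat) (b : 'I_k -> Cspace R m) :
  (forall v : 'rV[R]_k, \sum_i v 0 i *: b i = 0 -> v = 0) ->
  exists2 c : R, 0 < c & forall v : 'rV[R]_k, c * `|v| <= enorm (\sum_i v 0 i *: b i).
Proof.
move=> /orthonormal_frame[P [uP _ onP]].
pose E a := \sum_i P a i *: b i.
have bE (v : 'rV[R]_k) : \sum_i v 0 i *: b i = \sum_a (v *m invmx P) 0 a *: E a.
  have vE : v = v *m invmx P *m P by rewrite mulmxKV.
  move: (v *m invmx P) vE => u ->.
  under eq_bigr => i _ do rewrite mxE scaler_suml.
  rewrite exchange_big; apply: eq_bigr => a _; rewrite scaler_sumr.
  by apply: eq_bigr => i _; rewrite scalerA.
have nE (u : 'rV[R]_k) : `|u| <= enorm (\sum_a u 0 a *: E a).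
  have uE a : dot (\sum_a u 0 a *: E a) (E a) = u 0 a.
    rewrite dot_suml (bigD1 a) //= dotZl onP eqxx mulr1 big1 ?addr0 // => a' aa.
    by rewrite dotZl onP (negbTE aa) mulr0.
  apply: norm_le_coord => [|a]; first exact: enorm_ge0.
  have E1 : enorm (E a) = 1 by rewrite /enorm onP eqxx sqrtr1.
  by rewrite -[X in `|X|](uE a); apply: le_trans (dot_le_enorm _ _) _; rewrite E1 mulr1.
have [C C0 PC] := linear_lipschitz (@mulmxr_continuous R k k P).
exists C^-1; first by rewrite invr_gt0.
move=> v; rewrite mulrC ler_pdivrMr // bE.
apply: le_trans (ler_wpM2r (ltW C0) (nE _)); rewrite mulrC.
by apply: le_trans (PC (v *m invmx P)); rewrite /= mulmxKV.
Qed.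

Lemma derive_row (k : nat) (V : normedModType R) (phi : 'rV[R]_k -> V) x (v : 'rV[R]_k) :
  differentiable phi x -> 'D_v phi x = \sum_i v 0 i *: 'D_(delta_mx 0 i) phi x.
Proof.
move=> dphi; rewrite (deriveE v dphi) [v in LHS]row_sum_delta linear_sum.
by apply: eq_bigr => i _; rewrite linearZ (deriveE _ dphi).
Qed.

Lemma immersion_free (k : nat) (phi : 'rV[R]_k -> Cspace R m) x :
  differentiable phi x -> injective ('d phi x) ->
  forall v : 'rV[R]_k, \sum_i v 0 i *: partial i phi x = 0 -> v = 0.
Proof.
move=> dphi inj v v0; apply: inj; rewrite linear0 -(deriveE v dphi).
exact: (etrans (derive_row v dphi) v0).
Qed.

(** The differential expands lengths by [immersion_bound]; near the point, the
    remainder takes away at most half of that. *)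
Lemma immersion_expand (k : nat) (phi : 'rV[R]_k -> Cspace R m) (x : 'rV[R]_k) :
  differentiable phi x -> injective ('d phi x) ->
  exists2 c : R, 0 < c & \forall z \near x, c * `|z - x| <= enorm (phi z - phi x).
Proof.
move=> dphi inj; have [c c0 cP] := immersion_bound (immersion_free dphi inj).
pose e := c / 2 / ((2 * m)%:R + 1).
have m0 : 0 < (2 * m)%:R + 1 :> R by rewrite ltr_wpDl.
have e0 : 0 < e by rewrite !divr_gt0.
exists (c / 2); first by rewrite divr_gt0.
rewrite (near_shift 0 x) /=.
have := estimate_of_diff dphi e0; apply: filterS => h /=.
rewrite subr0 addrK => est.
have : c * `|h| <= enorm (phi (h + x) - phi x) + enorm (phi (h + x) - phi x - 'd phi x h).
  apply: le_trans (cP h) _.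
  have -> : \sum_i h 0 i *: partial i phi x = 'd phi x h.
    exact: (etrans (esym (derive_row h dphi)) (deriveE h dphi)).
  move: ('d phi x h) (phi (h + x) - phi x) => L D.
  rewrite {1}(_ : L = D - (D - L)); last by rewrite opprB addrCA subrr addr0.
  by rewrite -[X in _ <= _ + X]enormN; apply: ler_enormD.
have : enorm (phi (h + x) - phi x - 'd phi x h) <= c / 2 * `|h|.
  apply: le_trans (enorm_le_norm _) _.
  apply: le_trans (_ : ((2 * m)%:R + 1) * (e * `|h|) <= _).
    by apply: ler_pM => //; rewrite lerDl.
  by rewrite mulrA /e [_ * (c / 2 / _)]mulrC divfK ?gt_eqF.
move: (enorm (phi (h + x) - phi x)) (enorm (phi (h + x) - phi x - 'd phi x h)) => a b.
lra.
Qed.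

End ImmersionBounds.

Section IntrinsicDistance.
Context {R : realType} {m k : nat} {M : topologicalType} (F : M -> Cspace R m).
Hypothesis hausM : hausdorff_space M.

Lemma idist_arc c : C1_arc F c -> (idist F (c 0%R) (c 1%R) <= arc_length F c)%E.
Proof.
move=> Fc; apply: ereal_inf_lbound; exists [:: c]; first by split.
by rewrite big_seq1.
Qed.

Lemma arc_length_ge0 c : (0 <= arc_length F c)%E.
Proof. by apply: integral_ge0 => x _; rewrite lee_fin enorm_ge0. Qed.

(** Along the curve F stays at a distance less than e from F p, so that the
    times spent in the closed set K and in the open set O are the same. *)
Lemma short_chain_trapped (p : M) (O K : set M) (e : R) :
  open O -> closed K -> O `<=` K -> O p ->
  (forall q, K q -> enorm (F q - F p) < e -> O q) ->
  forall s q, piecewise_C1 F q s p -> (\sum_(c <- s) arc_length F c < e%:E)%E ->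
  O q /\ ((enorm (F q - F p))%:E <= \sum_(c <- s) arc_length F c)%E.
Proof.
move=> oO cK OK Op trap; elim=> [|c s IH] q.
  by move=> /= ->; rewrite big_nil subrr enorm0.
move=> [Fc cq chain]; rewrite big_cons => short.
have s_le : (\sum_(c <- s) arc_length F c <= arc_length F c + \sum_(c <- s) arc_length F c)%E.
  by rewrite -[leLHS]add0e; apply: leeD => //; exact: arc_length_ge0.
have [c1O d1] := IH _ chain (le_lt_trans s_le short).
have dist_t t : 0 <= t <= 1 -> ((enorm (F (c t) - F p))%:E <=
    arc_length F c + \sum_(c <- s) arc_length F c)%E.
  move=> /andP[t0 t1].
  apply: le_trans (leeD (chord_le_arc_length Fc t0 t1 (lexx 1)) d1).
  rewrite -EFinD lee_fin -[X in _ <= X + _]enormN opprB.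
  by apply: le_trans _ (ler_enormD _ _); rewrite addrA subrK.
have [cc _ _] := Fc.
have trapt t : 0 <= t <= 1 -> K (c t) -> O (c t).
  move=> t01 Kt; apply: trap => //; rewrite -lte_fin.
  exact: le_lt_trans (dist_t t t01) short.
suff cO : `[0, 1]%classic `&` c @^-1` O = `[0, 1]%classic.
  have : (`[0, 1]%classic `&` c @^-1` O) 0 by rewrite cO /= in_itv /= lexx ler01.
  move=> [_] /=; rewrite cq => Oq; split=> //.
  by rewrite -cq; apply: dist_t; rewrite lexx ler01.
apply: (@segment_connected R 0 1).
- by exists 1; split; [rewrite /= in_itv /= lexx ler01|].
- by exists (c @^-1` O) => //; move/continuousP: cc; apply.
- exists (c @^-1` K); first by move/continuous_closedP: cc; apply.
  apply/seteqP; split=> t /= [t01 h]; split=> //; first exact: OK.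
  by apply: trapt => //; move: t01; rewrite in_itv.
Qed.

(** The intrinsic distance is compared with the topology of the manifold, which
    is given independently of it, in a chart where F is expanding. *)
Lemma idist_lt_nbhs (W : set 'rV[R]_k) (psi : 'rV[R]_k -> M) z (O : set M) :
  parametrization F W psi -> W z -> open O -> O (psi z) ->
  exists2 e : R, 0 < e & forall q, (idist F q (psi z) < e%:E)%E -> O q.
Proof.
move=> [oW inj cpsi opsi [Spsi dinj]] Wz oO Oz.
have [dF _] := Spsi 1%N.
have [c c0 expand] := immersion_expand (dF z Wz) (dinj z Wz).
have : \forall x \near z, W x /\ O (psi x).
  apply: filterI; first by apply: open_nbhs_nbhs.
  by apply: (cpsi z Wz); apply: open_nbhs_nbhs.
move=> /(filterI expand)/nbhs_ballP[r /= r0 rP].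
pose d := r / 2; have d0 : 0 < d by rewrite /d; lra.
have cball x : closed_ball_ Num.norm z d x -> ball z r x.
  rewrite -ball_normE /ball_ /closed_ball_ /= => h; apply: le_lt_trans h _.
  by rewrite /d; lra.
pose K := psi @` closed_ball_ Num.norm z d.
have oB : open (psi @` ball z d).
  apply: opsi; first exact: ball_open.
  move=> x; rewrite -ball_normE /= => zx.
  by have [_ []] := rP x (cball x (ltW zx)).
have cK : closed K.
  apply: compact_closed => //; apply: continuous_compact.
    apply: continuous_in_subspaceT => x; rewrite inE => /cball/rP[_ [Wx _]].
    exact: cpsi.
  apply: bounded_closed_compact; last exact: closed_closed_ball_.
  exists (`|z| + d); split; first exact: num_real.
  move=> B Bd x zx; apply: le_trans (ltW Bd).
  have -> : x = z - (z - x) by rewrite opprB addrC subrK.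
  by apply: le_trans (ler_normB _ _) _; rewrite lerD2l.
exists (c * d); first by rewrite mulr_gt0.
move=> q /ereal_inf_lt[_ [s chain <-] short].
have BK : psi @` ball z d `<=` K.
  by move=> _ [x zx <-]; exists x => //; move: zx; rewrite -ball_normE /= => /ltW.
have Bp : (psi @` ball z d) (psi z) by exists z => //; apply: ballxx.
have trap q' : K q' -> enorm (F q' - F (psi z)) < c * d -> (psi @` ball z d) q'.
  move=> [x zx <-] near_z; exists x => //.
  rewrite -ball_normE /= distrC -(ltr_pM2l c0); apply: le_lt_trans near_z.
  by have [+ _] := rP x (cball x zx).
have [[x zx <-] _] := short_chain_trapped oB cK BK Bp trap chain short.
have zx' : closed_ball_ Num.norm z d x by move: zx; rewrite -ball_normE /= => /ltW.
by have [_ []] := rP x (cball x zx').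
Qed.

End IntrinsicDistance.

(** * Sections of the projection to a plane *)

Lemma Cr_on_local (R : realType) (U V : normedModType R) r (B : set U) (f : U -> V) :
  (forall x, B x -> exists C : set U, C x /\ Cr_on r C f) -> Cr_on r B f.
Proof.
elim: r f => [|r IH] f loc /=.
  by move=> x Bx; have [C [Cx Cf]] := loc x Bx; apply: Cf.
split=> [x Bx|v]; first by have [C [Cx [Cf _]]] := loc x Bx; apply: Cf.
by apply: IH => x Bx; have [C [Cx [_ Cf]]] := loc x Bx; exists C; split=> //; apply: Cf.
Qed.

Section Sections.
Context {R : realType} {m : nat} {M : topologicalType} (F : M -> Cspace R m).
Hypothesis hausM : hausdorff_space M.
Variables (E : 'I_m -> Cspace R m) (X0 : Cspace R m).
Implicit Types (C W : set 'rV[R]_m) (s psi : 'rV[R]_m -> M) (x y z v : 'rV[R]_m).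

Definition plane_coord (X : Cspace R m) : 'rV[R]_m := \row_i dot (X - X0) (E i).
Notation q := plane_coord.

(** A section of the projection [plane_coord] over C.  It is a parametrization of
    a piece of the submanifold as a graph: injectivity and immersivity follow
    from the last clause. *)
Definition graph_section C s : Prop :=
  [/\ open C, forall x, C x -> {for x, continuous s},
      forall O, open O -> O `<=` C -> open (s @` O),
      smooth_on C (F \o s) & forall x, C x -> q (F (s x)) = x].

Lemma plane_coord_smooth W (phi : 'rV[R]_m -> Cspace R m) : open W ->
  smooth_on W phi -> smooth_on W (q \o phi).
Proof.
move=> oW Sphi r; apply: Cr_on_row => // i.
apply: (@Cr_on_ext _ _ _ r W (fun x => dot (phi x) (E i) + - dot X0 (E i))) => //.
  by move=> x _; rewrite /= mxE dotBl.
by apply: Cr_onD => //; [apply: Cr_on_dot|apply: Cr_on_cst].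
Qed.

Lemma derive_plane_coord (phi : 'rV[R]_m -> Cspace R m) x v :
  differentiable phi x -> differentiable (q \o phi) x /\
  'D_v (q \o phi) x = \row_i dot ('D_v phi x) (E i).
Proof.
move=> dphi.
have h i : is_derive x v (fun y => dot (phi y - X0) (E i) : R) (dot ('D_v phi x) (E i)).
  have -> : (fun y => dot (phi y - X0) (E i)) =
      (fun y => dot (phi y) (E i)) - cst (dot X0 (E i)) :> ('rV[R]_m -> R).
    by apply/funext => y; rewrite dotBl.
  have d1 : is_derive x v (fun y => dot (phi y) (E i) : R) (dot ('D_v phi x) (E i)).
    apply: DeriveDef; last exact: derive_dot.
    by apply: diff_derivable; apply: differentiable_dot.
  by rewrite -[dot ('D_v phi x) _]subr0; apply: is_deriveB.
have dq : differentiable (q \o phi) x.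
  apply: differentiable_row => i.
  have -> : (fun y => (q \o phi) y 0 i : R) = (fun y => dot (phi y) (E i)) - cst (dot X0 (E i)).
    by apply/funext => y; rewrite /= mxE dotBl.
  by apply: differentiableB => //; apply: differentiable_dot.
split=> //; apply/rowP => i; rewrite mxE -(derive_coord v i dq).
have -> : (fun y => (q \o phi) y 0 i : R) = (fun y => dot (phi y - X0) (E i)).
  by apply/funext => y; rewrite /= mxE.
by case: (h i).
Qed.

Lemma section_differentiable C s x : graph_section C s -> C x -> differentiable (F \o s) x.
Proof. by move=> [_ _ _ Ss _] Cx; have [h _] := Ss 1%N; apply: h. Qed.

Lemma section_derive C s x v i : graph_section C s -> C x ->
  dot ('D_v (F \o s) x) (E i) = v 0 i.
Proof.
move=> sC Cx; have ds := section_differentiable sC Cx.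
have [oC _ _ _ qs] := sC.
have [dq Dq] := derive_plane_coord v ds.
have : 'D_v (q \o (F \o s)) x = 'D_v id x.
  apply: near_eq_derive; apply: (near_on_open oC Cx) => y Cy; exact: qs.
by rewrite derive_id Dq => /rowP/(_ i); rewrite mxE.
Qed.

Lemma section_parametrization C s : graph_section C s -> parametrization F C s.
Proof.
move=> sC; have [oC cs os Ss qs] := sC; split=> //.
  by move=> x y; rewrite !inE => Cx Cy sxy; rewrite -(qs x Cx) -(qs y Cy) sxy.
split=> // x Cx v w vw; have ds := section_differentiable sC Cx.
apply/rowP => i; rewrite -(section_derive v i sC Cx) -(section_derive w i sC Cx).
by rewrite (deriveE v ds) (deriveE w ds) vw.
Qed.

Lemma section_restrict C C' s : graph_section C s -> open C' -> C' `<=` C ->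
  graph_section C' s.
Proof.
move=> [oC cs os Ss qs] oC' CC; split=> //.
- by move=> x /CC/cs.
- by move=> O oO OC'; apply: os => // x /OC'/CC.
- by move=> r; apply: Cr_on_subset CC (Ss r).
- by move=> x /CC/qs.
Qed.

Lemma section_local B s : open B ->
  (forall x, B x -> exists C s', [/\ graph_section C s', C x & forall y, C y -> s y = s' y]) ->
  graph_section B s.
Proof.
move=> oB loc; split=> //.
- move=> x Bx; have [C [s' [[oC cs' _ _ _] Cx ss']]] := loc x Bx.
  exact: near_eq_continuous (near_on_open oC Cx (fun y Cy => esym (ss' y Cy))) (cs' x Cx).
- move=> O oO OB; rewrite openE => _ [x Ox <-].
  have [C [s' [[oC _ os' _ _] Cx ss']]] := loc x (OB _ Ox).
  have oOC : open (s' @` (O `&` C)) by apply: os'; [exact: openI|move=> y []].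
  have : nbhs (s x) (s' @` (O `&` C)).
    by apply: open_nbhs_nbhs; split=> //; exists x => //; rewrite ss'.
  apply: filterS => _ [y [Oy Cy] <-].
  by exists y => //; rewrite ss'.
- move=> r; apply: Cr_on_local => x Bx.
  have [C [s' [[oC _ _ Ss' _] Cx ss']]] := loc x Bx.
  exists C; split=> //; apply: Cr_on_ext (Ss' r) => // y Cy.
  by rewrite /= ss'.
- move=> x Bx; have [C [s' [[_ _ _ _ qs'] Cx ss']]] := loc x Bx.
  by rewrite ss' // qs'.
Qed.

Lemma section_agree_open C s1 s2 : graph_section C s1 -> graph_section C s2 ->
  open (C `&` [set x | s1 x = s2 x]).
Proof.
move=> [oC cs1 os1 _ qs1] [_ cs2 _ _ qs2]; rewrite openE => x [Cx s12].
have oI : open (s1 @` C) by apply: os1.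
have near2 : \forall y \near x, (s1 @` C) (s2 y).
  by apply: (cs2 x Cx); apply: open_nbhs_nbhs; split=> //; exists x.
have nearC : \forall y \near x, C y by apply: open_nbhs_nbhs.
apply: filterS2 near2 nearC => y [y' Cy' sy] Cy; split=> //.
have yy : y' = y by rewrite -(qs1 _ Cy') sy qs2.
by rewrite /= -sy yy.
Qed.

Lemma section_disagree_open C s1 s2 : graph_section C s1 -> graph_section C s2 ->
  open (C `&` [set x | s1 x <> s2 x]).
Proof.
move=> [oC cs1 _ _ _] [_ cs2 _ _ _]; rewrite openE => x [Cx /= s12].
move: hausM; rewrite open_hausdorff => /(_ (s1 x) (s2 x)) [|[A B] /= [sA sB] [oA oB AB]].
  by apply/eqP.
rewrite inE in sA; rewrite inE in sB.
have near1 : \forall y \near x, A (s1 y) by apply: (cs1 x Cx); apply: open_nbhs_nbhs.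
have near2 : \forall y \near x, B (s2 y) by apply: (cs2 x Cx); apply: open_nbhs_nbhs.
have nearC : \forall y \near x, C y by apply: open_nbhs_nbhs.
apply: filterS3 near1 near2 nearC => y Ay By Cy.
split=> //= sy; have : (A `&` B) (s1 y) by split=> //; rewrite sy.
by move/eqP: AB => ->.
Qed.

Definition segment_closed C := forall x y (t : R), C x -> C y -> 0 <= t <= 1 ->
  C (x + t *: (y - x)).

Lemma line_continuous x v : continuous (fun t : R => x + t *: v).
Proof.
move=> t; apply: cvgD; first exact: cvg_cst.
by apply: cvgZr_tmp; exact: cvg_id.
Qed.

(** The two sections agree on a set that is open because sections are open maps,
    and closed because the manifold is Hausdorff. *)
Lemma section_unique C s1 s2 x0 : segment_closed C ->
  graph_section C s1 -> graph_section C s2 -> C x0 -> s1 x0 = s2 x0 ->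
  forall x, C x -> s1 x = s2 x.
Proof.
move=> convC S1 S2 Cx0 s0 x Cx.
pose a (t : R) := x0 + t *: (x - x0).
have ca : continuous a by apply: line_continuous.
have Ca t : t \in `[0, 1] -> C (a t) by rewrite in_itv /=; apply: convC.
have : (`[0, 1]%classic `&` a @^-1` (C `&` [set x | s1 x = s2 x])) = `[0, 1]%classic.
  apply: (@segment_connected R 0 1).
  - exists 0; split; first by rewrite /= in_itv /= lexx ler01.
    by rewrite /preimage /a /= scale0r addr0.
  - exists (a @^-1` (C `&` [set x | s1 x = s2 x])) => //.
    by move/continuousP: ca; apply; apply: section_agree_open.
  - exists (~` (a @^-1` (C `&` [set x | s1 x <> s2 x]))).
      apply: open_closedC; move/continuousP: ca; apply.
      exact: section_disagree_open.
    apply/seteqP; split=> t [t01 h]; split=> //.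
      by move=> [_ /=]; case: h.
    split; first exact: Ca.
    by apply: contrapT => h'; apply: h; split=> //; apply: Ca.
move=> /seteqP[_ /(_ 1)]; case; first by rewrite /= in_itv /= lexx ler01.
by move=> _ [_]; rewrite /= /a scale1r addrC subrK.
Qed.

Lemma section_union C1 C2 s1 s2 s : graph_section C1 s1 -> graph_section C2 s2 ->
  (forall x, C1 x -> s x = s1 x) -> (forall x, C2 x -> s x = s2 x) ->
  graph_section (C1 `|` C2) s.
Proof.
move=> S1 S2 e1 e2; have [opn1 _ _ _ _] := S1; have [opn2 _ _ _ _] := S2.
apply: section_local; first exact: openU.
by move=> x [Cx|Cx]; [exists C1, s1|exists C2, s2].
Qed.

(** Transversality makes [plane_coord] a local diffeomorphism in the chart; the
    section is its local inverse. *)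
Lemma local_section W psi z : parametrization F W psi -> W z ->
  (forall v, (forall i, dot ('D_v (F \o psi) z) (E i) = 0) -> v = 0) ->
  exists (d : R) (s : 'rV[R]_m -> M) (O : set M),
    [/\ 0 < d, graph_section (ball (q (F (psi z))) d) s, open O, O (psi z) &
        forall u, O u -> ball (q (F (psi z))) d (q (F u)) -> s (q (F u)) = u].
Proof.
move=> [oW _ cpsi opsi [Spsi _]] Wz trans.
pose f := q \o (F \o psi).
have Sf : smooth_on W f by apply: plane_coord_smooth.
have dpsi x : W x -> differentiable (F \o psi) x by move=> Wx; have [h _] := Spsi 1%N; apply: h.
have inj : injective ('d f z).
  have [df _] := derive_plane_coord 0 (dpsi z Wz).
  move=> v w vw; apply/eqP; rewrite -subr_eq0; apply/eqP; apply: trans => i.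
  have [_ Df] := derive_plane_coord (v - w) (dpsi z Wz).
  have : 'D_(v - w) f z = 0 by rewrite (deriveE _ df) linearB /= vw subrr.
  by rewrite Df => /rowP/(_ i); rewrite !mxE.
have [Z [g [d [d0 oZ ZW Zz [gP gf Sg]]]]] := inverse_function oW Wz Sf inj.
exists d, (psi \o g), (psi @` Z).
split; [exact: d0| |exact: opsi|by exists z|by move=> _ [z' Zz' <-] /= h; rewrite gf].
have oB : open (ball (f z) d) by apply: ball_open.
have cg x : ball (f z) d x -> {for x, continuous g} by exact: (Sg 0%N).
have cf : {in Z, continuous f} by move=> x; rewrite inE => /ZW; exact: (Sf 0%N).
split=> //.
- move=> x bx; apply: continuous_comp; first exact: cg.
  by apply: cpsi; apply: ZW; case: (gP x bx).
- move=> O oO OB.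
  have -> : (psi \o g) @` O = psi @` (Z `&` f @^-1` O).
    apply/seteqP; split=> [_ [x Ox <-]|_ [x [Zx Ofx] <-]].
      have [Zg fg] := gP x (OB _ Ox).
      by exists (g x) => //; split=> //; rewrite /preimage /= -/(f (g x)) fg.
    exists (f x) => //=.
    by rewrite gf //; apply: OB.
  apply: opsi; last by move=> x [/ZW].
  by move/(continuous_inP _ oZ): cf; apply.
- move=> r; apply: Cr_on_Cspace => // w.
  apply: (@Cr_on_comp _ _ _ r (ball (f z) d) W (fun z => dot (F (psi z)) w) g) => //.
    by move=> x bx; apply: ZW; case: (gP x bx).
  exact: (Cr_on_dot w oW (Spsi r)).
- by move=> x bx; case: (gP x bx).
Qed.

(** The transition map from a chart to a section is the projection to the
    plane of the graph. *)
Lemma transition_derive C s W psi z y v : graph_section C s -> C y ->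
  parametrization F W psi -> W z -> psi z = s y ->
  'D_v (F \o psi) z = 'D_(\row_i dot ('D_v (F \o psi) z) (E i)) (F \o s) y.
Proof.
move=> sC Cy [oW _ cpsi _ [Spsi _]] Wz zy.
have dpsi : differentiable (F \o psi) z by have [h _] := Spsi 1%N; apply: h.
have [df Df] := derive_plane_coord v dpsi.
set f := q \o (F \o psi) in df Df.
have [oD _ og _ qg] := sC.
have fz : f z = y by rewrite /f /= zy qg.
have near_f : \forall z' \near z, (F \o psi) z' = ((F \o s) \o f) z'.
  have h : \forall z' \near z, (s @` C) (psi z').
    apply: (cpsi z Wz); apply: open_nbhs_nbhs; split; first exact: og.
    by exists y.
  apply: filterS h => z' [y' ry' yz'].
  by rewrite /f /= -yz' qg.
have dg : differentiable (F \o s) (f z).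
  by rewrite fz; apply: section_differentiable sC Cy.
rewrite -Df (near_eq_derive _ near_f) (deriveE _ (differentiable_comp df dg)).
by rewrite (diff_comp df dg) /= -(deriveE _ df) -(deriveE _ dg) fz.
Qed.

End Sections.

(** * The slope of a graph *)

Lemma inverse_growth (R : realType) (a b c d r : R) : 1 <= a -> 1 <= b -> a <= c ->
  `|d| <= r -> r <= (2 * c)^-1 -> b^-1 - a^-1 = d -> b <= 2 * c.
Proof.
move=> a1 b1 ac dr rc E.
have a0 : 0 < a by lra. have b0 : 0 < b by lra. have c0 : 0 < c by lra.
have ca : c^-1 <= a^-1 by rewrite lef_pV2.
have half : (2 * c)^-1 = c^-1 - (2 * c)^-1 by field; rewrite gt_eqF.
have : (2 * c)^-1 <= b^-1 by have := ler_norm (- d); rewrite normrN; lra.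
by rewrite lef_pV2 ?posrE ?mulr_gt0.
Qed.

Section SlopeBound.
Context {R : realType} {m : nat}.

Lemma is_derive_dot (f g : R -> Cspace R m) (f' g' : Cspace R m) (t : R) :
  is_derive t (1 : R) f f' -> is_derive t (1 : R) g g' ->
  is_derive t (1 : R) (fun s => dot (f s) (g s) : R) (dot f' (g t) + dot (f t) g').
Proof.
move=> Df Dg.
have h (u : R -> Cspace R m) u' w : is_derive t (1 : R) u u' ->
    is_derive t (1 : R) (fun s => dot (u s) w : R) (dot u' w).
  move=> [du uE]; have du' : differentiable u t by apply/derivable1_diffP.
  apply: DeriveDef; first by apply: diff_derivable; apply: differentiable_dot.
  by rewrite -uE; apply: derive_dot.
pose e1 i : Cspace R m := (delta_mx 0 i, 0); pose e2 i : Cspace R m := (0, delta_mx 0 i).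
have dotE (z w : Cspace R m) :
    dot z w = \sum_i (dot z (e1 i) * dot w (e1 i) + dot z (e2 i) * dot w (e2 i)).
  rewrite [w in LHS]Cspace_sum_delta dot_sumr; apply: eq_bigr => i _.
  by rewrite dotDr !dotZr mulrC [X in _ + X]mulrC.
pose k i : R -> R := (fun s => dot (f s) (e1 i)) * (fun s => dot (g s) (e1 i)) +
  (fun s => dot (f s) (e2 i)) * (fun s => dot (g s) (e2 i)).
have -> : (fun s => dot (f s) (g s) : R) = \sum_(i < m) k i.
  by apply/funext => s; rewrite fct_sumE dotE.
have dk i : is_derive t (1 : R) (k i)
   ((dot (f t) (e1 i) *: dot g' (e1 i) + dot (g t) (e1 i) *: dot f' (e1 i)) +
    (dot (f t) (e2 i) *: dot g' (e2 i) + dot (g t) (e2 i) *: dot f' (e2 i))).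
  by apply: is_deriveD; apply: is_deriveM; apply: h.
apply: (is_derive_eq (is_derive_sum dk)).
rewrite !dotE -big_split; apply: eq_bigr => i _ /=.
by rewrite /GRing.scale /=; ring.
Qed.

(** T lies in the span of the b k, which is transverse to the orthogonal
    complement of the span of the E k; as X belongs to that complement, T is
    determined by the components of A along the E k. *)
Lemma oblique_component_bound (E b : 'I_m -> Cspace R m) (A T X : Cspace R m)
  (c : 'I_m -> R) (sg : R) :
  (forall i j, dot (E i) (E j) = (i == j)%:R) ->
  (forall i k, dot (b i) (E k) = (i == k)%:R) ->
  (forall i, enorm (b i) <= sg) -> 1 <= sg ->
  X = A + T -> T = \sum_k c k *: b k -> (forall k, dot X (E k) = 0) ->
  enorm X <= enorm A * ((1 + m%:R) * sg).
Proof.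
move=> onE bE b_le sg1 XE TE XE0; have sg0 : 0 <= sg by apply: le_trans sg1.
have cE k : c k = - dot A (E k).
  have := XE0 k; rewrite XE dotDl => /eqP; rewrite addrC addr_eq0 => /eqP <-.
  rewrite TE dot_suml (bigD1 k) //= dotZl bE eqxx mulr1.
  by rewrite big1 ?addr0 // => l lk; rewrite dotZl bE (negbTE lk) mulr0.
have cA k : `|c k| <= enorm A.
  rewrite cE normrN; apply: le_trans (dot_le_enorm _ _) _.
  by rewrite [enorm (E k)](_ : _ = 1) ?mulr1 // /enorm onE eqxx sqrtr1.
have TA : enorm T <= enorm A * (m%:R * sg).
  rewrite TE; apply: le_trans (ler_enorm_sum _ _ _) _.
  have -> : enorm A * (m%:R * sg) = \sum_(k < m) enorm A * sg.
    by rewrite sumr_const card_ord -[RHS]mulr_natl mulrCA.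
  apply: ler_sum => k _; rewrite enormZ; apply: ler_pM; rewrite ?enorm_ge0 ?cA ?b_le //.
have XA : enorm X <= enorm A + enorm T by rewrite XE; apply: ler_enormD.
have A0 := enorm_ge0 A.
apply: le_trans XA _.
rewrite mulrDl mulrDr mul1r; apply: lerD => //.
by rewrite -[leLHS]mulr1 ler_wpM2l.
Qed.

Context {M : topologicalType} (F : M -> Cspace R m).
Variables (E : 'I_m -> Cspace R m) (X0 : Cspace R m).
Hypothesis onE : forall i j, dot (E i) (E j) = (i == j)%:R.
Variables (C : set 'rV[R]_m) (s : 'rV[R]_m -> M) (K : R).
Hypothesis sC : graph_section F E X0 C s.
Hypothesis AK : forall x, C x -> second_form_norm (F \o s) x <= K.
Let phi := F \o s.
Implicit Types x v : 'rV[R]_m.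

(** Adding 1 bounds every power of the slope by higher powers of [slope2]. *)
Definition slope2 x : R := 1 + \sum_i dot (partial i phi x) (partial i phi x).

Lemma slope2_ge1 x : 1 <= slope2 x.
Proof. by rewrite lerDl; apply: sumr_ge0 => i _; apply: dot_ge0. Qed.

Lemma partial_le_slope i x : enorm (partial i phi x) <= Num.sqrt (slope2 x).
Proof.
rewrite ler_wsqrtr // /slope2 (bigD1 i) //= addrCA lerDl addr_ge0 //.
by apply: sumr_ge0 => j _; apply: dot_ge0.
Qed.

Lemma phi_smooth : smooth_on C phi. Proof. by case: sC. Qed.

Lemma partial_differentiable i x : C x -> differentiable (partial i phi) x.
Proof. by move=> Cx; have [_ /(_ (delta_mx 0 i)) [h _]] := phi_smooth 2%N; apply: h. Qed.

Lemma partial_dot_E i k x : C x -> dot (partial i phi x) (E k) = (i == k)%:R.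
Proof.
move=> Cx; rewrite (section_derive (delta_mx 0 i) k sC Cx) mxE eqxx /=.
by rewrite eq_sym.
Qed.

Lemma second_partial_dot_E i j k x : C x -> dot (partial j (partial i phi) x) (E k) = 0.
Proof.
move=> Cx; have [oC _ _ _ _] := sC.
rewrite -(derive_dot _ _ (partial_differentiable i Cx)).
rewrite (@near_eq_derive _ _ _ _ (cst ((i == k)%:R : R))) ?derive_cst //.
apply: (near_on_open oC Cx) => y Cy; exact: partial_dot_E.
Qed.

(** The second derivatives of a graph parametrisation are normal to the plane
    of projection, so that their tangential part is controlled by their normal
    part, the second fundamental form. *)
Lemma second_partial_le i j x : C x ->
  enorm (partial j (partial i phi) x) <=
    K * (1 + m%:R) * Num.sqrt (slope2 x) ^+ 3.
Proof.
move=> Cx; set sg := Num.sqrt (slope2 x).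
have sg1 : 1 <= sg by rewrite -[leLHS]sqrtr1 ler_wsqrtr // slope2_ge1.
have sg0 : 0 <= sg by apply: le_trans sg1.
have [A [T [c [AE XE TE]]]] : exists A T (c : 'I_m -> R),
    [/\ enorm A <= K * sg ^+ 2, partial j (partial i phi) x = A + T &
        T = \sum_k c k *: partial k phi x].
  have [_ _ _ _ [_ dinj]] := section_parametrization sC.
  have free := immersion_free (section_differentiable sC Cx) (dinj x Cx).
  exists (second_form phi x j i), (tangent_part phi x (partial j (partial i phi) x)).
  exists (fun k => \sum_l imetric phi x k l * dot (partial j (partial i phi) x) (partial l phi x)).
  split; last by apply: eq_bigr => k _; rewrite scaler_suml.
    apply: le_trans (second_form_le j i free) _.
    rewrite expr2; apply: ler_pM (AK Cx) _; rewrite ?sqrtr_ge0 ?mulr_ge0 ?enorm_ge0 //.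
    by apply: ler_pM; rewrite ?enorm_ge0 ?partial_le_slope.
  by rewrite /second_form /normal_part subrK.
have XE0 k : dot (partial j (partial i phi) x) (E k) = 0 by apply: second_partial_dot_E.
have := oblique_component_bound onE (fun a b => partial_dot_E a b Cx)
  (fun a => partial_le_slope a x) sg1 XE TE XE0.
move=> h; apply: le_trans h _.
rewrite exprS [K * _ * _](_ : _ = (K * sg ^+ 2) * ((1 + m%:R) * sg)); last by ring.
by apply: ler_wpM2r => //; rewrite mulr_ge0 // addr_ge0.
Qed.

Hypothesis convC : segment_closed C.
Hypothesis C0 : C 0.

Definition slope_rate : R := 2 * m%:R ^+ 2 * (1 + m%:R) * K.

Lemma slope2_line x (t : R) : C x -> 0 <= t <= 1 ->
  exists2 dk : R, is_derive t (1 : R) (fun t : R => slope2 (0 + t *: (x - 0))) dk &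
    `|dk| <= slope_rate * `|x| * slope2 (0 + t *: (x - 0)) ^+ 2.
Proof.
move=> Cx t01; rewrite subr0; set y := 0 + t *: x.
have Cy : C y by rewrite /y -[x in _ *: x]subr0; apply: convC.
pose f i (t : R) : Cspace R m := partial i phi (0 + t *: x).
pose f' i : Cspace R m := 'D_x (partial i phi) y.
have df i : is_derive t (1 : R) (f i) (f' i).
  by apply: is_derive_line; apply: partial_differentiable.
have ds i := is_derive_dot (df i) (df i).
exists (\sum_i (dot (f' i) (f i t) + dot (f i t) (f' i))).
  have -> : (fun t : R => slope2 (0 + t *: x)) =
      cst 1 + \sum_(i < m) (fun s => dot (f i s) (f i s) : R).
    by apply/funext => r; rewrite /slope2 !fctE fct_sumE.
  have D1 : is_derive t (1 : R) (cst 1 : R -> R) 0 by apply: is_derive_cst.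
  by apply: (is_derive_eq (is_deriveD D1 (is_derive_sum ds))); rewrite add0r.
set sg := Num.sqrt (slope2 y).
have sg0 : 0 <= sg by apply: sqrtr_ge0.
have sg2 : sg ^+ 2 = slope2 y.
  by rewrite sqr_sqrtr //; apply: le_trans (slope2_ge1 y).
have f'E i : enorm (f' i) <= m%:R * (`|x| * (K * (1 + m%:R) * sg ^+ 3)).
  rewrite /f' (derive_row x (partial_differentiable i Cy)).
  apply: le_trans (ler_enorm_sum _ _ _) _.
  have -> : m%:R * (`|x| * (K * (1 + m%:R) * sg ^+ 3)) =
      \sum_(j < m) (`|x| * (K * (1 + m%:R) * sg ^+ 3)).
    by rewrite sumr_const card_ord -[RHS]mulr_natl.
  apply: ler_sum => j _; rewrite enormZ; apply: ler_pM; rewrite ?enorm_ge0 //.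
    exact: coord_le_norm.
  exact: second_partial_le.
apply: le_trans (ler_norm_sum _ _ _) _.
have -> : slope_rate * `|x| * slope2 y ^+ 2 =
    \sum_(i < m) (2 * (m%:R * (`|x| * (K * (1 + m%:R) * sg ^+ 3)) * sg)).
  by rewrite sumr_const card_ord -[RHS]mulr_natl -sg2 /slope_rate; ring.
apply: ler_sum => i _.
have di : `|dot (f' i) (f i t)| <= m%:R * (`|x| * (K * (1 + m%:R) * sg ^+ 3)) * sg.
  apply: le_trans (dot_le_enorm _ _) _; apply: ler_pM; rewrite ?enorm_ge0 //.
  exact: partial_le_slope.
have di' : `|dot (f i t) (f' i)| <= m%:R * (`|x| * (K * (1 + m%:R) * sg ^+ 3)) * sg.
  by rewrite (dotC (f i t) (f' i)).
apply: le_trans (ler_normD _ _) _; rewrite mulr_natl mulr2n.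
exact: lerD di di'.
Qed.

(** Along a ray the squared slope S satisfies |S'| <= B |x| S^2, that is
    |(1/S)'| <= B |x|: it cannot double before B |x| = 1 / (2 S(0)). *)
Lemma slope_bound x : C x -> slope2 0 <= 1 + m%:R ->
  slope_rate * `|x| <= (2 * (1 + m%:R))^-1 -> slope2 x <= 2 * (1 + m%:R).
Proof.
move=> Cx S0 small.
pose k (t : R) := slope2 (0 + t *: (x - 0)).
have k1 t : 1 <= k t by apply: slope2_ge1.
have kp t : 0 < k t by apply: lt_le_trans (k1 t).
have dk (t : R) : 0 <= t <= 1 -> exists2 d : R, is_derive t (1 : R) (fun t => (k t)^-1) d &
    `|d| <= slope_rate * `|x|.
  move=> t01; have [d Dd dle] := slope2_line Cx t01.
  have kn0 : k t != 0 by rewrite gt_eqF.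
  have [dkt kE] : is_derive t (1 : R) k d by exact: Dd.
  have DV : is_derive t (1 : R) (fun t => (k t)^-1) (- k t ^- 2 *: d).
    by apply: DeriveDef; [exact: derivableV|rewrite deriveV // kE].
  exists (- k t ^- 2 *: d) => //.
  have -> : `|- k t ^- 2 *: d| = `|d| / k t ^+ 2.
    rewrite normrZ normrN normfV (ger0_norm (exprn_ge0 2 (ltW (kp t)))).
    by rewrite mulrC.
  by rewrite ler_pdivrMr ?exprn_gt0.
have [|||t t01 kE] := @MVT_segment R (fun t => (k t)^-1) (fun t => 'D_1 (fun t => (k t)^-1) t) 0 1.
- exact: ler01.
- move=> t; rewrite in_itv /= => /andP[t0 t1].
  have [|d [dV _] _] := dk t; first by rewrite !ltW.
  exact: derivableP.
- apply: derivable_within_continuous => t; rewrite in_itv /= => /dk[d [dV _] _].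
  exact: dV.
have [d [_ dE] dle] : exists2 d : R, is_derive t (1 : R) (fun t => (k t)^-1) d &
    `|d| <= slope_rate * `|x| by apply: dk; move: t01; rewrite in_itv.
have e0 : 0 + (0 : R) *: (x - 0) = 0 by rewrite scale0r addr0.
have k0E : k 0 = slope2 0 := congr1 slope2 e0.
have e1 : 0 + (1 : R) *: (x - 0) = x by rewrite scale1r add0r subr0.
have k1E : k 1 = slope2 x := congr1 slope2 e1.
apply: (inverse_growth (slope2_ge1 0) (slope2_ge1 x) S0 dle small).
by move: kE; rewrite dE subr0 mulr1 k0E k1E.
Qed.

End SlopeBound.

(** * Continuation of a graph over a ball of uniform radius *)

Lemma harmonic_small (R : realType) (c e : R) : 0 < e ->
  exists N, forall n, (N <= n)%N -> c * n.+1%:R^-1 < e.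
Proof.
move=> e0; exists (Num.trunc (c / e)) => n.
by rewrite truncn_le_nat ltr_pdivrMr // ltr_pdivrMr // mulrC.
Qed.

Lemma perturbed_bound_contra (R : realType) (a b c d d' l k : R) :
  a <= l * d' -> l * d' <= l * (d + k * c) -> b <= a + c ->
  (l * k + 1) * c < b - l * d -> False.
Proof. lra. Qed.

Section Continuation.
Context {R : realType} {m : nat} {M : topologicalType} (F : M -> Cspace R m).
Hypothesis hausM : hausdorff_space M.
Hypothesis chartM : forall p : M, exists (W : set 'rV[R]_m) (psi : 'rV[R]_m -> M),
  parametrization F W psi /\ (psi @` W) p.
Hypothesis completeM : complete_submanifold F.
Variable K : R.
Hypothesis AK : forall (W : set 'rV[R]_m) (psi : 'rV[R]_m -> M),
  parametrization F W psi -> forall x, W x -> second_form_norm (F \o psi) x <= K.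
Variable p : M.
Variable E : 'I_m -> Cspace R m.
Hypothesis onE : forall i j, dot (E i) (E j) = (i == j)%:R.
Variables (d0 : R) (s0 : 'rV[R]_m -> M).
Hypothesis d0_gt0 : 0 < d0.
Notation q := (plane_coord E (F p)).
Notation section := (graph_section F E (F p)).
Hypothesis s0_section : section (ball 0 d0) s0.
Hypothesis s0p : s0 0 = p.
Hypothesis s0_slope : slope2 F s0 0 <= 1 + m%:R.
Variable r : R.
Hypothesis r_small : forall a : R, a <= r ->
  @slope_rate R m K * a <= (2 * (1 + m%:R))^-1.
Implicit Types (C : set 'rV[R]_m) (s : 'rV[R]_m -> M) (x y z v : 'rV[R]_m).

(** Convexity makes any two pieces agree where both are defined, since they
    agree at 0 and their domains meet in a convex set.  The pieces thus glue to
    one section [glue] over the union [reach] of their domains. *)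
Definition piece C s := [/\ section C s, segment_closed C, C 0 & s 0 = p].

Lemma segment_closedI C C' : segment_closed C -> segment_closed C' ->
  segment_closed (C `&` C').
Proof. by move=> h h' x y t [Cx Cx'] [Cy Cy'] t01; split; [apply: h|apply: h']. Qed.

Lemma segment_closed_ball x (e : R) : segment_closed (ball x e).
Proof. by move=> y z t By Bz t01; apply: ball_line. Qed.

Lemma sections_agree C C' s s' x0 : segment_closed C -> segment_closed C' ->
  section C s -> section C' s' -> C x0 -> C' x0 -> s x0 = s' x0 ->
  forall x, C x -> C' x -> s x = s' x.
Proof.
move=> convC convC' S S' Cx0 Cx0' e x Cx Cx'.
have [oC _ _ _ _] := S; have [oC' _ _ _ _] := S'.
have oI : open (C `&` C') by apply: openI.
apply: (@section_unique R m M F hausM E (F p) (C `&` C') s s' x0) => //.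
- exact: segment_closedI.
- by apply: section_restrict S oI _ => y [].
- by apply: section_restrict S' oI _ => y [].
Qed.

Lemma piece_agree C C' s s' x : piece C s -> piece C' s' -> C x -> C' x -> s x = s' x.
Proof.
move=> [S convC C0 s00] [S' convC' C0' s00'].
by apply: (sections_agree convC convC' S S' C0 C0'); rewrite s00 s00'.
Qed.

Lemma initial_piece : piece (ball 0 d0) s0.
Proof. by split=> //; [apply: segment_closed_ball|apply: ballxx]. Qed.

Lemma partial_near_eq s s' x i : (\forall y \near x, s y = s' y) ->
  partial i (F \o s) x = partial i (F \o s') x.
Proof. by move=> ss; apply: near_eq_derive; apply: filterS ss => y /= ->. Qed.

Lemma slope2_near_eq s s' x : (\forall y \near x, s y = s' y) -> slope2 F s x = slope2 F s' x.
Proof.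
move=> ss; rewrite /slope2; apply: (congr1 (fun a => 1 + a)); apply: eq_bigr => i _.
exact: (congr2 dot (partial_near_eq i ss) (partial_near_eq i ss)).
Qed.

Lemma piece_slope C s x : piece C s -> C x -> `|x| <= r ->
  slope2 F s x <= 2 * (1 + m%:R).
Proof.
move=> Cs Cx xr; have [S convC C0 s00] := Cs.
apply: (slope_bound onE S _ convC C0 Cx _ (r_small xr)).
  exact: AK (section_parametrization S).
have [oC _ _ _ _] := S.
have n0 : \forall y \near (0 : 'rV[R]_m), s y = s0 y.
  have n1 : \forall y \near (0 : 'rV[R]_m), C y by apply: open_nbhs_nbhs.
  have n2 : \forall y \near (0 : 'rV[R]_m), ball 0 d0 y by apply: nbhsx_ballx.
  by apply: filterS2 n1 n2 => y Cy By; apply: (piece_agree Cs initial_piece).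
by rewrite (slope2_near_eq n0).
Qed.

Definition lip : R := m%:R * (2 * (1 + m%:R)).

Lemma lip_ge0 : 0 <= lip.
Proof. by rewrite !mulr_ge0 // addr_ge0. Qed.

Lemma piece_derive_le C s x v : piece C s -> C x -> `|x| <= r ->
  enorm ('D_v (F \o s) x) <= lip * `|v|.
Proof.
move=> Cs Cx xr; have [S _ _ _] := Cs.
have slope := piece_slope Cs Cx xr.
have part i : enorm (partial i (F \o s) x) <= 2 * (1 + m%:R).
  apply: le_trans (partial_le_slope F s i x) _.
  apply: le_trans _ slope.
  have := slope2_ge1 F s x; move: (slope2 F s x) => S2 S21.
  rewrite -[leRHS]ger0_norm; last by lra.
  rewrite -sqrtr_sqr ler_wsqrtr //; nra.
rewrite (derive_row v (section_differentiable S Cx)).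
apply: le_trans (ler_enorm_sum _ _ _) _.
have -> : lip * `|v| = \sum_(i < m) `|v| * (2 * (1 + m%:R)).
  by rewrite sumr_const card_ord -[RHS]mulr_natl /lip; ring.
apply: ler_sum => i _; rewrite enormZ; apply: ler_pM; rewrite ?enorm_ge0 //.
  exact: coord_le_norm.
exact: part.
Qed.

Definition reach : set 'rV[R]_m := [set x | exists C s, piece C s /\ C x].

Definition glue x : M := xget p [set u | exists C s, [/\ piece C s, C x & s x = u]].

Lemma glueE C s x : piece C s -> C x -> glue x = s x.
Proof.
move=> Cs Cx; have : [set u | exists C s, [/\ piece C s, C x & s x = u]] (glue x).
  by apply: xgetPex; exists (s x), C, s.
by move=> [C' [s' [Cs' Cx' <-]]]; apply: piece_agree Cx' Cx.
Qed.

Lemma reach_open : open reach.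
Proof.
rewrite openE => x [C [s [Cs Cx]]]; have [[oC _ _ _ _] _ _ _] := Cs.
have nC : nbhs x C by apply: open_nbhs_nbhs.
by apply: filterS nC => y Cy; exists C, s.
Qed.

Lemma glue_section : section reach glue.
Proof.
apply: section_local; first exact: reach_open.
move=> x [C [s [Cs Cx]]]; exists C, s; split=> //; first by case: Cs.
by move=> y Cy; apply: (glueE Cs Cy).
Qed.

Lemma reach0 : reach 0.
Proof. by exists (ball 0 d0), s0; split; [apply: initial_piece|apply: ballxx]. Qed.

Lemma piece_star C s x (t : R) : piece C s -> C x -> 0 <= t <= 1 -> C (t *: x).
Proof.
move=> [_ convC C0 _] Cx t01; have := convC 0 x t C0 Cx t01.
by rewrite add0r subr0.
Qed.

Lemma reach_star x (t : R) : reach x -> 0 <= t <= 1 -> reach (t *: x).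
Proof. by move=> [C [s [Cs Cx]]] t01; exists C, s; split=> //; apply: piece_star Cs Cx t01. Qed.

Lemma glue_near C s x : piece C s -> C x -> \forall y \near x, glue y = s y.
Proof.
move=> Cs Cx; have [[oC _ _ _ _] _ _ _] := Cs.
have nC : \forall y \near x, C y by apply: open_nbhs_nbhs.
by apply: filterS nC => y Cy; apply: glueE Cs Cy.
Qed.

Lemma glue_derive_le x v : reach x -> `|x| <= r -> enorm ('D_v (F \o glue) x) <= lip * `|v|.
Proof.
move=> [C [s [Cs Cx]]] xr.
have -> : 'D_v (F \o glue) x = 'D_v (F \o s) x.
  by apply: near_eq_derive; apply: filterS (glue_near Cs Cx) => y /= ->.
exact: piece_derive_le Cs Cx xr.
Qed.

(** Arcs have to be defined on the whole real line: a segment is travelled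
    back and forth, at the pace of a cosine. *)
Definition pace (t t' : R) (u : R) : R := t + (t' - t) * ((1 - cos (pi * u)) / 2).

Lemma pace_mem t t' u (a b : R) : a <= t <= b -> a <= t' <= b -> a <= pace t t' u <= b.
Proof.
move=> /andP[t0 t1] /andP[u0 u1]; rewrite /pace.
have := cos_le1 (pi * u); have := cos_geN1 (pi * u).
move: (cos (pi * u)) => c c0 c1; nra.
Qed.

Lemma is_derive_pace t t' u :
  is_derive u (1 : R) (pace t t') ((t' - t) * (pi * sin (pi * u) / 2)).
Proof.
rewrite /pace; apply: is_derive_eq.
by rewrite /GRing.scale /=; ring.
Qed.

Lemma is_derive_reparam (V : normedModType R) (g : R -> V) (h : R -> R) (g' : V) (h' u : R) :
  is_derive (h u) (1 : R) g g' -> is_derive u (1 : R) h h' ->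
  is_derive u (1 : R) (g \o h) (h' *: g').
Proof.
move=> [dg gE] [dh hE].
have dg' : differentiable g (h u) by apply/derivable1_diffP.
have dh' : differentiable h u by apply/derivable1_diffP.
have dgh : differentiable (g \o h) u by apply: differentiable_comp.
apply: DeriveDef; first exact: diff_derivable.
rewrite (deriveE _ dgh) diff_comp //= -(deriveE _ dh') hE.
rewrite -[h' in LHS]mulr1 -[h' * 1]/(h' *: (1 : R^o)) linearZ -gE.
by rewrite (deriveE _ dg').
Qed.

Lemma glue_idist x (b t t' : R) : (forall u, 0 <= u <= b -> reach (u *: x)) ->
  b <= 1 -> `|x| <= r -> 0 <= t <= b -> 0 <= t' <= b ->
  (idist F (glue (t *: x)) (glue (t' *: x)) <= (lip * `|x| * pi * `|t' - t|)%:E)%E.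
Proof.
move=> reach_b b1 xr tb tb'.
pose c u := glue (0 + pace t t' u *: x).
have rc u : reach (0 + pace t t' u *: x).
  by rewrite add0r; apply/reach_b/pace_mem.
have xc u : `|0 + pace t t' u *: x| <= r.
  rewrite add0r normrZ; apply: le_trans xr; rewrite -[leRHS]mul1r ler_wpM2r //.
  by have /andP[h0 h1] := pace_mem u tb tb'; rewrite ger0_norm // (le_trans h1).
have c0 : c 0 = glue (t *: x).
  by rewrite /c /pace mulr0 cos0 subrr mul0r mulr0 addr0 add0r.
have c1 : c 1 = glue (t' *: x).
  have p1 : pace t t' 1 = t' by rewrite /pace mulr1 cospi; field.
  by rewrite /c p1 add0r.
have cg u : {for 0 + pace t t' u *: x, continuous glue}.
  by have [_ h _ _ _] := glue_section; apply: h.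
have cpace : continuous (pace t t').
  move=> u; apply: differentiable_continuous; apply/derivable1_diffP.
  by case: (is_derive_pace t t' u).
have cline : continuous (fun u => 0 + pace t t' u *: x).
  move=> u; apply: cvgD; first exact: cvg_cst.
  by apply: cvgZr_tmp; exact: cpace.
pose z' u := (t' - t) * (pi * sin (pi * u) / 2).
pose D y := 'D_x (F \o glue) y.
have dc u : is_derive u (1 : R) (F \o c) (z' u *: D (0 + pace t t' u *: x)).
  have d1 : is_derive (pace t t' u) (1 : R) (fun s : R => (F \o glue) (0 + s *: x))
      (D (0 + pace t t' u *: x)).
    by apply: is_derive_line; apply: section_differentiable glue_section (rc u).
  exact: (is_derive_reparam d1 (is_derive_pace t t' u)).
have dcE : derive1 (F \o c) = fun u => z' u *: D (0 + pace t t' u *: x).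
  by apply/funext => u; rewrite derive1E; case: (dc u).
have Fc : C1_arc F c.
  split.
  - move=> u; apply: (@continuous_comp _ _ _ (fun u => 0 + pace t t' u *: x) glue).
      exact: cline.
    exact: cg.
  - by move=> u; case: (dc u).
  - rewrite dcE => u; apply: cvgZ.
      apply: cvgM; first exact: cvg_cst.
      apply: cvgM; last exact: cvg_cst.
      apply: cvgM; first exact: cvg_cst.
      apply: (@continuous_comp _ _ _ (fun u => pi * u) sin); last exact: continuous_sin.
      by apply: cvgM; [exact: cvg_cst|exact: cvg_id].
    apply: (@continuous_comp _ _ _ (fun u => 0 + pace t t' u *: x) D); first exact: cline.
    by have [_ _ _ /(_ 1%N)[_ /(_ x) h] _] := glue_section; apply: h.
rewrite -c0 -c1; apply: le_trans (idist_arc Fc) _; apply: arc_length_le => // u _.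
rewrite dcE enormZ mulrC -mulrA.
apply: ler_pM; rewrite ?enorm_ge0 //; first exact: glue_derive_le.
rewrite /z' normrM mulrC; apply: ler_wpM2r => //.
rewrite normrM normrM (ger0_norm (pi_ge0 R)) -mulrA ler_piMr ?pi_ge0 //.
have : `|sin (pi * u)| <= 1 by rewrite ler_norml sin_le1 sin_geN1.
by move: (`|sin (pi * u)|) => a; rewrite ger0_norm ?invr_ge0 //; lra.
Qed.

Definition approach (n : nat) : R := 1 - n.+1%:R^-1.

Lemma approach_itv n : 0 <= approach n < 1.
Proof. by rewrite /approach subr_ge0 invf_le1 // ler1n /= gtrBl invr_gt0. Qed.

(** The sequence is Cauchy because the lift of a segment has a length at most
    proportional to that of the segment. *)
Lemma limit_point x : `|x| <= r -> (forall t : R, 0 <= t < 1 -> reach (t *: x)) ->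
  exists p1, forall O : set M, open O -> O p1 ->
    exists N, forall n, (N <= n)%N -> O (glue (approach n *: x)).
Proof.
move=> xr below.
pose c := lip * `|x| * pi.
have c0 : 0 <= c by rewrite !mulr_ge0 ?lip_ge0 ?pi_ge0.
have [|p1 p1P] := completeM (u := fun n => glue (approach n *: x)).
  move=> e e0; have [N NP] := harmonic_small c e0.
  exists N => i j Ni Nj; pose b := Num.max (approach i) (approach j).
  have b1 : b < 1 by rewrite gt_max !(proj2 (andP (approach_itv _))).
  apply: (@le_lt_trans _ _ (c * `|approach j - approach i|)%:E).
    apply: (@glue_idist x b) => //; rewrite ?(ltW b1) //.
    - by move=> u /andP[u0 ub]; apply: below; rewrite u0 (le_lt_trans ub).
    - by rewrite (proj1 (andP (approach_itv _))) /b le_max lexx.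
    - by rewrite (proj1 (andP (approach_itv _))) /b le_max lexx orbT.
  rewrite lte_fin; apply: le_lt_trans (NP N (leqnn N)); apply: ler_wpM2l => //.
  have h k : (N <= k)%N -> 0 <= (k.+1%:R^-1 : R) <= N.+1%:R^-1.
    by move=> Nk; rewrite invr_ge0 ler0n lef_pV2 ?posrE // ler_nat ltnS.
  have := h _ Ni; have := h _ Nj; rewrite /approach => /andP[j0 j1] /andP[i0 i1].
  move: (i.+1%:R^-1 : R) (j.+1%:R^-1 : R) (N.+1%:R^-1 : R) i0 i1 j0 j1 => a a' d *.
  by rewrite ler_norml; apply/andP; split; lra.
exists p1 => O oO Op1; have [W [psi [par [z Wz zp]]]] := chartM p1.
have [|e e0 eP] := idist_lt_nbhs hausM par Wz oO; first by rewrite zp.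
have [N NP] := p1P e e0; exists N => n Nn.
by apply: eP; rewrite zp; apply: NP.
Qed.

Lemma chart_derive_le W psi z y v : parametrization F W psi -> W z ->
  reach y -> `|y| <= r -> psi z = glue y ->
  enorm ('D_v (F \o psi) z) <= lip * `|\row_i dot ('D_v (F \o psi) z) (E i)|.
Proof.
move=> par Wz ry yr zy.
have := transition_derive v glue_section ry par Wz zy.
by move=> {1}->; apply: glue_derive_le.
Qed.

Lemma dist_approach x n : `|x - approach n *: x| = `|x| * n.+1%:R^-1.
Proof.
rewrite -{1}[x]scale1r -scalerBl /approach opprB addrC subrK normrZ mulrC.
by rewrite ger0_norm // invr_ge0.
Qed.

(** Passage to the limit of [chart_derive_le]: a strict failure of the
    inequality at z would persist on a neighbourhood, whose image contains points
    of the section. *)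
Lemma limit_derive_le W psi z x v : parametrization F W psi -> W z -> `|x| <= r ->
  (forall t : R, 0 <= t < 1 -> reach (t *: x)) ->
  (forall O : set M, open O -> O (psi z) ->
    exists N, forall n, (N <= n)%N -> O (glue (approach n *: x))) ->
  enorm ('D_v (F \o psi) z) <= lip * \sum_i `|dot ('D_v (F \o psi) z) (E i)|.
Proof.
move=> par Wz xr below lim; have [oW _ cpsi opsi [Spsi _]] := par.
rewrite leNgt; apply/negP => gap.
pose D z' := 'D_v (F \o psi) z'.
pose S (X : Cspace R m) := \sum_i `|dot X (E i)|.
have S_le (X Y : Cspace R m) : S Y <= S X + m%:R * enorm (Y - X).
  have -> : m%:R * enorm (Y - X) = \sum_(i < m) enorm (Y - X).
    by rewrite sumr_const card_ord -[RHS]mulr_natl.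
  rewrite /S -big_split; apply: ler_sum => i _.
  have Ei : enorm (E i) = 1 by rewrite /enorm onE eqxx sqrtr1.
  have := dot_le_enorm (Y - X) (E i); rewrite Ei mulr1 dotBl => h.
  rewrite -[dot Y (E i)](subrKC (dot X (E i))).
  by apply: le_trans (ler_normD _ _) _; rewrite lerD2l.
pose g := enorm (D z) - lip * S (D z).
have g0 : 0 < g by rewrite subr_gt0.
pose e := g / (lip * m%:R + 1).
have l0 : 0 < lip * m%:R + 1 by rewrite ltr_wpDl // mulr_ge0 // lip_ge0.
have e0 : 0 < e by rewrite divr_gt0.
have near_D : \forall z' \near z, enorm (D z' - D z) < e.
  have cD : {for z, continuous D} by have [_ /(_ v) h] := Spsi 1%N; apply: h.
  exact: near_enorm cD e0.
have [B [oB Oz OP]] : exists B : set 'rV[R]_m,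
    [/\ open B, B z & forall z', B z' -> W z' /\ enorm (D z' - D z) < e].
  pose A := [set z' | W z' /\ enorm (D z' - D z) < e].
  have nA : nbhs z A by apply: filterI near_D; apply: open_nbhs_nbhs.
  by exists A^°; split=> //; [exact: open_interior|exact: interior_subset].
have [N /(_ N (leqnn N)) [z' Oz' zz']] := lim (psi @` B)
  (opsi _ oB (fun z' Oz' => (OP z' Oz').1)) (ex_intro2 _ _ z Oz erefl).
have [Wz' close] := OP z' Oz'.
have aN := approach_itv N.
have ry : reach (approach N *: x) by apply: below.
have yr : `|approach N *: x| <= r.
  have /andP[h0 h1] := aN.
  by rewrite normrZ ger0_norm //; apply: le_trans xr; rewrite ler_piMl // ltW.
have main := chart_derive_le v par Wz' ry yr zz'.
have rowS : `|\row_i dot (D z') (E i)| <= S (D z').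
  apply: norm_le_coord => [|i]; first by apply: sumr_ge0.
  by rewrite mxE /S (bigD1 i) //= lerDl sumr_ge0.
have main' : enorm (D z') <= lip * S (D z').
  by apply: le_trans main _; apply: ler_wpM2l => //; exact: lip_ge0.
have S1 := ler_wpM2l lip_ge0 (S_le (D z) (D z')).
have en : enorm (D z) <= enorm (D z') + enorm (D z' - D z).
  by rewrite -[X in _ <= _ + X]enormN opprB; apply: le_trans _ (ler_enormD _ _); rewrite addrC subrK.
have fin : (lip * m%:R + 1) * enorm (D z' - D z) < enorm (D z) - lip * S (D z).
  by rewrite mulrC -ltr_pdivlMr.
exact: (perturbed_bound_contra main' S1 en fin).
Qed.

Lemma cball_scale x (t : R) : `|x| <= r -> 0 <= t <= 1 -> `|t *: x| <= r.
Proof.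
move=> xr /andP[t0 t1]; rewrite normrZ ger0_norm //.
by apply: le_trans xr; rewrite ler_piMl.
Qed.

Lemma lt_half_add_half_contra (a : R) : a < a / 2 + a / 2 -> False.
Proof. lra. Qed.

Definition tube x (e : R) : set 'rV[R]_m := \bigcup_(l in `[0, 1]%classic) ball (l *: x) e.

Lemma tube_open x e : open (tube x e).
Proof. by apply: bigcup_open => l _; apply: ball_open. Qed.

Lemma tube_segment_closed x e : segment_closed (tube x e).
Proof.
move=> y z t [l /= l01 yl] [k /= k01 zk] t01.
exists (l + t * (k - l)).
  move: l01 k01 t01; rewrite /= !in_itv /= => /andP[l0 l1] /andP[k0 k1] /andP[t0 t1].
  by apply/andP; split; nra.
have hy : ball (0 : 'rV[R]_m) e (y - l *: x).
  by move: yl; rewrite -!ball_normE /ball_ /= sub0r opprB.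
have hz : ball (0 : 'rV[R]_m) e (z - k *: x).
  by move: zk; rewrite -!ball_normE /ball_ /= sub0r opprB.
have := segment_closed_ball hy hz t01.
rewrite -!ball_normE /ball_ /= sub0r.
set a := - _; set b := (_ - _ : 'rV[R]_m); rewrite (_ : a = b) //.
by apply/rowP => i; rewrite !mxE; ring.
Qed.

(** By convexity of C the neighbourhood of the part of the segment that ends at
    t x is in C as soon as the balls around its two end points are. *)
Lemma tube_subset C x (t e d : R) : segment_closed C -> 0 <= t < 1 -> 0 < e ->
  ball (0 : 'rV[R]_m) e `<=` C -> ball (t *: x) e `<=` C ->
  `|x - t *: x| + e <= d -> tube x e `<=` C `|` ball x d.
Proof.
move=> convC /andP[t0 t1] e0 eC teC xd y [l /= l01 yl].
have /andP[l0 l1] : 0 <= l <= 1 by move: l01; rewrite in_itv.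
have hy : `|y - l *: x| < e.
  by move: yl; rewrite -ball_normE /ball_ /= distrC.
have [lt|tl] := leP l t.
  left; have [tz|tn0] := eqVneq t 0.
    have lz : l = 0 by apply/eqP; rewrite eq_le l0 -{1}tz lt.
    apply: eC; rewrite -ball_normE /ball_ /= sub0r normrN.
    by move: hy; rewrite lz scale0r subr0.
  have tp : 0 < t by rewrite lt_neqAle eq_sym tn0.
  have h1 : C (y - l *: x) by apply: eC; rewrite -ball_normE /ball_ /= sub0r normrN.
  have h2 : C (t *: x + (y - l *: x)).
    by apply: teC; rewrite -ball_normE /ball_ /= opprD addrA subrr sub0r normrN.
  have lt01 : 0 <= l / t <= 1 by rewrite divr_ge0 //= ler_pdivrMr // mul1r.
  have := convC _ _ _ h1 h2 lt01; rewrite addrK scalerA divfK //.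
  by rewrite subrK.
right; rewrite -ball_normE /ball_ /=.
apply: lt_le_trans xd.
have -> : x - y = (x - l *: x) - (y - l *: x) by rewrite opprB addrA subrK.
apply: le_lt_trans (ler_normB _ _) _; apply: ler_ltD => //.
rewrite -{1}[x]scale1r -{3}[x]scale1r -!scalerBl !normrZ ler_wpM2r //.
by rewrite !ger0_norm ?subr_ge0 ?lerD2l ?lerN2 // ltW.
Qed.

(** Let [reach] contain the half-open segment from 0 to [x].  Completeness
    produces a limit of [glue] at [x]; the slope bound passes to the limit, so
    that the tangent plane there is transverse to the projection, and a section
    exists around the limit point.  It is glued to a section over a convex set
    containing most of the segment, over a thin tube around the segment: there
    the two domains meet in a convex set. *)
Lemma reach_limit x : `|x| <= r -> (forall t : R, 0 <= t < 1 -> reach (t *: x)) -> reach x.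
Proof.
move=> xr below; have [p1 lim] := limit_point xr below.
have [W [psi [par [z Wz zp]]]] := chartM p1; rewrite -zp in lim.
have [oW _ cpsi opsi [Spsi dinj]] := par.
have dpsi : differentiable (F \o psi) z by have [h _] := Spsi 1%N; apply: h.
have trans v : (forall i, dot ('D_v (F \o psi) z) (E i) = 0) -> v = 0.
  move=> v0; have := limit_derive_le v par Wz xr below lim.
  rewrite big1 => [|i _]; last by rewrite v0 normr0.
  rewrite mulr0 => h; apply: (dinj z Wz); rewrite linear0 -(deriveE v dpsi).
  have ez : enorm ('D_v (F \o psi) z) = 0 by apply/eqP; rewrite eq_le h enorm_ge0.
  by apply: dot_eq0; rewrite -enorm_sqr ez expr0n.
have [d [s1 [N0 [d_gt0 S1 oN0 N0z s1P]]]] := local_section (F p) par Wz trans.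
set y1 := plane_coord E (F p) (F (psi z)) in S1 s1P.
have qglue n : q (F (glue (approach n *: x))) = approach n *: x.
  by have [_ _ _ _ qg] := glue_section; apply: qg; apply: below; apply: approach_itv.
have y1x : y1 = x.
  apply/eqP/negPn/negP => ne; pose e := `|y1 - x|.
  have e0 : 0 < e by rewrite normr_gt0 subr_eq0.
  have e2 : 0 < e / 2 by rewrite divr_gt0.
  pose f := q \o (F \o psi).
  have cf : {for z, continuous f} by apply: (plane_coord_smooth E (F p) oW Spsi 0%N).
  pose A := [set z' | W z' /\ `|f z - f z'| < e / 2].
  have nA : nbhs z A.
    apply: filterI; first exact: open_nbhs_nbhs.
    have cf' : f @ z --> f z := cf.
    by apply: (cvgr_dist_lt _ _ cf').
  have AW : A^° `<=` W by move=> z' /interior_subset[].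
  have [N1 N1P] := lim _ (opsi _ (@open_interior _ A) AW) (ex_intro2 _ _ z nA erefl).
  have [N2 N2P] := harmonic_small `|x| e2.
  pose n := maxn N1 N2.
  have [z' /interior_subset[_ fz'] zz'] := N1P n (leq_maxl _ _).
  have h1 : `|y1 - approach n *: x| < e / 2 by move: fz'; rewrite /f /= zz' qglue.
  have h2 : `|x - approach n *: x| < e / 2 by rewrite dist_approach; apply: N2P; apply: leq_maxr.
  apply: (@lt_half_add_half_contra e); rewrite {1}/e.
  have -> : y1 - x = (y1 - approach n *: x) - (x - approach n *: x) by rewrite opprB addrA subrK.
  by apply: le_lt_trans (ler_normB _ _) _; apply: ltrD.
rewrite y1x in S1 s1P.
have d2 : 0 < d / 2 by rewrite divr_gt0.
have [N1 N1P] := lim N0 oN0 N0z.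
have [N2 N2P] := harmonic_small `|x| d2.
pose n := maxn N1 N2; pose t := approach n; pose y := t *: x.
have t01 : 0 <= t < 1 := approach_itv n.
have xy : `|x - y| < d / 2 by rewrite dist_approach; apply: N2P; apply: leq_maxr.
have yball : ball x d y.
  by rewrite -ball_normE /ball_ /=; apply: lt_trans xy _; rewrite ltr_pdivrMr // ltr_pMr ?ltr1n.
have s1y : s1 y = glue y.
  have := s1P _ (N1P n (leq_maxl _ _)); rewrite qglue -/t -/y; exact.
have [C [s [Cs Cy]]] : reach y by apply: below.
have [S convC C0 s00] := Cs; have [oC _ _ _ _] := S.
have sy : s y = s1 y by rewrite s1y (glueE Cs Cy).
have [e1 /= e10 e1C] : exists2 e : R, 0 < e & ball (0 : 'rV[R]_m) e `<=` C.
  by have /nbhs_ballP[e e0 eC] : nbhs (0 : 'rV[R]_m) C; [exact: open_nbhs_nbhs|exists e].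
have [e2 /= e20 e2C] : exists2 e : R, 0 < e & ball y e `<=` C.
  by have /nbhs_ballP[e e0 eC] : nbhs y C; [exact: open_nbhs_nbhs|exists e].
pose e := Num.min (d / 2) (Num.min e1 e2).
have e0 : 0 < e by rewrite !lt_min d2 e10.
have tube_sub : tube x e `<=` C `|` ball x d.
  apply: (@tube_subset C x t e d convC t01 e0).
  - by move=> w h; apply: e1C; apply: le_ball h; rewrite !ge_min lexx !orbT.
  - by move=> w h; apply: e2C; apply: le_ball h; rewrite !ge_min lexx !orbT.
  - rewrite [leRHS]splitr; apply: lerD; first exact: ltW.
    by rewrite ge_min lexx.
pose s' w := if pselect (C w) then s w else s1 w.
have s'C w : C w -> s' w = s w by rewrite /s'; case: pselect.
have s'B w : ball x d w -> s' w = s1 w.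
  move=> bw; rewrite /s'; case: pselect => // Cw.
  exact: (sections_agree convC (@segment_closed_ball x d) S S1 Cy yball sy Cw bw).
exists (tube x e), s'; split; last first.
  by exists 1; rewrite /= ?in_itv /= ?ler01 ?lexx // scale1r; apply: ballxx.
split.
- exact: section_restrict (section_union S S1 s'C s'B) (@tube_open x e) tube_sub.
- exact: tube_segment_closed.
- by exists 0; rewrite /= ?in_itv /= ?ler01 ?lexx // scale0r; apply: ballxx.
- by rewrite s'C.
Qed.

Lemma reach_cball x : `|x| <= r -> reach x.
Proof.
move=> xr.
pose B := `[0, 1]%classic `&` [set t : R | reach (t *: x)].
suff /seteqP[_ /(_ 1)] : B = `[0, 1]%classic.
  by rewrite /B /= in_itv /= ler01 lexx => /(_ isT)[_]; rewrite scale1r.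
apply: (@segment_connected R 0 1).
- by exists 0; split; [rewrite /= in_itv /= lexx ler01|rewrite /= scale0r; apply: reach0].
- exists [set t : R | reach (t *: x)] => //.
  have cx : continuous (fun t : R => t *: x) by move=> t; apply: cvgZr_tmp; exact: cvg_id.
  by move/continuousP: cx => /(_ _ reach_open).
- exists (~` \bigcup_(u in [set u : R | 0 <= u /\ ~ reach (u *: x)]) [set t : R | u < t]).
    by apply: open_closedC; apply: bigcup_open => u _; apply: open_gt.
  apply/seteqP; split=> t [t01 h]; split=> //.
    move=> [u [u0 nu] /= ut]; apply: nu.
    have t0 : 0 < t by apply: le_lt_trans ut.
    have -> : u *: x = (u / t) *: (t *: x) by rewrite scalerA divfK // gt_eqF.
    apply: (reach_star h).
    by rewrite divr_ge0 ?(ltW t0) //= ler_pdivrMr // mul1r ltW.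
  have /andP[t0 t1] : 0 <= t <= 1 by move: t01; rewrite /= in_itv.
  apply: reach_limit; first by apply: cball_scale; rewrite ?t0.
  move=> u /andP[u0 u1]; rewrite scalerA; apply: contrapT => nr.
  have [tz|tn0] := eqVneq t 0.
    by apply: nr; rewrite tz mulr0 scale0r; apply: reach0.
  apply: h; exists (u * t); first by split=> //; apply: mulr_ge0.
  by rewrite /= gtr_pMl // lt_neqAle eq_sym tn0.
Qed.

End Continuation.

Section UniformGraph.
Context {R : realType} {m : nat} {M : topologicalType} (F : M -> Cspace R m).

(** The tangent plane at p is transverse to the projection to itself, and the
    differential of the section at 0 is then the inclusion of the plane, of
    slope 1 in each of the m directions. *)
Lemma initial_section (p : M) (W : set 'rV[R]_m) (psi : 'rV[R]_m -> M) (z : 'rV[R]_m) :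
  parametrization F W psi -> W z -> psi z = p ->
  exists (E : 'I_m -> Cspace R m) (d : R) (s : 'rV[R]_m -> M),
    [/\ forall i j, dot (E i) (E j) = (i == j)%:R, 0 < d,
        graph_section F E (F p) (ball 0 d) s, s 0 = p & slope2 F s 0 = 1 + m%:R].
Proof.
move=> par Wz zp; have [oW _ cpsi opsi [Spsi dinj]] := par.
have dpsi : differentiable (F \o psi) z by have [h _] := Spsi 1%N; apply: h.
have [P [uP _ onE]] := orthonormal_frame (immersion_free dpsi (dinj z Wz)).
pose b i := partial i (F \o psi) z.
pose E a := \sum_i P a i *: b i.
have EE a : 'D_(row a P) (F \o psi) z = E a.
  by rewrite (derive_row _ dpsi); apply: eq_bigr => i _; rewrite mxE.
have trans v : (forall i, dot ('D_v (F \o psi) z) (E i) = 0) -> v = 0.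
  move=> v0; pose D := 'D_v (F \o psi) z.
  pose beta : 'cV[R]_m := \col_i dot D (b i).
  have Pb : P *m beta = 0.
    apply/colP => a; rewrite !mxE -[RHS](v0 a) /E dot_sumr.
    by apply: eq_bigr => i _; rewrite mxE dotZr.
  have b0 : beta = 0 by rewrite -[beta](mulKmx uP) Pb mulmx0.
  have DD : dot D D = 0.
    rewrite {2}/D (derive_row v dpsi) dot_sumr big1 // => i _.
    by rewrite dotZr; have /colP/(_ i) := b0; rewrite !mxE => ->; rewrite mulr0.
  apply: (dinj z Wz); rewrite linear0 -(deriveE v dpsi); exact: dot_eq0.
have [d [s [N0 [d0 S oN0 Oz sP]]]] := local_section (F p) par Wz trans.
have q0 : plane_coord E (F p) (F (psi z)) = 0.
  by rewrite zp; apply/rowP => i; rewrite !mxE subrr dot0l.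
rewrite q0 in S sP.
have s00 : s 0 = p.
  by have := sP _ Oz; rewrite q0 zp; apply; apply: ballxx.
exists E, d, s; split=> //.
have pE i : partial i (F \o s) 0 = E i.
  have B0 : ball (0 : 'rV[R]_m) d 0 by apply: ballxx.
  have := transition_derive (row i P) S B0 par Wz (etrans zp (esym s00)).
  rewrite (EE i) => ->; congr derive.
  by apply/rowP => j; rewrite !mxE onE eqxx eq_sym.
rewrite /slope2; congr (1 + _).
have -> : m%:R = \sum_(i < m) (1 : R) by rewrite sumr_const card_ord.
apply: eq_bigr => i _; apply: (etrans (congr2 dot (pE i) (pE i))).
by rewrite onE eqxx.
Qed.

(** Only the initial section around p has a radius that depends on p.  It is
    continued up to the radius r at which [slope_bound] ceases to apply, which
    K and m determine. *)
Theorem uniform_graph (K : R) : submanifold F m -> complete_submanifold F ->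
  (forall (W : set 'rV[R]_m) (psi : 'rV[R]_m -> M),
    parametrization F W psi -> forall x, W x -> second_form_norm (F \o psi) x <= K) ->
  exists r L : R, [/\ 0 < r, 0 <= L & forall p : M,
    exists (E : 'I_m -> Cspace R m) (C : set 'rV[R]_m) (s : 'rV[R]_m -> M),
      [/\ forall i j, dot (E i) (E j) = (i == j)%:R,
         graph_section F E (F p) C s, s 0 = p,
         forall x, `|x| <= r -> C x &
         forall x v, `|x| <= r -> enorm ('D_v (F \o s) x) <= L * `|v|]].
Proof.
move=> [hausM _ chartM] completeM AK.
have AK' (W : set 'rV[R]_m) (psi : 'rV[R]_m -> M) : parametrization F W psi ->
    forall x, W x -> second_form_norm (F \o psi) x <= `|K|.
  by move=> par x Wx; apply: le_trans (AK W psi par x Wx) (ler_norm K).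
pose B := @slope_rate R m `|K|.
have B0 : 0 <= B by rewrite /B /slope_rate !mulr_ge0 ?addr_ge0 ?exprn_ge0.
have m1 : 0 < 2 * (1 + m%:R) :> R by rewrite mulr_gt0 // ltr_wpDr.
pose r := (2 * (1 + m%:R))^-1 / (B + 1).
have B1 : 0 < B + 1 by rewrite ltr_wpDl.
have r0 : 0 < r by rewrite divr_gt0 ?invr_gt0.
have r_small a : a <= r -> B * a <= (2 * (1 + m%:R))^-1.
  move=> ar; apply: le_trans (ler_wpM2l B0 ar) _.
  rewrite /r mulrCA ler_piMr ?invr_ge0 ?(ltW m1) //.
  by rewrite ler_pdivrMr // mul1r lerDl.
exists r, (@lip R m); split=> //; first exact: lip_ge0.
move=> p; have [W [psi [par [z Wz zp]]]] := chartM p.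
have [E [d [s0 [onE d0 S0 s0p slope]]]] := initial_section par Wz zp.
have slope' : slope2 F s0 0 <= 1 + m%:R by rewrite slope.
exists E, (reach F p E), (glue F p E); split=> //.
- exact: glue_section hausM p E.
- have ip := initial_piece d0 S0 s0p.
  exact: (etrans (glueE hausM ip (ballxx _ d0)) s0p).
- move=> x xr.
  exact: (reach_cball hausM chartM completeM AK' onE d0 S0 s0p slope' r_small xr).
- move=> x v xr; apply: (glue_derive_le hausM AK' onE d0 S0 s0p slope' r_small v _ xr).
  exact: (reach_cball hausM chartM completeM AK' onE d0 S0 s0p slope' r_small xr).
Qed.

End UniformGraph.

(** * The maximum principle *)

Section LocalMaximum.
Context {R : realType}.

Lemma local_max_derivatives (k k1 : R -> R) (k2 d : R) : 0 < d ->
  (forall t, `|t| < d -> is_derive t (1 : R) k (k1 t)) ->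
  is_derive (0 : R) (1 : R) k1 k2 ->
  (forall t, `|t| < d -> k t <= k 0) -> k1 0 = 0 /\ k2 <= 0.
Proof.
move=> d0 dk dk1 kmax.
have itvd t : t \in `]- d, d[ -> `|t| < d by rewrite in_itv /= ltr_norml.
have h0 : `|0 : R| < d by rewrite normr0.
have [_ kE0] := dk 0 h0.
have k10 : k1 0 = 0.
  suff [_ e0] : is_derive (0 : R) (1 : R) k 0 by rewrite -kE0.
  apply: (@derive1_at_max R k (- d) d 0).
  - by rewrite -subr_ge0 opprK addr_ge0 // ltW.
  - by move=> t /itvd td; case: (dk t td).
  - by rewrite in_itv /= d0 oppr_lt0 d0.
  - by move=> t /itvd td; apply: kmax.
split=> //; rewrite leNgt; apply/negP => k20.
have [dk1' k1E] := dk1.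
have : \forall h \near (0 : R)^', `|k2 - h^-1 *: (k1 (h + 0) - k1 0)| < k2.
  have lim : h^-1 *: (k1 (h + 0) - k1 0) @[h --> (0 : R)^'] --> k2.
    have -> : k2 = 'D_1 k1 0 by [].
    have := dk1'; rewrite /derivable /derive => cv.
    have -> : (fun h : R => h^-1 *: (k1 (h + 0) - k1 0)) =
              (fun h : R => h^-1 *: ((k1 \o shift 0) (h *: (1 : R)) - k1 0)).
      by apply/funext => h; rewrite /= [h *: (1 : R)]mulr1.
    exact: cv.
  exact: (cvgr_dist_lt _ _ lim).
move=> /nbhs_ballP[e /= e0 eP].
pose t := Num.min e d / 2.
have med : 0 < Num.min e d by rewrite lt_min e0 d0.
have t0 : 0 < t by rewrite divr_gt0.
have tmin : t < Num.min e d by rewrite ltr_pdivrMr // ltr_pMr ?ltr1n.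
have te : t < e by move: tmin; rewrite lt_min => /andP[].
have td : t < d by move: tmin; rewrite lt_min => /andP[].
have k1pos u : 0 < u -> u < e -> 0 < k1 u.
  move=> u0 ue; have := eP u.
  rewrite -ball_normE /ball_ /= sub0r normrN gtr0_norm // => /(_ ue).
  rewrite gt_eqF // => /(_ isT); rewrite addr0 k10 subr0 => h.
  have : 0 < u^-1 * k1 u.
    have := ler_norm (k2 - u^-1 *: k1 u); rewrite /GRing.scale /= in h *; lra.
  by rewrite pmulr_rgt0 // invr_gt0.
have inab u : 0 <= u <= t -> `|u| < d.
  by move=> /andP[u0 ut]; rewrite ger0_norm //; apply: le_lt_trans td.
have [||u ut kE] := @MVT R k k1 0 t t0.
- by move=> u; rewrite in_itv /= => /andP[u0 ut]; apply/dk/inab; rewrite !ltW.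
- apply: derivable_within_continuous => u; rewrite in_itv /= => /inab/dk h.
  exact: (@ex_derive _ _ _ _ _ _ _ h).
move: ut; rewrite in_itv /= => /andP[u0 ut].
have : k t <= k 0 by apply/kmax/inab; rewrite lexx ltW.
have : 0 < k1 u * (t - 0).
  by rewrite subr0 mulr_gt0 //; apply: k1pos => //; apply: lt_trans te.
lra.
Qed.

End LocalMaximum.

Section MaximumPrinciple.
Context {R : realType} {m : nat} {M : topologicalType} (F : M -> Cspace R m).
Variable V : Cspace R m.
Hypothesis lagF : lagrangian F.
Hypothesis solF : translating_soliton F m V.

Lemma partial_frame_derive (phi : 'rV[R]_m -> Cspace R m) x (P : 'M[R]_m) a :
  differentiable phi x -> 'D_(row a P) phi x = frame phi x P a.
Proof.
move=> dphi; rewrite (derive_row _ dphi); apply: eq_bigr => i _.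
by rewrite mxE.
Qed.

Lemma derive2_row (phi : 'rV[R]_m -> Cspace R m) (C : set 'rV[R]_m) x (v : 'rV[R]_m) :
  open C -> smooth_on C phi -> C x ->
  'D_v (fun y => 'D_v phi y) x =
  \sum_i \sum_j (v 0 i * v 0 j) *: partial i (partial j phi) x.
Proof.
move=> oC Sphi Cx.
have dphi y : C y -> differentiable phi y by move=> Cy; have [h _] := Sphi 1%N; apply: h.
have dpart j y : C y -> differentiable (partial j phi) y.
  by move=> Cy; have [_ /(_ (delta_mx 0 j)) [h _]] := Sphi 2%N; apply: h.
have ddv : differentiable (fun y => 'D_v phi y) x.
  by have [_ /(_ v) [h _]] := Sphi 2%N; apply: h.
rewrite (derive_row _ ddv); apply: eq_bigr => i _.
pose e : 'rV[R]_m := delta_mx 0 i.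
have E1 : 'D_e (fun y => 'D_v phi y) x = 'D_e (\sum_(j < m) (v 0 j *: partial j phi)) x.
  apply: near_eq_derive; apply: (near_on_open oC Cx) => y Cy.
  by rewrite (derive_row _ (dphi y Cy)) fct_sumE.
rewrite E1 derive_sum.
  rewrite scaler_sumr; apply: eq_bigr => j _.
  by rewrite deriveZ ?scalerA //; apply: diff_derivable; apply: dpart.
by move=> j; apply: derivableZ; apply: diff_derivable; apply: dpart.
Qed.

(** Restricted to the submanifold, a function h of the ambient space has
    second derivatives D^2 h (X, X) + <grad h, A(X, X)> along the submanifold
    where grad h is normal.  Summed over an orthonormal frame at a maximum,
    the last term becomes <grad h, H> = <grad h, V>. *)
Lemma maximum_trace (C : set 'rV[R]_m) (s : 'rV[R]_m -> M) (x : 'rV[R]_m)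
  (G : Cspace R m) (Q : Cspace R m -> R) :
  parametrization F C s -> C x ->
  (forall v, dot ('D_v (F \o s) x) G = 0) ->
  (forall v, Q ('D_v (F \o s) x) + dot ('D_v (fun y => 'D_v (F \o s) y) x) G <= 0) ->
  exists E : 'I_m -> Cspace R m,
    [/\ forall a b, dot (E a) (E b) = (a == b)%:R,
        forall a b, dot (Jmul (E a)) (E b) = 0,
        forall a, dot (E a) G = 0 &
        \sum_a Q (E a) + dot V G <= 0].
Proof.
move=> par Cx grad0 hess; have [oC _ _ _ [Sphi dinj]] := par.
set phi := F \o s in grad0 hess Sphi dinj.
have dphi : differentiable phi x by have [h _] := Sphi 1%N; apply: h.
have [P [_ PP onP]] := orthonormal_frame (immersion_free dphi (dinj x Cx)).
pose E a := frame phi x P a.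
have DE a : 'D_(row a P) phi x = E a by apply: partial_frame_derive.
have tan0 X : dot (tangent_part phi x X) G = 0.
  rewrite (tangent_part_frame PP) dot_suml big1 // => a _.
  by rewrite dotZl -/(E a) -DE grad0 mulr0.
have secondG i j : dot (partial i (partial j phi) x) G = dot (second_form phi x i j) G.
  by rewrite /second_form /normal_part dotBl tan0 subr0.
exists E; split.
- exact: onP.
- by move=> a b; rewrite -!DE; apply: lagF.2 par x Cx _ _.
- by move=> a; rewrite -DE grad0.
have H : dot (mean_curvature phi x) G = dot V G.
  by rewrite (solF par Cx) /normal_part dotBl tan0 subr0.
rewrite -H (mean_curvature_frame PP) dot_suml -big_split.
apply: sumr_le0 => a _; apply: le_trans (hess (row a P)).
rewrite (DE a) lerD2l (derive2_row _ oC Sphi Cx) le_eqVlt; apply/orP; left; apply/eqP.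
rewrite !dot_suml; apply: eq_bigr => i _; rewrite !dot_suml; apply: eq_bigr => j _.
by rewrite !dotZl secondG !mxE.
Qed.

End MaximumPrinciple.

Lemma almost_maximum_arith (R : realType) (a b t d n eta : R) :
  n + d <= eta -> t <= d -> a - n + (b - t) <= 0 -> b + a <= eta.
Proof. lra. Qed.

Section AlmostMaximum.
Context {R : realType} {m : nat} {M : topologicalType} (F : M -> Cspace R m).
Variable V : Cspace R m.
Let W := - Jmul V.
Hypothesis lagF : lagrangian F.
Hypothesis solF : translating_soliton F m V.
Hypothesis completeF : complete_submanifold F.
Hypothesis boundF : bounded_second_form F m.
Hypothesis V1 : enorm V = 1.
Variables (b : R) (l l1 l2 : R -> R) (u0 u1 : R).
Hypothesis u10 : u1 < u0.
Hypothesis dl : forall u, `|u| < u0 ->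
  is_derive u (1 : R) l (l1 u) /\ is_derive u (1 : R) l1 (l2 u).
Let x q : R := dot (F q) W.
Let y q : R := dot (F q) V.
Hypothesis x_gap : forall q, `|x q| < u0 -> `|x q| <= u1.

Lemma is_derive_dotl (f : R -> Cspace R m) (f' w : Cspace R m) (t : R) :
  is_derive t (1 : R) f f' -> is_derive t (1 : R) (fun s => dot (f s) w : R) (dot f' w).
Proof.
move=> Df; have Dw : is_derive t (1 : R) (fun _ : R => w) 0 by apply: is_derive_cst.
by apply: (is_derive_eq (is_derive_dot Df Dw)); rewrite dot0r addr0.
Qed.

(** The penalty c |z - z0|^2 keeps the maxima of b y + l(x) close to z0.  The
    derivatives are those of a function on the ambient space: [barrier_grad] is
    its gradient and [barrier_hess] its second derivative in a direction. *)
Definition barrier (c : R) (z0 z : Cspace R m) : R :=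
  b * dot z V + l (dot z W) - c * dot (z - z0) (z - z0).

Definition barrier_grad (c : R) (z0 z : Cspace R m) : Cspace R m :=
  b *: V + l1 (dot z W) *: W - (2 * c) *: (z - z0).

Definition barrier_hess (c : R) (z X : Cspace R m) : R :=
  l2 (dot z W) * dot X W ^+ 2 - 2 * c * dot X X.

Lemma dot_barrier_grad c z0 z X : dot X (barrier_grad c z0 z) =
  b * dot X V + l1 (dot z W) * dot X W - 2 * c * dot X (z - z0).
Proof.
rewrite /barrier_grad; move: (z - z0) => w.
by rewrite [LHS]dotBr [X in X - _ = _]dotDr !dotZr.
Qed.

Lemma barrier_derivative c z0 (X : R -> Cspace R m) (X1 : Cspace R m) t :
  `|dot (X t) W| < u0 -> is_derive t (1 : R) X X1 ->
  is_derive t (1 : R) (fun s => barrier c z0 (X s)) (dot X1 (barrier_grad c z0 (X t))).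
Proof.
move=> Xt dX.
have d1 := is_derive_dotl V dX.
have d2 : is_derive t (1 : R) (l \o (fun s => dot (X s) W)) (l1 (dot (X t) W) * dot X1 W).
  by apply: is_derive1_comp; [case: (dl Xt)|exact: is_derive_dotl].
have dz : is_derive t (1 : R) (fun s => X s - z0) X1.
  rewrite -[X1]subr0; apply: is_deriveB.
have d3 := is_derive_dot dz dz.
have d := is_deriveB (is_deriveD (is_deriveZ b d1) d2) (is_deriveZ c d3).
apply: is_derive_eq d _; rewrite dot_barrier_grad (dotC (X t - z0) X1).
move: (dot X1 V) (dot X1 W) (dot X1 (X t - z0)) (l1 _) => e1 e2 e3 e4.
by rewrite /GRing.scale /=; ring.
Qed.

Lemma barrier_second_derivative c z0 (X X1 : R -> Cspace R m) (X2 : Cspace R m) t :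
  `|dot (X t) W| < u0 -> is_derive t (1 : R) X (X1 t) -> is_derive t (1 : R) X1 X2 ->
  is_derive t (1 : R) (fun s => dot (X1 s) (barrier_grad c z0 (X s)))
    (barrier_hess c (X t) (X1 t) + dot X2 (barrier_grad c z0 (X t))).
Proof.
move=> Xt dX dX1.
have d1 := is_derive_dotl V dX1.
have dW := is_derive_dotl W dX1.
have d2 : is_derive t (1 : R) (l1 \o (fun s => dot (X s) W)) (l2 (dot (X t) W) * dot (X1 t) W).
  by apply: is_derive1_comp; [case: (dl Xt)|exact: is_derive_dotl].
have dz : is_derive t (1 : R) (fun s => X s - z0) (X1 t).
  rewrite -[X1 t]subr0; apply: is_deriveB.
have d3 := is_derive_dot dX1 dz.
have d := is_deriveB (is_deriveD (is_deriveZ b d1) (is_deriveM d2 dW)) (is_deriveZ (2 * c) d3).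
have -> : (fun s => dot (X1 s) (barrier_grad c z0 (X s))) =
    (b *: (fun s => dot (X1 s) V) +
     (l1 \o (fun s => dot (X s) W)) * (fun s => dot (X1 s) W)) -
    (2 * c) *: (fun s => dot (X1 s) (X s - z0)).
  by apply/funext => s; rewrite dot_barrier_grad.
apply: is_derive_eq d _; rewrite dot_barrier_grad /barrier_hess /=.
move: (dot X2 V) (dot X2 W) (dot X2 (X t - z0)) (dot (X1 t) (X1 t)) (dot (X1 t) W) => e1 e2 e3 e4 e5.
move: (l1 _) (l2 _) => e6 e7.
by rewrite /GRing.scale /=; ring.
Qed.

Section OnSection.
Variables (E0 : 'I_m -> Cspace R m) (X0 : Cspace R m) (C : set 'rV[R]_m)
  (s : 'rV[R]_m -> M) (r : R).
Hypothesis sC : graph_section F E0 X0 C s.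
Hypothesis rC : forall v, `|v| <= r -> C v.
Hypothesis x0 : `|x (s 0)| < u0.

Lemma section_continuous v : C v -> {for v, continuous (F \o s)}.
Proof. by move=> Cv; apply: differentiable_continuous; apply: section_differentiable sC Cv. Qed.

(** The values of |x| avoid the interval from u1 to u0, hence cannot cross it
    along a segment. *)
Lemma section_in_strip v : `|v| <= r -> `|x (s v)| < u0.
Proof.
move=> vr; have [oC _ _ _ _] := sC.
pose g (t : R) := x (s (0 + t *: v)).
have Ct (t : R) : 0 <= t <= 1 -> C (0 + t *: v).
  move=> /andP[t0 t1]; apply: rC; rewrite add0r normrZ ger0_norm //.
  by apply: le_trans vr; rewrite ler_piMl.
pose A := [set t : R | C (0 + t *: v)].
have cl : continuous (fun t : R => 0 + t *: v) by apply: line_continuous.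
have oA : open A by move/continuousP: cl; apply.
have cg : {in A, continuous g}.
  move=> t; rewrite inE => At.
  have ct : {for t, continuous (fun t : R => (F \o s) (0 + t *: v))}.
    apply: (@continuous_comp _ _ _ (fun t : R => 0 + t *: v) (F \o s)); first exact: cl.
    exact: section_continuous.
  exact: (@continuous_comp _ _ _ (fun t : R => (F \o s) (0 + t *: v)) (dotL W) t ct
    (@dotL_continuous R m W _)).
suff Bset : `[0, 1]%classic `&` [set t | `|g t| < u0] = `[0, 1]%classic.
  have : (`[0, 1]%classic `&` [set t | `|g t| < u0]) 1.
    by rewrite Bset /= in_itv /= ler01 lexx.
  by move=> [_]; rewrite /= /g scale1r add0r.
apply: (@segment_connected R 0 1).
- by exists 0; split; rewrite /= ?in_itv /= ?ler01 ?lexx // /g scale0r addr0.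
- exists (A `&` g @^-1` ball (0 : R) u0).
    by move/(continuous_inP _ oA): cg; apply; exact: ball_open.
  apply/seteqP; split=> t [t01 h]; split=> //.
    split; first by apply: Ct; move: t01; rewrite /= in_itv.
    by rewrite /= -ball_normE /ball_ /= sub0r normrN.
  by case: h => _; rewrite /= -ball_normE /ball_ /= sub0r normrN.
- exists (~` (A `&` g @^-1` [set a | u1 < `|a|])).
    apply: open_closedC; move/(continuous_inP _ oA): cg; apply.
    move/continuousP: (@norm_continuous R R) => /(_ _ (@open_gt R u1)); exact.
  apply/seteqP; split=> t [t01 h]; split=> //.
    by move=> [_ /=]; apply/negP; rewrite -leNgt; apply: x_gap.
  apply: le_lt_trans u10; rewrite leNgt; apply/negP => h'; apply: h; split=> //.
  by apply: Ct; move: t01; rewrite /= in_itv.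
Qed.

Lemma section_lipschitz L v : 0 <= L -> `|v| <= r ->
  (forall v' w, `|v'| <= r -> enorm ('D_w (F \o s) v') <= L * `|w|) ->
  enorm (F (s v) - F (s 0)) <= L * `|v|.
Proof.
move=> L0 vr Dle; set w := F (s v) - F (s 0).
pose g (u : 'rV[R]_m) : R := dot ((F \o s) u) w.
have inr (t : R) : 0 <= t <= 1 -> `|0 + t *: (v - 0)| <= r.
  move=> /andP[t0 t1]; rewrite add0r subr0 normrZ ger0_norm //.
  by apply: le_trans vr; rewrite ler_piMl.
have ds t (t01 : 0 <= t <= 1) := section_differentiable sC (rC (inr t t01)).
have [t t01|t t01 gE] := @mean_value_line R _ g 0 v.
  by apply: differentiable_dot; apply: ds.
have ww : enorm w ^+ 2 <= L * `|v| * enorm w.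
  have -> : enorm w ^+ 2 = g v - g 0 by rewrite enorm_sqr /g -dotBl.
  rewrite gE (derive_dot _ _ (ds t t01)).
  apply: le_trans (ler_norm _) _; apply: le_trans (dot_le_enorm _ _) _.
  apply: ler_wpM2r; first exact: enorm_ge0.
  by apply: le_trans (Dle _ _ (inr t t01)) _; rewrite subr0.
have [->|w0] := eqVneq (enorm w) 0; first by rewrite mulr_ge0.
have wp : 0 < enorm w by rewrite lt_neqAle eq_sym w0 enorm_ge0.
by rewrite -(ler_pM2r wp) -expr2.
Qed.

(** The second derivative test is applied along each line of the domain of the
    section. *)
Lemma barrier_maximum c z0 v : `|v| < r ->
  (forall v', `|v'| <= r -> barrier c z0 (F (s v')) <= barrier c z0 (F (s v))) ->
  exists E : 'I_m -> Cspace R m,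
    [/\ forall i j, dot (E i) (E j) = (i == j)%:R,
        forall i j, dot (Jmul (E i)) (E j) = 0,
        forall i, dot (E i) (barrier_grad c z0 (F (s v))) = 0 &
        \sum_i barrier_hess c (F (s v)) (E i) + dot V (barrier_grad c z0 (F (s v))) <= 0].
Proof.
move=> vr vmax; have [oC _ _ Ss _] := sC.
have both w : dot ('D_w (F \o s) v) (barrier_grad c z0 (F (s v))) = 0 /\
    barrier_hess c (F (s v)) ('D_w (F \o s) v) +
    dot ('D_w (fun u => 'D_w (F \o s) u) v) (barrier_grad c z0 (F (s v))) <= 0.
  pose X (t : R) := (F \o s) (v + t *: w).
  pose X1 (t : R) := 'D_w (F \o s) (v + t *: w).
  pose X2 := 'D_w (fun u => 'D_w (F \o s) u) v.
  have w1 : 0 < `|w| + 1 by rewrite ltr_wpDl.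
  pose d := (r - `|v|) / (`|w| + 1).
  have d0 : 0 < d by rewrite divr_gt0 // subr_gt0.
  have inr (t : R) : `|t| < d -> `|v + t *: w| <= r.
    rewrite ltr_pdivlMr // => td; apply: le_trans (ler_normD _ _) _.
    rewrite normrZ -lerBrDl; apply: le_trans (ltW td).
    by rewrite ler_wpM2l // lerDl.
  have dX (t : R) : `|t| < d -> is_derive t (1 : R) X (X1 t).
    move=> td; apply: is_derive_line.
    by apply: section_differentiable sC (rC (inr t td)).
  have v00 : v + (0 : R) *: w = v by rewrite scale0r addr0.
  have dX1 : is_derive (0 : R) (1 : R) X1 X2.
    have [_ /(_ w) [h _]] := Ss 2%N.
    have hv := h v (rC (ltW vr)).
    have := @is_derive_line R _ _ (fun u => 'D_w (F \o s) u) v w 0.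
    by rewrite v00 => /(_ hv).
  have strip (t : R) : `|t| < d -> `|dot (X t) W| < u0.
    by move=> td; apply: section_in_strip (inr t td).
  have h0 : `|0 : R| < d by rewrite normr0.
  have X00 : X 0 = F (s v) by rewrite /X v00.
  have X10 : X1 0 = 'D_w (F \o s) v by rewrite /X1 v00.
  have dk t (td : `|t| < d) := barrier_derivative c z0 (strip t td) (dX t td).
  have dk1 := barrier_second_derivative c z0 (strip 0 h0) (dX 0 h0) dX1.
  have [|k10 k2] := local_max_derivatives d0 dk dk1.
    by move=> t td; rewrite X00; apply: vmax; apply: inr.
  have key : dot (X1 0) (barrier_grad c z0 (X 0)) = 0 /\
    barrier_hess c (X 0) (X1 0) + dot X2 (barrier_grad c z0 (X 0)) <= 0 by split.
  by move: key; rewrite X00 X10.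
have par := section_parametrization sC.
by apply: (maximum_trace lagF solF par (rC (ltW vr))) => w; case: (both w).
Qed.

End OnSection.

Lemma dotVW : dot V W = 0.
Proof. by rewrite dotNr dotC dot_Jmul_self oppr0. Qed.

Lemma barrier_continuous c z0 (T : topologicalType) (f : T -> Cspace R m) t :
  `|dot (f t) W| < u0 -> {for t, continuous f} ->
  {for t, continuous (fun t => barrier c z0 (f t))}.
Proof.
move=> ft cf.
have cl : {for dot (f t) W, continuous l}.
  by apply: differentiable_continuous; apply/derivable1_diffP; case: (dl ft) => [[]].
have h1 : {for t, continuous (fun t => dot (f t) V)}.
  exact: (@continuous_comp _ _ _ f (dotL V) t cf (@dotL_continuous R m V _)).
have h2 : {for t, continuous (fun t => dot (f t) W)}.
  exact: (@continuous_comp _ _ _ f (dotL W) t cf (@dotL_continuous R m W _)).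
have h3 : {for t, continuous (fun t => l (dot (f t) W))}.
  exact: (@continuous_comp _ _ _ (fun t => dot (f t) W) l t h2 cl).
have h4 : {for t, continuous (fun t => f t - z0)}.
  by apply: cvgB; [exact: cf|exact: cvg_cst].
have h5 : {for t, continuous (fun t => enorm (f t - z0))}.
  exact: (@continuous_comp _ _ _ (fun t => f t - z0) (@enorm R m) t h4 (@enorm_continuous R m _)).
have -> : (fun t => barrier c z0 (f t)) =
    (fun t => b * dot (f t) V + l (dot (f t) W) - c * (enorm (f t - z0) * enorm (f t - z0))).
  by apply/funext => t'; rewrite -expr2 enorm_sqr.
apply: cvgB; last by apply: cvgM; [exact: cvg_cst|apply: cvgM; exact: h5].
by apply: cvgD; [apply: cvgM; [exact: cvg_cst|exact: h1]|exact: h3].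
Qed.

(** The Omori-Yau principle for b y + l(x) and the drift Laplacian, on the set
    of points where |x| < u0; by [x_gap] a connected set that meets it is
    contained in it, so that it contains the graph around each of its points.
    The point p is chosen so close to the supremum that the penalty c r^2 on the
    boundary of the graph forces an interior maximum. *)
Lemma almost_maximum (eta : R) : 0 < eta -> (exists q, `|x q| < u0) ->
  (exists B, forall q, `|x q| < u0 -> b * y q + l (x q) <= B) ->
  exists (q : M) (E : 'I_m -> Cspace R m),
    [/\ `|x q| < u0,
        forall i j, dot (E i) (E j) = (i == j)%:R,
        forall i j, dot (Jmul (E i)) (E j) = 0,
        forall i, `|b * dot (E i) V + l1 (x q) * dot (E i) W| <= eta &
        b + l2 (x q) * (\sum_i dot (E i) W ^+ 2) <= eta].
Proof.
move=> eta0 [q0 q0x] [B fB].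
have [K AK] := boundF; have [subF _] := lagF.
have [r [L [r0 L0 graph]]] := uniform_graph subF completeF AK.
have k0 : 0 < 2 * (m%:R + L * r + 1) by rewrite mulr_gt0 // ltr_wpDl // addr_ge0 // mulr_ge0 // ltW.
pose c := eta / (2 * (m%:R + L * r + 1)).
have c0 : 0 < c by rewrite divr_gt0.
have c_small : 2 * c * (m%:R + L * r) <= eta.
  rewrite mulrAC /c mulrA ler_pdivrMr // mulrC ler_wpM2l ?(ltW eta0) //.
  by rewrite ler_pM2l // lerDl.
pose f q := b * y q + l (x q).
pose A := f @` [set q | `|x q| < u0].
have hasA : has_sup A.
  by split; [exists (f q0), q0|exists B => _ [q qx <-]; apply: fB].
have cr : 0 < c * r ^+ 2 by rewrite mulr_gt0 ?exprn_gt0.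
have [_ [p px <-] pf] := sup_adherent cr hasA.
have [E0 [C [s [onE0 sC s0 rC Dle]]]] := graph p.
have x0 : `|x (s 0)| < u0 by rewrite s0.
have strip := section_in_strip sC rC x0.
pose H v := barrier c (F p) (F (s v)).
have ballE (v : 'rV[R]_m) : closed_ball_ Num.norm (0 : 'rV[R]_m) r v = (`|v| <= r).
  by rewrite /closed_ball_ /= sub0r normrN.
have [v vball vmax] : exists2 v : 'rV[R]_m, `|v| <= r & forall v', `|v'| <= r -> H v' <= H v.
  have [|||v] := @compact_EVT_max _ R H (closed_ball_ Num.norm (0 : 'rV[R]_m) r).
  - by exists 0; rewrite ballE normr0 ltW.
  - apply: bounded_closed_compact; last exact: closed_closed_ball_.
    exists r; split; first exact: num_real.
    by move=> B' rB' v; rewrite ballE => vr; apply: le_trans vr (ltW rB').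
  - apply: continuous_in_subspaceT => v; rewrite inE ballE => vr.
    apply: (@barrier_continuous c (F p) _ (F \o s)); first exact: strip.
    exact: (section_continuous sC (rC v vr)).
  rewrite inE ballE => vr vmax; exists v => // v' vr'.
  by apply: vmax; rewrite inE ballE.
have vr : `|v| < r.
  rewrite lt_neqAle vball andbT; apply/eqP => vE.
  have far : `|v| ^+ 2 <= dot (F (s v) - F p) (F (s v) - F p).
    rewrite -enorm_sqr ler_pXn2r ?nnegrE ?enorm_ge0 //.
    apply: norm_le_coord => [|i]; first exact: enorm_ge0.
    have [_ _ _ _ qs] := sC.
    rewrite -{1}(qs v (rC v vball)) mxE; apply: le_trans (dot_le_enorm _ _) _.
    by rewrite [enorm (E0 i)](_ : _ = 1) ?mulr1 // /enorm onE0 eqxx sqrtr1.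
  have Hv : H v <= sup A - c * r ^+ 2.
    rewrite /H /barrier; apply: lerB.
      by apply: ub_le_sup; [case: hasA|exists (s v) => //; apply: strip].
    by rewrite -vE ler_wpM2l // ltW.
  have H0 : H 0 = f p.
    by rewrite /H /barrier s0 subrr dot0l mulr0 subr0.
  have := vmax 0; rewrite normr0 ltW // H0 => /(_ isT) H0v.
  by have := lt_le_trans pf (le_trans H0v Hv); rewrite ltxx.
have [E [onE lagE grad trace]] := barrier_maximum sC rC x0 vr vmax.
have dist : enorm (F (s v) - F p) <= L * r.
  rewrite -s0; apply: le_trans (section_lipschitz sC rC L0 vball Dle) _.
  by apply: ler_wpM2l.
have c20 : 0 <= 2 * c by rewrite mulr_ge0 // ltW.
have small X : enorm X = 1 -> 2 * c * `|dot X (F (s v) - F p)| <= 2 * c * (L * r).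
  move=> X1; apply: ler_wpM2l => //; apply: le_trans (dot_le_enorm _ _) _.
  by rewrite X1 mul1r.
have E1 i : enorm (E i) = 1 by rewrite /enorm onE eqxx sqrtr1.
exists (s v), E; split=> //; first exact: strip.
  move=> i; have := grad i; rewrite dot_barrier_grad => /eqP; rewrite subr_eq0 => /eqP ->.
  rewrite normrM ger0_norm //; apply: le_trans (small _ (E1 i)) _.
  by apply: le_trans c_small; apply: ler_wpM2l => //; rewrite lerDr.
have VV : dot V V = 1 by rewrite -enorm_sqr V1 expr1n.
move: trace; rewrite dot_barrier_grad VV dotVW mulr0 mulr1 addr0.
have -> : \sum_i barrier_hess c (F (s v)) (E i) =
    l2 (x (s v)) * (\sum_i dot (E i) W ^+ 2) - 2 * c * m%:R.
  rewrite /barrier_hess big_split /= mulr_sumr; congr (_ + _).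
  rewrite sumrN; congr (- _); under eq_bigr => i _ do rewrite onE eqxx mulr1.
  by rewrite sumr_const card_ord [RHS]mulr_natr.
have sV := le_trans (ler_wpM2l c20 (ler_norm (dot V (F (s v) - F p)))) (small _ V1).
move: c_small sV; rewrite mulrDr.
exact: almost_maximum_arith.
Qed.

End AlmostMaximum.

(** * Translating solitons *)

Section LogCos.
Context {R : realType}.
Variable a : R.

Lemma is_derive_cosM (u : R) : is_derive u (1 : R) (fun u => cos (a * u)) (- (a * sin (a * u))).
Proof.
have Da : is_derive u (1 : R) (fun u : R => a * u) a.
  apply: is_derive_eq; by rewrite /GRing.scale /= mulr1.
by apply: (is_derive_eq (is_derive1_comp (is_derive_cos (a * u)) Da)); rewrite mulNr mulrC.
Qed.

Lemma is_derive_sinM (u : R) : is_derive u (1 : R) (fun u => sin (a * u)) (a * cos (a * u)).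
Proof.
have Da : is_derive u (1 : R) (fun u : R => a * u) a.
  apply: is_derive_eq; by rewrite /GRing.scale /= mulr1.
by apply: (is_derive_eq (is_derive1_comp (is_derive_sin (a * u)) Da)); rewrite mulrC.
Qed.

Lemma derive_log_cos (u : R) : 0 < cos (a * u) ->
  is_derive u (1 : R) (fun u => - ln (cos (a * u))) (a * (sin (a * u) / cos (a * u))) /\
  is_derive u (1 : R) (fun u => a * (sin (a * u) / cos (a * u))) (a ^+ 2 / cos (a * u) ^+ 2).
Proof.
move=> cpos; have cn0 : cos (a * u) != 0 by rewrite gt_eqF.
have Dc := is_derive_cosM u; have Ds := is_derive_sinM u.
split.
  have Dl := is_derive1_comp (is_derive1_ln cpos) Dc.
  by apply: (is_derive_eq (is_deriveN Dl)); field.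
have Dv : is_derive u (1 : R) (fun u => (cos (a * u))^-1) (a * sin (a * u) / cos (a * u) ^+ 2).
  have [dc cE] := Dc; apply: DeriveDef; first exact: derivableV.
  by rewrite deriveV // cE /GRing.scale /=; field.
apply: (is_derive_eq (is_deriveZ a (is_deriveM Ds Dv))).
have := cos2Dsin2 (a * u); rewrite /GRing.scale /=.
move: (cos (a * u)) (sin (a * u)) cn0 => c s cn0 cs.
have -> : a ^+ 2 / c ^+ 2 = a ^+ 2 * (c ^+ 2 + s ^+ 2) / c ^+ 2 by rewrite cs mulr1.
by field.
Qed.

End LogCos.

(** The contradiction at an almost maximum of -a y - log cos (a x): with the
    exact equations in place of the approximate ones, the tangential parts
    satisfy v = T w with T = tan (a x), so that the unit vector V has norm
    (1 + T^2) |w|^2 = 1, and the trace inequality reads a^2 <= a. *)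
Lemma tangent_secant_contradiction (R : realType) (n : nat) (v w : 'I_n -> R)
    (a c s k eta : R) :
  1 < a -> 0 < k -> k <= c -> c ^+ 2 + s ^+ 2 = 1 -> 0 < eta -> eta <= 1 ->
  eta * (1 + a ^+ 2 * (n%:R * (2 / k + 1))) < a ^+ 2 - a ->
  (forall i, `|w i| <= 1) ->
  \sum_i v i ^+ 2 + \sum_i w i ^+ 2 = 1 ->
  (forall i, `|- a * v i + a * (s / c) * w i| <= eta) ->
  - a + a ^+ 2 / c ^+ 2 * (\sum_i w i ^+ 2) <= eta -> False.
Proof.
move=> a1 k0 kc cs eta0 eta1 gap w1 vw grad trace.
have a0 : 0 < a by apply: lt_trans a1.
have c0 : 0 < c by apply: lt_le_trans kc.
pose T := s / c.
have s1 : `|s| <= 1.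
  rewrite -(ler_pXn2r (_ : 0 < 2)%N) ?nnegrE // expr1n real_normK ?num_real //.
  by rewrite -cs lerDr sqr_ge0.
have Tk : `|T| <= k^-1.
  rewrite /T normrM normfV (gtr0_norm c0) ler_pdivrMr //.
  by apply: le_trans s1 _; rewrite mulrC ler_pdivlMr // mul1r.
pose e i := v i - T * w i.
have e_le i : `|e i| <= eta.
  have := grad i; have -> : - a * v i + a * (s / c) * w i = - (a * e i) by rewrite /e /T; ring.
  rewrite normrN normrM gtr0_norm // => h.
  by apply: le_trans h; rewrite ler_peMl // ltW.
have v_le i : v i ^+ 2 <= T ^+ 2 * w i ^+ 2 + eta * (2 / k + 1).
  have -> : v i ^+ 2 = T ^+ 2 * w i ^+ 2 + (2 * (T * w i * e i) + e i ^+ 2) by rewrite /e; ring.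
  rewrite lerD2l [leRHS]mulrDr; apply: lerD.
    rewrite [leRHS]mulrCA ler_pM2l //; apply: le_trans (ler_norm _) _.
    rewrite normrM [leRHS]mulrC; apply: ler_pM => //.
    by rewrite normrM -[leRHS]mulr1; apply: ler_pM.
  rewrite mulr1 -real_normK ?num_real // expr2 -[leRHS]mulr1.
  by apply: ler_pM => //; apply: le_trans (e_le i) eta1.
have V_le : \sum_i v i ^+ 2 <= T ^+ 2 * (\sum_i w i ^+ 2) + n%:R * (eta * (2 / k + 1)).
  have -> : n%:R * (eta * (2 / k + 1)) = \sum_(i < n) eta * (2 / k + 1).
    by rewrite sumr_const card_ord [LHS]mulr_natl.
  by rewrite mulr_sumr -big_split; apply: ler_sum => i _; apply: v_le.
have secE : a ^+ 2 / c ^+ 2 = a ^+ 2 * (1 + T ^+ 2).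
  transitivity (a ^+ 2 * (c ^+ 2 + s ^+ 2) / c ^+ 2); first by rewrite cs mulr1.
  by rewrite /T; field; rewrite gt_eqF.
move: vw V_le trace gap; rewrite secE.
move: (\sum_i v i ^+ 2) (\sum_i w i ^+ 2) => X N.
clear - a0; move: (n%:R * (2 / k + 1)) (mulrCA n%:R eta (2 / k + 1)) => Q ->.
move: (T ^+ 2) => T2 vw V_le trace gap.
have h : a ^+ 2 * 1 <= a ^+ 2 * ((1 + T2) * N + eta * Q).
  by apply: ler_wpM2l; [apply: sqr_ge0|lra].
lra.
Qed.

Theorem theoremC (R : realType) (m : nat) (M : topologicalType)
    (F : M -> Cspace R m) (V : Cspace R m) (epsilon : R)
    (hlag : lagrangian F)
    (hcomplete : complete_submanifold F)
    (hzero : exists p0 : M, F p0 = 0)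
    (hV : enorm V = 1)
    (hsoliton : translating_soliton F m V)
    (hA : bounded_second_form F m) :
  let y := fun p : M => dot V (F p) in
  let x := fun p : M => dot (- Jmul V) (F p) in
  let alpha := x in
  0 < epsilon ->
  (forall p : M, epsilon <= cos (alpha p)) ->
  ~ has_ubound (range y) /\ ~ has_lbound (range y).
Proof.
move=> y x alpha eps0 cos_ge.
have [p0 Fp0] := hzero.
have xE p : dot (F p) (- Jmul V) = x p by rewrite dotC.
have yE p : dot (F p) V = y p by rewrite dotC.
have xp0 : x p0 = 0 by rewrite /x Fp0 dot0r.
have eps1 : -1 <= epsilon <= 1.
  have := cos_ge p0; rewrite /alpha xp0 cos0 => ->; rewrite andbT.
  by apply: le_trans (ltW eps0); rewrite oppr_le0.
pose beta := acos epsilon.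
have pi0 := pi_gt0 R.
have beta_pi : beta \in `[0, pi] by rewrite in_itv /= acos_ge0 //= acos_lepi.
have beta0 : 0 <= beta by rewrite acos_ge0.
have cos_beta : cos beta = epsilon by rewrite acosK // in_itv.
have beta_half : beta < pi / 2.
  rewrite -ltr_cos //; first by rewrite cos_beta cos_pihalf.
  by rewrite in_itv /=; apply/andP; split; lra.
(* |x| is at most beta < pi/2; this a > 1 leaves a |x| < pi/2 up to u0, the
   middle of beta and pi/2. *)
pose a := pi / (pi / 2 + beta).
have den0 : 0 < pi / 2 + beta by lra.
have a1 : 1 < a by rewrite /a ltr_pdivlMr // mul1r; lra.
have a0 : 0 < a by apply: lt_trans a1.
pose u0 := (pi / 2 + beta) / 2.
have beta_u0 : beta < u0 by rewrite /u0; lra.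
have au0 : a * u0 = pi / 2 by rewrite /a /u0 mulrA divfK // gt_eqF.
have x_gap p : `|dot (F p) (- Jmul V)| < u0 -> `|dot (F p) (- Jmul V)| <= beta.
  rewrite xE => xp; rewrite leNgt; apply/negP => xbeta.
  have xpi : `|x p| \in `[0, pi].
    by rewrite in_itv /= normr_ge0 /=; move: xp; rewrite /u0; lra.
  have : cos `|x p| < cos beta by rewrite ltr_cos.
  by rewrite cos_norm cos_beta ltNge cos_ge.
have strip0 : exists p, `|dot (F p) (- Jmul V)| < u0.
  by exists p0; rewrite xE xp0 normr0; apply: le_lt_trans beta_u0.
have cpos (u : R) : `|u| < u0 -> 0 < cos (a * u).
  move=> uu; apply: cos_gt0_pihalf; rewrite -ltr_norml -au0 normrM (gtr0_norm a0).
  by rewrite ltr_pM2l.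
split.
  (* For b = 1 and l = 0 the trace inequality reads 1 <= eta: this is L y = 1. *)
  move=> [B yB].
  have d0 (u : R) : `|u| < u0 ->
    is_derive u (1 : R) (fun _ : R => 0 : R) 0 /\ is_derive u (1 : R) (fun _ : R => 0 : R) 0.
    by move=> _; split; apply: is_derive_cst.
  have half : 0 < 2^-1 :> R by rewrite invr_gt0.
  have [|q [E [_ _ _ _]]] := almost_maximum hlag hsoliton hcomplete hA hV beta_u0 (b := 1)
    (l := fun=> 0) (l1 := fun=> 0) (l2 := fun=> 0) d0 x_gap half strip0.
    by exists B => q _ /=; rewrite mul1r addr0 yE; apply: yB; exists q.
  by rewrite /= mul0r addr0; lra.
move=> [B yB].
pose k := cos (a * beta).
have k0 : 0 < k by apply: cpos; rewrite ger0_norm.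
have cos_k p : `|x p| < u0 -> k <= cos (a * x p).
  move=> xp; have xb : `|x p| <= beta by have := x_gap p; rewrite xE; apply.
  rewrite -[cos (a * x p)]cos_norm normrM (gtr0_norm a0) leNgt.
  have abeta : a * beta \in `[0, pi].
    rewrite in_itv /= mulr_ge0 ?(ltW a0) //=.
    apply: le_trans (_ : a * u0 <= _); first by rewrite ler_wpM2l // ltW.
    by rewrite au0; lra.
  have ax : a * `|x p| \in `[0, pi].
    rewrite in_itv /= mulr_ge0 ?(ltW a0) //=; move: abeta; rewrite in_itv /= => /andP[_].
    by apply: le_trans; rewrite ler_wpM2l // ltW.
  by rewrite ltr_cos // -leNgt ler_wpM2l // ltW.
pose Q := 1 + a ^+ 2 * (m%:R * (2 / k + 1)).
have Q0 : 0 < Q.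
  by rewrite ltr_wpDr // mulr_ge0 ?sqr_ge0 // mulr_ge0 // addr_ge0 // divr_ge0 // ltW.
have aa : 0 < a ^+ 2 - a by rewrite expr2 -{3}[a]mulr1 -mulrBr mulr_gt0 // subr_gt0.
pose eta := Num.min 1 ((a ^+ 2 - a) / (2 * Q)).
have eta0 : 0 < eta by rewrite lt_min ltr01 divr_gt0 // mulr_gt0.
have eta1 : eta <= 1 by rewrite ge_min lexx.
have gap : eta * Q < a ^+ 2 - a.
  apply: (@le_lt_trans _ _ ((a ^+ 2 - a) / 2)).
    rewrite -ler_pdivlMr // -mulrA -invfM ge_min lexx orbT //.
  by rewrite ltr_pdivrMr // ltr_pMr // ltr1n.
have [|q [E [xq onE lagE grad trace]]] := almost_maximum hlag hsoliton hcomplete hA hV beta_u0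
    (b := - a) (fun u uu => derive_log_cos (cpos u uu)) x_gap eta0 strip0.
  exists (- a * B - ln k) => q xq /=; rewrite /= xE in xq; rewrite yE xE.
  apply: lerD.
    by rewrite !mulNr lerN2 ler_wpM2l ?(ltW a0) //; apply: yB; exists q.
  by rewrite lerN2 ler_ln ?posrE ?cos_k // cpos.
rewrite /= xE in xq grad trace.
have WE i : dot (E i) (- Jmul V) ^+ 2 = dot (Jmul V) (E i) ^+ 2.
  by rewrite dotNr sqrrN dotC.
have parseval : \sum_i dot (E i) V ^+ 2 + \sum_i dot (E i) (- Jmul V) ^+ 2 = 1.
  have := lagrangian_parseval onE lagE V; rewrite -enorm_sqr hV expr1n => <-.
  by congr (_ + _); apply: eq_bigr => i _; rewrite ?WE // dotC.
have W1 i : `|dot (E i) (- Jmul V)| <= 1.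
  apply: le_trans (dot_le_enorm _ _) _.
  by rewrite enormN /enorm onE eqxx sqrtr1 mul1r Jmul_dot -/(enorm V) hV.
exact: (tangent_secant_contradiction a1 k0 (cos_k q xq) (cos2Dsin2 _) eta0 eta1 gap
  W1 parseval grad trace).
Qed.
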